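(* Let $A:\mathbb{R}\to M_n(\mathbb{R})$ be bounded and continuous, let $f:\mathbb{R}\times\mathbb{R}^n\to\mathbb{R}^n$ be continuous, let $\Psi(t,s)$ be the transition matrix of $y'=A(t)y$ and let $\phi(t,t_0,\xi)$ denote the solution of $x'=A(t)x+f(t,x)$ passing through $\xi$ at $t=t_0$. Assume: (H1) There is a constant $\mu$ with $|f(t,x)|\le \mu$ for all $t\in\mathbb{R}$, $x\in\mathbb{R}^n$. (H2) There is a constant $\gamma$ with $|f(t,x_1)-f(t,x_2)|\le \gamma|x_1-x_2|$ for all $t\in\mathbb{R}$, $x_1,x_2\in\mathbb{R}^n$. (H3) There are constants $K\ge 1$ and $\alpha>0$ with $\|\Psi(t,s)\|\le Ke^{-\alpha(t-s)}$ for all $t\ge s$. (H4) $\gamma\le \alpha/(4K)$. (H5) $f(t,0)=0$ for all $t\in\mathbb{R}$. (D1) $f$ is of class $C^2$ and, for every fixed $t\in\mathbb{R}$ and every $\xi\in\mathbb{R}^n$, $$\int_{-\infty}^{t}\big\|\Psi(t,r)\,Df(r,\phi(r,0,\xi))\,\Psi(r,t)\big\|_\infty\,dr<1 .$$ (D2) For every fixed $t\in\mathbb{R}$ and every $\xi\in\mathbb{R}^n$, $$\liminf_{s\to-\infty}\Big(-\int_s^t \operatorname{Tr}A(r)\,dr\Big)>-\infty\quad\text{and}\quad \liminf_{s\to-\infty}\Big(-\int_s^t \operatorname{Tr}\{A(r)+Df(r,\phi(r,0,\xi))\}\,dr\Big)>-\infty .$$ (D3) For every fixed $t\in\mathbb{R}$,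 every $\xi\in\mathbb{R}^n$ and all $i,j\in\{1,\dots,n\}$, with $x(t)=(x_1(t),\dots,x_n(t))=\phi(t,0,\xi)$, the limit $$\lim_{s\to-\infty}\frac{\partial Z(s,x(t))}{\partial x_j(t)}\,e_i$$ exists, where $e_i$ is the $i$-th vector of the canonical basis of $\mathbb{R}^n$ and $s\mapsto Z(s,x(t))$ is the fundamental matrix, with $Z(t,x(t))=I$, of the parameter dependent linear system $z'=F(s,x(t))z$ (derivative with respect to $s$), with $$F(r,x(t))=\Psi(t,r)\,Df(r,\phi(r,t,x(t)))\,\Psi(r,t).$$ Let $H:\mathbb{R}\times\mathbb{R}^n\to\mathbb{R}^n$ be the Palmer map of this pair of systems and let $\rho:\mathbb{R}\times(\mathbb{R}^n\setminus\{0\})\to[0,+\infty)$ be a ($C^1$) density function associated to $y'=A(t)y$ (see context). Then there exists a density function $\bar\rho\in C(\mathbb{R}\times(\mathbb{R}^n\setminus\{0\}),[0,+\infty))$ associated to $x'=A(t)x+f(t,x)$, defined by $$\bar\rho(t,x)=\rho(t,H(t,x))\,\det\Big(\frac{\partial H(t,x)}{\partial x}\Big).$$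
   Context: $|\cdot|$ is a norm on $\mathbb{R}^n$ and $\|\cdot\|$ a corresponding matrix norm; $\|\cdot\|_\infty$ is the matrix norm induced by the max norm. $\operatorname{Tr}$ denotes the trace and $I$ the identity matrix. The transition matrix is $\Psi(t,s)=\Psi(t)\Psi^{-1}(s)$, where $\Psi(t)$ is a fundamental matrix of $y'=A(t)y$. $Df(t,x)$ denotes the Jacobian matrix of $f$ with respect to $x$. In (D3), $t$ is fixed, $F(r,\cdot)$ and $Z(s,\cdot)$ are regarded as functions of the parameter $x(t)\in\mathbb{R}^n$ (the value at time $t$ of the solution), and $\partial/\partial x_j(t)$ is the partial derivative with respect to its $j$-th coordinate. Palmer map: by a known theorem of Palmer, under (H1)--(H4) there exists a unique function $H:\mathbb{R}\times\mathbb{R}^n\to\mathbb{R}^n$ such that (i) $H(t,x)-x$ is bounded on $\mathbb{R}\times\mathbb{R}^n$, and (ii) if $t\mapsto x(t)$ is a solution of $x'=A(t)x+f(t,x)$, then $t\mapsto H(t,x(t))$ is a solution of $y'=A(t)y$. Moreover $H$ is continuous and $x\mapsto H(t,x)$ is a homeomorphism of $\mathbb{R}^n$ for each fixed $t$. This $H$ is the Palmer map; under (H1)--(H4) and (D1)--(D3) the paper takes $x\mapsto H(t,x)$ to be a $C^2$ orientation preserving diffeomorphism (positive Jacobian determinant) for each fixed $t$. Density function: consider a system $z'=g(t,z)$ with $g(t,0)=0$ for all $t\in\mathbb{R}$, where $g:\mathbb{R}\times\mathbb{R}^n\to\mathbb{R}^n$ is such that existence, uniqueness and unbounded continuation of solutions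 hold. A density function of this system is a $C^1$ function $\rho:\mathbb{R}\times(\mathbb{R}^n\setminus\{0\})\to[0,+\infty)$ which is integrable outside a ball centered at the origin (that is, for each fixed $t$, $\rho(t,\cdot)$ is integrable outside any open ball centered at the origin) and satisfies $$\frac{\partial\rho(t,z)}{\partial t}+\nabla\cdot[\rho(t,z)g(t,z)]>0$$ for every $t\in\mathbb{R}$ and almost every $z\in\mathbb{R}^n$, where $\nabla\cdot[\rho g]=\nabla\rho\cdot g+\rho\,[\nabla\cdot g]$, with $\nabla\rho$ the gradient of $\rho$ and $\nabla\cdot g$ the divergence of $g$ with respect to $z$. Known result (Monzón): if $y'=A(t)y$ is globally asymptotically stable (which is implied by (H3)), then it has a $C^1$ density function $\rho:\mathbb{R}\times(\mathbb{R}^n\setminus\{0\})\to[0,+\infty)$. *)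

(* Defs.v *)
From HB Require Import structures.
From mathcomp Require Import all_boot all_order all_algebra.
From mathcomp Require Import all_classical all_reals all_analysis.

Set Implicit Arguments.
Unset Strict Implicit.
Unset Printing Implicit Defensive.

Import Order.TTheory GRing.Theory Num.Theory.
Import numFieldNormedType.Exports.

Local Open Scope classical_set_scope.
Local Open Scope ring_scope.

(* R^n is 'cV[R]_n with the product sigma-algebra, which is also the Borel one. *)
Section measurable_cV.
Variables (R : realType) (n : nat).

Let coord : 'I_n -> 'cV[R]_n -> R := fun i x => x i 0.

Let cV_set0 : g_sigma_preimage coord set0.
Proof. exact: sigma_algebra0. Qed.

Let cV_setC A : g_sigma_preimage coord A -> g_sigma_preimage coord (~` A).
Proof. exact: sigma_algebraC. Qed.

Let cV_bigcup (F : (set 'cV[R]_n)^nat) :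
  (forall i, g_sigma_preimage coord (F i)) ->
  g_sigma_preimage coord (\bigcup_i (F i)).
Proof. exact: sigma_algebra_bigcup. Qed.

HB.instance Definition _ :=
  @isMeasurable.Build default_measure_display 'cV[R]_n
    (g_sigma_preimage coord) cV_set0 cV_setC cV_bigcup.

Lemma measurable_coord (i : 'I_n) :
  measurable_fun [set: 'cV[R]_n] (fun x => x i 0).
Proof.
move=> _ Y mY; rewrite setTI; apply: sub_sigma_algebra => /=.
rewrite -bigcup_seq/=; exists i => /=; first by rewrite mem_index_enum.
by exists Y => //; rewrite setTI.
Qed.

Lemma measurable_fun_cVP d (T : measurableType d) (f : T -> 'cV[R]_n) :
  (forall i, measurable_fun setT (fun x => f x i 0)) -> measurable_fun setT f.
Proof.
move=> mf.
have : g_sigma_preimage (fun i => coord i \o f) `<=` measurable.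
  apply: smallest_sub; first exact: sigma_algebra_measurable.
  rewrite -bigcup_seq; apply: bigcup_sub => i _.
  by move=> A [B mB <-]; exact: mf.
by rewrite g_sigma_preimage_comp => preS _ A mA; apply: preS; exists A.
Qed.

End measurable_cV.

Section lebesgue_cV.
Context {R : realType}.

Definition cV_cons n (p : R * 'cV[R]_n) : 'cV[R]_n.+1 :=
  \col_(i < n.+1) if unlift ord0 i is Some j then p.2 j 0 else p.1.

(* n-dimensional Lebesgue measure: the n-fold product of the one on R *)
Fixpoint lebesgue_cV (n : nat) : set 'cV[R]_n -> \bar R :=
  match n with
  | 0 => dirac (0 : 'cV[R]_0)
  | m.+1 => fun A =>
      ((@lebesgue_measure R) \x (@lebesgue_cV m))%E (@cV_cons m @^-1` A)
  end.

Lemma cV_cons0 n p : @cV_cons n p ord0 0 = p.1.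
Proof. by rewrite mxE unlift_none. Qed.

Lemma cV_consS n p j : @cV_cons n p (lift ord0 j) 0 = p.2 j 0.
Proof. by rewrite mxE liftK. Qed.

Lemma measurable_cV_cons n : measurable_fun setT (@cV_cons n).
Proof.
apply: measurable_fun_cVP => i; case: (unliftP ord0 i) => [j|] ->.
  under eq_fun do rewrite cV_consS.
  exact: (measurableT_comp (measurable_coord j)).
under eq_fun do rewrite cV_cons0.
exact: measurable_fst.
Qed.


Section step.
Variables (n : nat) (mu : {sigma_finite_measure set 'cV[R]_n -> \bar R}).

Let nu (A : set 'cV[R]_n.+1) :=
  ((@lebesgue_measure R) \x mu)%E (@cV_cons n @^-1` A).

Let meas_pre A : measurable A -> measurable (@cV_cons n @^-1` A).
Proof. by move=> mA; rewrite -[X in measurable X]setTI; exact: measurable_cV_cons. Qed.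

Let nu0 : nu set0 = 0%E.
Proof. by rewrite /nu preimage_set0 measure0. Qed.

Let nu_ge0 A : (0 <= nu A)%E.
Proof. exact: measure_ge0. Qed.

Let nu_sigma : semi_sigma_additive nu.
Proof.
move=> F mF tF mUF; rewrite /nu preimage_bigcup.
apply: measure_semi_sigma_additive.
- by move=> i; exact: meas_pre.
- apply/trivIsetP => /= i j _ _ ij; rewrite -preimage_setI.
  by move/trivIsetP : tF => /(_ _ _ _ _ ij) ->//; rewrite preimage_set0.
- by rewrite -preimage_bigcup; exact: meas_pre.
Qed.

HB.instance Definition _ := isMeasure.Build _ _ _ nu nu0 nu_ge0 nu_sigma.

Let uncons (x : 'cV[R]_n.+1) : R * 'cV[R]_n :=
  (x ord0 0, \col_j x (lift ord0 j) 0).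

Let cV_consK : cancel (@cV_cons n) uncons.
Proof.
move=> [a x]; rewrite /uncons cV_cons0; congr pair.
by apply/colP => j; rewrite mxE cV_consS.
Qed.

Let measurable_uncons : measurable_fun setT uncons.
Proof.
apply/measurable_fun_pairP; split; first exact: measurable_coord.
apply: measurable_fun_cVP => j /=; under eq_fun do rewrite mxE.
exact: measurable_coord.
Qed.

Let nu_fin : sigma_finite setT nu.
Proof.
have /sigma_finiteP[F [FT ndF Foo]] := sigma_finiteT (@lebesgue_measure R).
have /sigma_finiteP[G [GT ndG Goo]] := sigma_finiteT mu.
exists (fun k => uncons @^-1` (F k `*` G k)).
  apply/seteqP; split=> // x _.
  have [i _ Fi] : (\bigcup_k F k) (uncons x).1 by rewrite -FT.
  have [j _ Gj] : (\bigcup_k G k) (uncons x).2 by rewrite -GT.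
  exists (maxn i j) => //; split.
    by move: Fi; exact/subsetPset/ndF/leq_maxl.
  by move: Gj; exact/subsetPset/ndG/leq_maxr.
move=> k; have [mF Fk] := Foo k; have [mG Gk] := Goo k; split.
  rewrite -[X in measurable X]setTI; apply: measurable_uncons => //.
  exact: measurableX.
rewrite /nu -comp_preimage (_ : uncons \o _ = id); last exact/funext.
by rewrite preimage_id product_measure1E// lte_mul_pinfty// ge0_fin_numE.
Qed.

HB.instance Definition _ := Measure_isSigmaFinite.Build _ _ _ nu nu_fin.

Lemma lebesgue_cV_step :
  {m : {sigma_finite_measure set 'cV[R]_n.+1 -> \bar R} | m = nu :> (set _ -> _)}.
Proof. by exists nu. Qed.

End step.

Lemma lebesgue_cV_sigma_finite n :
  {m : {sigma_finite_measure set 'cV[R]_n -> \bar R} |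
     m = @lebesgue_cV n :> (set _ -> _)}.
Proof.
elim: n => [|n [m mE]]; first by exists (dirac (0 : 'cV[R]_0)).
by have [m' m'E] := lebesgue_cV_step m; exists m'; rewrite m'E mE.
Qed.

Section instances.
Variable n : nat.

Let leb0 : @lebesgue_cV n set0 = 0%E.
Proof. by have [m <-] := lebesgue_cV_sigma_finite n; exact: measure0. Qed.

Let leb_ge0 A : (0 <= @lebesgue_cV n A)%E.
Proof. by have [m <-] := lebesgue_cV_sigma_finite n; exact: measure_ge0. Qed.

Let leb_sigma : semi_sigma_additive (@lebesgue_cV n).
Proof.
have [m <-] := lebesgue_cV_sigma_finite n.
exact: measure_semi_sigma_additive.
Qed.

HB.instance Definition _ :=
  isMeasure.Build _ _ _ (@lebesgue_cV n) leb0 leb_ge0 leb_sigma.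

Let leb_fin : sigma_finite setT (@lebesgue_cV n).
Proof. by have [m <-] := lebesgue_cV_sigma_finite n; exact: sigma_finiteT. Qed.

HB.instance Definition _ :=
  Measure_isSigmaFinite.Build _ _ _ (@lebesgue_cV n) leb_fin.

End instances.

Lemma lebesgue_cV_box n (a b : 'cV[R]_n) : (forall i, a i 0 <= b i 0) ->
  lebesgue_cV [set x | forall i, a i 0 < x i 0 <= b i 0] =
  (\prod_i (b i 0 - a i 0))%:E.
Proof.
elim: n a b => [|n IH] a b ab /=.
  by rewrite big_ord0 diracE mem_set// => -[].
pose tl (v : 'cV[R]_n.+1) : 'cV[R]_n := \col_j v (lift ord0 j) 0.
have -> : @cV_cons n @^-1` [set x | forall i, a i 0 < x i 0 <= b i 0] =
  `]a ord0 0, b ord0 0]%classic `*`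
  [set x : 'cV[R]_n | forall i, tl a i 0 < x i 0 <= tl b i 0].
  apply/seteqP; split => [[u x] /= h|[u x] [/= hu hx] i].
    split=> [|i]; first by have := h ord0; rewrite cV_cons0 in_itv.
    by have := h (lift ord0 i); rewrite cV_consS !mxE.
  case: (unliftP ord0 i) => [j|] ->; last by rewrite cV_cons0; rewrite in_itv in hu.
  by have := hx j; rewrite cV_consS !mxE.
rewrite product_measure1E//; last first.
  set B := (X in measurable X).
  have -> : B = \bigcap_(i in [set: 'I_n]) ((fun x : 'cV[R]_n => x i 0) @^-1`
      `]a (lift ord0 i) 0, b (lift ord0 i) 0]%classic).
    apply/seteqP; split=> [x h i _|x h i] /=.
      by have := h i; rewrite !mxE in_itv.
    by have := h i I; rewrite /= in_itv !mxE.
  apply: fin_bigcap_measurable => // i _; rewrite -[X in measurable X]setTI.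
  exact: measurable_coord.
rewrite [X in (_ * X)%E](IH (tl a) (tl b)); last by move=> i; rewrite !mxE.
rewrite [X in (X * _)%E](@lebesgue_measure_itv R `]a ord0 0, b ord0 0]).
rewrite /= lte_fin big_ord_recl EFinM.
congr (_ * _)%E; last by congr EFin; apply: eq_bigr => i _; rewrite !mxE.
have := ab ord0; rewrite le_eqVlt => /predU1P[->|->]; last by rewrite EFinB.
by rewrite ltxx subrr.
Qed.

End lebesgue_cV.

Section calculus.
Context {R : realType}.

(* C^k on an open set U. In finite dimension a map is C^{k+1} iff it is
   differentiable with all directional derivatives of class C^k. *)
Fixpoint Ck_on (V W : normedModType R) (k : nat) (U : set V) (g : V -> W) :=
  match k with
  | 0 => forall x, U x -> {for x, continuous g}
  | m.+1 => (forall x, U x -> differentiable g x) /\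
            forall v, Ck_on m U ('D_v g)
  end.

Variable n : nat.
Implicit Types (g h : 'cV[R]_n -> 'cV[R]_n) (p : 'cV[R]_n -> R).

Definition basis_vec (i : 'I_n) : 'cV[R]_n := delta_mx i 0.

(* The library's jacobian is for row vectors and is the transpose of this. *)
Definition jacobian_mx g (x : 'cV[R]_n) : 'M[R]_n :=
  \matrix_(i, j) ('D_(basis_vec j) (fun y => g y i 0) x).

Definition gradient p (x : 'cV[R]_n) : 'cV[R]_n :=
  \col_i 'D_(basis_vec i) p x.

Definition divergence g (x : 'cV[R]_n) : R :=
  \sum_i 'D_(basis_vec i) (fun y => g y i 0) x.

(* div (p g) = grad p . g + p div g *)
Definition divergence_mul p g (x : 'cV[R]_n) : R :=
  ((gradient p x)^T *m g x) 0 0 + p x * divergence g x.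

Definition C2_orientation_preserving_diffeo h :=
  [/\ Ck_on 2 setT h,
      exists h', [/\ cancel h h', cancel h' h & Ck_on 2 setT h'] &
      forall x, 0 < \det (jacobian_mx h x)].

End calculus.

Section norms.
Context {R : realType}.

Definition is_norm (V : lmodType R) (N : V -> R) :=
  [/\ forall x y, N (x + y) <= N x + N y,
      forall a x, N (a *: x) = `|a| * N x &
      forall x, N x = 0 -> x = 0].

(* Compatible with the vector norm; the induced operator norm is one example. *)
Definition corresponding_mx_norm n (N : 'cV[R]_n -> R) (M : 'M[R]_n -> R) :=
  [/\ is_norm M,
      forall A B, M (A *m B) <= M A * M B &
      forall A x, N (A *m x) <= M A * N x].

(* On the right-hand side `|_| is the library norm of 'cV[R]_n: the max norm. *)
Definition mx_norm_infty n (A : 'M[R]_n) : R :=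
  sup [set `|A *m x| | x in [set x : 'cV[R]_n | `|x| <= 1]].

End norms.

Section systems.
Context {R : realType} {n : nat}.
Implicit Types (g : R -> 'cV[R]_n -> 'cV[R]_n) (A : R -> 'M[R]_n).

Definition solution_on (J : set R) g (x : R -> 'cV[R]_n) :=
  forall t : R, J t -> is_derive t 1 x (g t (x t)).

Definition linear_system A : R -> 'cV[R]_n -> 'cV[R]_n :=
  fun t y => A t *m y.

Definition perturbed_system A f : R -> 'cV[R]_n -> 'cV[R]_n :=
  fun t x => A t *m x + f t x.

Definition fundamental_matrix A (Psi : R -> 'M[R]_n) :=
  forall t : R, is_derive t 1 Psi (A t *m Psi t) /\ Psi t \in unitmx.

Definition transition_mx (Psi : R -> 'M[R]_n) (t s : R) : 'M[R]_n :=
  Psi t *m invmx (Psi s).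

(* phi t t0 xi is the value at t of the solution through xi at t0. *)
Definition general_solution g (phi : R -> R -> 'cV[R]_n -> 'cV[R]_n) :=
  forall t0 xi, solution_on setT g (fun t => phi t t0 xi) /\ phi t0 t0 xi = xi.

Definition palmer_map (N : 'cV[R]_n -> R) A f (H : R -> 'cV[R]_n -> 'cV[R]_n) :=
  (exists M, forall t x, N (H t x - x) <= M) /\
  forall x, solution_on setT (perturbed_system A f) x ->
    solution_on setT (linear_system A) (fun t => H t (x t)).

(* Equilibrium at 0, and existence, uniqueness and unbounded continuation of
   solutions: every initial value problem has a solution on the whole line, and
   it agrees with any solution on a smaller open interval. *)
Definition admissible_system g :=
  [/\ forall t, g t 0 = 0,
      forall t0 z0, exists z, solution_on setT g z /\ z t0 = z0 &
      forall a b t0 z w, t0 \in `]a, b[ ->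
        solution_on `]a, b[%classic g z -> solution_on `]a, b[%classic g w ->
        z t0 = w t0 -> forall t, t \in `]a, b[ -> z t = w t].

(* The values rho t 0 are irrelevant. Balls are for the max norm; as the radius
   is arbitrary, integrability outside balls does not depend on the norm. *)
Definition density_function g (rho : R -> 'cV[R]_n -> R) :=
  [/\ admissible_system g,
      Ck_on 1 [set p : R * 'cV[R]_n | p.2 != 0] (fun p => rho p.1 p.2),
      forall t z, z != 0 -> 0 <= rho t z,
      forall t r, 0 < r ->
        (@lebesgue_cV R n).-integrable (~` ball (0 : 'cV[R]_n) r)
          (fun z => (rho t z)%:E) &
      forall t, {ae @lebesgue_cV R n, forall z,
        0 < derive1 (rho ^~ z) t + divergence_mul (rho t) (g t) z}].

(* F(r, x) for a fixed t; x is the value at time t of the solution. *)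
Definition param_coef (Psi : R -> 'M[R]_n) f
    (phi : R -> R -> 'cV[R]_n -> 'cV[R]_n) (t r : R) (x : 'cV[R]_n) : 'M[R]_n :=
  transition_mx Psi t r *m jacobian_mx (f r) (phi r t x) *m
  transition_mx Psi r t.

End systems.

(* Main.v *)
(* The Palmer map conjugates the flows: phi t s = H_t^-1 \o U(t, s) \o H_s, where
   U is the transition matrix of the linear system. As every H_t is a C^2
   diffeomorphism, the flow of the perturbed system is C^2 in x, and the only
   regularity to prove is the one in t. It comes from the reverse identity
   H_s = U(s, t) *m H_t \o phi t s: Gronwall estimates for phi t s - id and for
   \det D(phi t s) - 1 as s -> t give
     d/dt H = A H - D_g H,   d/dt h = (tr A - div g) h - D_g h,  h = \det D_x H,
   with g = A x + f, and then joint C^1 regularity of H and h. By the chain rule,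
   for rho' t x = rho t (H t x) * h t x,
     d/dt rho' + div (rho' g) = h * (d/dt rho + div (rho A y)) at y = H t x.
   Integrability and the almost everywhere inequality are transported by the
   change of variables y = H t x, whose density is h. *)

(* The obstacle is that [A] is only continuous, so the field is not C^1 in [t], while [h] already
   contains first derivatives of [H]; classical smooth dependence does not give a C^1 density. In
   the reverse identity [t] is frozen at the point under study, so all that varies with [s] is
   [U s t], the flow and its Jacobian near coinciding times, where they are close to the identity;
   the rest is spatial regularity of the single map [H t]. Joint continuity of the x-derivative of
   [h] involves second derivatives of the flow; Liouville's formula controls them by a local
   Lipschitz constant of the divergence, available because [f] is C^2. The origin needs care, since
   [rho] is controlled only away from it: [H t 0] is a solution, bounded on the whole line, of an
   exponentially stable linear system, hence zero. In the change of variables, differentiability of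
   the map and of its inverse traps the image of a small box between two parallelepipeds, and
   bisection makes this local estimate global. *)
Require Import Defs.
From HB Require Import structures.
From mathcomp Require Import all_boot all_order all_algebra.
From mathcomp Require Import all_classical all_reals all_analysis.
From mathcomp Require Import measurable_realfun perm ring lra.

Set Implicit Arguments.
Unset Strict Implicit.
Unset Printing Implicit Defensive.

Import Order.TTheory GRing.Theory Num.Theory.
Import numFieldNormedType.Exports.

Local Open Scope classical_set_scope.
Local Open Scope ring_scope.

(** * Lebesgue measure on column vectors *)

Section linear_change.
Context {R : realType}.
Notation mu := (@lebesgue_measure R).

Lemma lebesgue_measure_addr (c : R) (A : set R) : measurable A ->
  mu ((fun x => x + c) @^-1` A) = mu A.
Proof.
move=> mA; have mf : measurable_fun [set: measurableTypeR R]
    ((fun x => x + c) : measurableTypeR R -> measurableTypeR R).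
  by apply: measurable_funD => //; exact: measurable_cst.
have H := @lebesgue_measure_unique R (pushforward mu
  ((fun x => x + c) : measurableTypeR R -> measurableTypeR R)).
apply/esym; apply: H => // _ [[a b]] _ <- /=; rewrite /pushforward.
rewrite (_ : _ @^-1` _ = `]a - c, b - c]%classic); last first.
  by apply/seteqP; split=> x /=; rewrite !in_itv/= ltrBlDr lerBrDr.
rewrite !lebesgue_measure_itv/= !lte_fin ltrD2r.
by case: ifP => // _; rewrite -!EFinD; congr EFin; ring.
Qed.

Lemma lebesgue_measure_mull (a : R) (A : set R) : a != 0 -> measurable A ->
  (mu ((fun x => (a * x)%R) @^-1` A) * `|a|%:E)%E = mu A.
Proof.
move=> a0 mA; have mf : measurable_fun [set: measurableTypeR R]
    ((fun x => a * x) : measurableTypeR R -> measurableTypeR R).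
  by apply: measurable_funM => //; exact: measurable_cst.
have na0 : 0 <= `|a| by [].
have H := @lebesgue_measure_unique R (mscale (NngNum na0) (pushforward mu
  ((fun x => a * x) : measurableTypeR R -> measurableTypeR R))).
rewrite muleC; apply/esym; apply: H => // _ [[x y]] _ <-.
rewrite -[RHS]/(`|a|%:E * mu ((fun x => (a * x)%R) @^-1` `]x, y]%classic))%E.
have [a_gt0|a_lt0|/eqP] := ltgtP 0 a; last by rewrite eq_sym (negbTE a0).
- rewrite (_ : _ @^-1` _ = `]x / a, y / a]%classic); last first.
    by apply/seteqP; split=> z /=; rewrite !in_itv/= ltr_pdivrMr// ler_pdivlMr// mulrC.
  rewrite !lebesgue_measure_itv/= !lte_fin ltr_pM2r ?invr_gt0//.
  case: ifP => // _; last by rewrite mule0.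
  by rewrite -!EFinD -EFinM gtr0_norm//; congr EFin; field.
- rewrite (_ : _ @^-1` _ = `[y / a, x / a[%classic); last first.
    apply/seteqP; split=> z /=; rewrite !in_itv/= ltr_ndivlMr// ler_ndivrMr// mulrC.
      by move=> /andP[-> ->].
    by move=> /andP[-> ->].
  rewrite !lebesgue_measure_itv/= !lte_fin ltr_nM2r ?invr_lt0//.
  case: ifP => // _; last by rewrite mule0.
  by rewrite -!EFinD -EFinM ltr0_norm//; congr EFin; field.
Qed.

Lemma lebesgue_cVS n (A : set 'cV[R]_n.+1) :
  lebesgue_cV A = (mu \x (@lebesgue_cV R n))%E (@cV_cons R n @^-1` A).
Proof. by []. Qed.

Lemma cV_consE n (u : R) (x : 'cV[R]_n) : cV_cons (u, x) = col_mx u%:M x :> 'cV_(1 + n).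
Proof.
apply/colP => i; case: (unliftP ord0 i) => [j|] ->.
  by rewrite cV_consS -rshift1 col_mxEd.
rewrite cV_cons0 -(_ : lshift n (0 : 'I_1) = ord0); last exact: val_inj.
by rewrite col_mxEu mxE eqxx.
Qed.

Lemma measurable_mulmx m n (T : 'M[R]_(m, n)) :
  measurable_fun [set: 'cV[R]_n] (mulmx T : _ -> 'cV[R]_m).
Proof.
apply: measurable_fun_cVP => i; under eq_fun do rewrite mxE.
apply: measurable_sum => j; apply: measurable_funM; first exact: measurable_cst.
exact: measurable_coord.
Qed.

Lemma measurable_addcV n (c : 'cV[R]_n) : measurable_fun setT (fun x : 'cV[R]_n => x + c).
Proof.
apply: measurable_fun_cVP => i; under eq_fun do rewrite mxE.
apply: measurable_funD; first exact: measurable_coord.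
exact: measurable_cst.
Qed.

Lemma measurable_preimage_setT d d' (T : measurableType d) (U : measurableType d')
  (f : T -> U) A : measurable_fun setT f -> measurable A -> measurable (f @^-1` A).
Proof. by move=> mf mA; rewrite -[X in measurable X]setTI; exact: mf. Qed.

Lemma product_measure_swap n (A : set (R * 'cV[R]_n)) : measurable A ->
  (mu \x (@lebesgue_cV R n))%E A = (mu \x^ (@lebesgue_cV R n))%E A.
Proof.
move=> mA; apply: product_measure_unique => // B C mB mC.
exact: product_measure2E.
Qed.

(** Tonelli: [S] fixes the first coordinate, so the common factor [c] of the slices comes out of the
    outer integral. The slice maps may depend on [u], as a shear requires. *)
Lemma lebesgue_cV_xfiber n (S : 'cV[R]_n.+1 -> 'cV[R]_n.+1) (c : R)
    (S' : R -> 'cV[R]_n -> 'cV[R]_n) (A : set 'cV[R]_n.+1) :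
  measurable_fun setT S -> 0 <= c ->
  (forall u x, S (cV_cons (u, x)) = cV_cons (u, S' u x)) ->
  (forall u B, measurable B -> (lebesgue_cV (S' u @^-1` B) * c%:E)%E = lebesgue_cV B) ->
  measurable A -> (lebesgue_cV (S @^-1` A) * c%:E)%E = lebesgue_cV A.
Proof.
move=> mS c0 SE hS mA; rewrite !lebesgue_cVS.
have mF : measurable (@cV_cons R n @^-1` A).
  exact: (measurable_preimage_setT (@measurable_cV_cons R n)).
have mG : measurable (@cV_cons R n @^-1` (S @^-1` A)).
  apply: (measurable_preimage_setT (@measurable_cV_cons R n)).
  exact: (measurable_preimage_setT mS).
rewrite /product_measure1 -ge0_integralZr//; last first.
  exact: measurable_fun_xsection.
apply: eq_integral => u _ /=; rewrite -[RHS](hS u); last exact: measurable_xsection.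
congr (lebesgue_cV _ * _)%E; apply/seteqP.
by split=> x; rewrite /= !xsectionE/= SE.
Qed.

(** The slices are now lines in the first coordinate, so the order of integration is exchanged
    before the same argument. *)
Lemma lebesgue_cV_yfiber n (S : 'cV[R]_n.+1 -> 'cV[R]_n.+1) (c : R)
    (S' : 'cV[R]_n -> R -> R) (A : set 'cV[R]_n.+1) :
  measurable_fun setT S -> 0 <= c ->
  (forall u x, S (cV_cons (u, x)) = cV_cons (S' x u, x)) ->
  (forall x B, measurable B -> (mu (S' x @^-1` B) * c%:E)%E = mu B) ->
  measurable A -> (lebesgue_cV (S @^-1` A) * c%:E)%E = lebesgue_cV A.
Proof.
move=> mS c0 SE hS mA; rewrite !lebesgue_cVS.
have mF : measurable (@cV_cons R n @^-1` A).
  exact: (measurable_preimage_setT (@measurable_cV_cons R n)).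
have mG : measurable (@cV_cons R n @^-1` (S @^-1` A)).
  apply: (measurable_preimage_setT (@measurable_cV_cons R n)).
  exact: (measurable_preimage_setT mS).
rewrite !product_measure_swap// /product_measure2 -ge0_integralZr//; last first.
  exact: measurable_fun_ysection.
apply: eq_integral => u _ /=; rewrite -[RHS](hS u); last exact: measurable_ysection.
congr (mu _ * _)%E; apply/seteqP.
by split=> x; rewrite /= !ysectionE/= SE.
Qed.

(** Induction on the dimension: a translation of the first coordinate followed by one of the
    remaining coordinates, each preserving the measure of its fibres. *)
Lemma lebesgue_cV_addr n (c : 'cV[R]_n) (A : set 'cV[R]_n) : measurable A ->
  lebesgue_cV ((fun x => x + c) @^-1` A) = lebesgue_cV A.
Proof.
elim: n c A => [|n IH] c A mA.
  by congr lebesgue_cV; apply/seteqP; split=> x /=; rewrite (_ : x + c = x)//;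
    apply/colP => -[].
pose c1 : 'cV[R]_n.+1 := cV_cons (c 0 0, 0).
pose c2 : 'cV[R]_n := \col_j c (lift ord0 j) 0.
rewrite -(@lebesgue_cV_yfiber n (fun x => x + c1) 1 (fun x u => u + c 0 0) A)//; first last.
- by move=> x B mB; rewrite mule1 lebesgue_measure_addr.
- move=> u x; apply/colP => i; rewrite mxE; case: (unliftP ord0 i) => [j|] ->.
    by rewrite !cV_consS/= mxE addr0.
  by rewrite !cV_cons0.
- exact: measurable_addcV.
have mA1 : measurable ((fun x : 'cV[R]_n.+1 => x + c1) @^-1` A).
  by apply: (@measurable_preimage_setT _ _ _ _ (fun x : 'cV[R]_n.+1 => x + c1) A) => //; exact: measurable_addcV.
rewrite -(@lebesgue_cV_xfiber n (fun x => x + cV_cons (0, c2)) 1 (fun u x => x + c2) _ _ _ _ _ mA1)//; first last.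
- by move=> x B mB; rewrite mule1 IH.
- move=> u x; apply/colP => i; rewrite mxE; case: (unliftP ord0 i) => [j|] ->.
    by rewrite !cV_consS/= !mxE.
  by rewrite !cV_cons0 addr0.
- exact: measurable_addcV.
rewrite !mule1; congr lebesgue_cV; apply/seteqP; split=> x /=;
  rewrite -addrA (_ : _ + c1 = c)//; apply/colP => i; rewrite mxE;
  case: (unliftP ord0 i) => [j|] ->; rewrite ?cV_consS ?cV_cons0/= ?mxE ?addr0 ?add0r//.
Qed.

(** Taking preimages and multiplying by the determinant keeps the identity free of division in the
    extended reals. *)
Definition scales_volume n (T : 'M[R]_n) := forall A, measurable A ->
  (lebesgue_cV (mulmx T @^-1` A) * `|\det T|%:E)%E = lebesgue_cV A.

Lemma scales_volumeM n (S T : 'M[R]_n) :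
  scales_volume S -> scales_volume T -> scales_volume (S *m T).
Proof.
move=> hS hT A mA; have mSA : measurable (mulmx S @^-1` A : set 'cV[R]_n).
  by apply: measurable_preimage_setT => //; exact: measurable_mulmx.
rewrite -(hS _ mA) -(hT _ mSA) det_mulmx normrM EFinM muleCA muleC -muleA.
by rewrite muleA; congr (lebesgue_cV _ * _ * _)%E; apply/seteqP; split=> x /=; rewrite mulmxA.
Qed.

(** The first coordinate [u] is fixed and the others undergo [D] followed by the translation by
    [u *: b]. *)
Lemma scales_volume_lower n (b : 'cV[R]_n) (D : 'M[R]_n) : scales_volume D ->
  scales_volume (block_mx 1%:M 0 b D : 'M[R]_(1 + n)).
Proof.
move=> hD A mA; rewrite det_lblock det1 mul1r.
apply: (@lebesgue_cV_xfiber n _ _ (fun u x => D *m x + u *: b)) => //.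
- exact: measurable_mulmx.
- move=> u x; rewrite !cV_consE mul_block_col mul1mx mul0mx addr0.
  by rewrite mul_mx_scalar addrC.
- move=> u B mB; rewrite -(lebesgue_cV_addr (u *: b) mB) -[RHS]hD//.
  by apply: (@measurable_preimage_setT _ _ _ _ (fun x : 'cV[R]_n => x + u *: b) B) => //;
    exact: measurable_addcV.
Qed.

(** Only the first coordinate moves, by a dilation and a translation depending on the others. *)
Lemma scales_volume_upper n (a : R) (c : 'rV[R]_n) : a != 0 ->
  scales_volume (block_mx a%:M c 0 1%:M : 'M[R]_(1 + n)).
Proof.
move=> a0 A mA; rewrite det_ublock det1 mulr1 det_scalar1.
apply: (@lebesgue_cV_yfiber n _ _ (fun x u => a * u + (c *m x) 0 0)) => //.
- exact: measurable_mulmx.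
- move=> u x; rewrite !cV_consE mul_block_col mul1mx mul0mx add0r.
  rewrite (_ : a%:M *m u%:M + c *m x = (a * u + (c *m x) 0 0)%:M)//.
  apply/matrixP => i j; by rewrite !ord1 mul_scalar_mx !mxE eqxx !mulr1n.
- move=> x B mB; rewrite -(lebesgue_measure_addr ((c *m x) 0 0) mB).
  rewrite -[RHS](lebesgue_measure_mull a0)//.
  apply: (@measurable_preimage_setT _ _ (measurableTypeR R) (measurableTypeR R) (fun x0 : R => x0 + _) B) => //.
  by apply: measurable_funD => //; exact: measurable_cst.
Qed.

(** Gaussian elimination by induction on the dimension: a nonzero corner entry splits the matrix
    into a lower factor carrying the Schur complement, which is again invertible, and an upper
    factor. *)
Lemma unit_scales_volume n (T : 'M[R]_n) : T \in unitmx -> scales_volume T.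
Proof.
elim: n T => [|n IH] T uT.
  move=> A mA; rewrite det_mx00 normr1 mule1; congr lebesgue_cV; apply/seteqP.
  by split=> x /=; rewrite (_ : T *m x = x)//; apply/colP => -[].
have pivot (S : 'M[R]_(1 + n)) : S \in unitmx -> S 0 0 != 0 -> scales_volume S.
  move=> uS a0; set a := S 0 0.
  pose b : 'cV[R]_n := dlsubmx S; pose c : 'rV[R]_n := ursubmx S.
  have SE : S = (block_mx 1%:M 0 (a^-1 *: b) (drsubmx S - a^-1 *: (b *m c)) : 'M[R]_(1 + n))
       *m (block_mx a%:M c 0 1%:M : 'M[R]_(1 + n)).
    rewrite mulmx_block !mul1mx !mul0mx !mulmx0 !mulmx1 !addr0 mul_mx_scalar.
    rewrite scalerA divff// scale1r -scalemxAl addrC subrK.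
    rewrite -[LHS]submxK; congr block_mx.
    rewrite [LHS]mx11_scalar /a; congr _%:M; rewrite !mxE.
    by congr (S _ _); exact: val_inj.
  rewrite SE; apply: scales_volumeM; last exact: scales_volume_upper.
  apply/scales_volume_lower/IH.
  move: uS; rewrite {1}SE unitmx_mul => /andP[+ _].
  by rewrite !unitmxE det_lblock det1 mul1r.
(* If the corner vanishes, invertibility gives a nonzero entry lower in column 0; the shear [E 1]
   adds its row to row 0, and [E (-1)] undoes this. *)
have [T0|T0] := eqVneq (T 0 0) 0; last exact: pivot.
have [i Ti] : exists i, T i 0 != 0.
  apply/not_existsP => h; move: uT; rewrite unitmxE (expand_det_col _ 0).
  rewrite big1 ?unitr0// => i _.
  by have /negP/negPn/eqP -> := h i; rewrite mul0r.
have [j ij] : exists j, i = lift ord0 j.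
  case: (unliftP ord0 i) => [j|] ij; first by exists j.
  by move: Ti; rewrite ij T0 eqxx.
pose E (s : R) : 'M[R]_(1 + n) := block_mx (1 : R)%:M (s *: delta_mx 0 j) 0 1%:M.
have EN : E (-1) *m E 1 = 1%:M.
  rewrite mulmx_block !mul1mx !mul0mx !mulmx0 !mulmx1 !addr0 add0r scalar_mx_block.
  by congr block_mx; rewrite -scalerDl subrr scale0r.
have uE : E 1 \in unitmx by case/mulmx1_unit: EN.
rewrite (_ : T = E (-1) *m (E 1 *m T)); last by rewrite mulmxA EN mul1mx.
apply: scales_volumeM; first by apply: scales_volume_upper; rewrite oner_eq0.
apply: pivot; first by rewrite unitmx_mul uE.
suff -> : (E 1 *m T) 0 0 = T i 0 by [].
have EE k : E 1 0 (lift ord0 k) = (k == j)%:R.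
  rewrite /E -rshift1 -(_ : lshift n (0 : 'I_1) = 0); last exact: val_inj.
  by rewrite block_mxEur !mxE mul1r eqxx.
rewrite mxE big_ord_recl T0 mulr0 add0r (bigD1 j)//= EE eqxx mul1r ij.
by rewrite big1 ?addr0// => k kj; rewrite EE (negbTE kj) mul0r.
Qed.

End linear_change.

(** * Bounds for the max norm of matrices *)

Section mx_norm_bounds.
Context {R : realType}.

Lemma le_mx_norm m n (M : 'M[R]_(m, n)) i j : `|M i j| <= `|M|.
Proof.
rewrite [leRHS]/Num.Def.normr/= mx_normrE.
exact: (le_bigmax_cond _ (fun k : 'I_m * 'I_n => `|M k.1 k.2|) (j := (i, j))).
Qed.

Lemma mx_norm_le m n (M : 'M[R]_(m, n)) c :
  0 <= c -> (forall i j, `|M i j| <= c) -> `|M| <= c.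
Proof.
move=> c0 Mc; rewrite [leLHS]/Num.Def.normr/= mx_normrE.
by apply: bigmax_le => // -[i j] _; exact: Mc.
Qed.

Lemma cV_norm_le n (x : 'cV[R]_n) c : 0 <= c -> (forall i, `|x i 0| <= c) -> `|x| <= c.
Proof. by move=> c0 h; apply: mx_norm_le => // i j; rewrite ord1. Qed.

Lemma norm_mulmx_le m n p (A : 'M[R]_(m, n)) (B : 'M[R]_(n, p)) :
  `|A *m B| <= n%:R * `|A| * `|B|.
Proof.
apply: mx_norm_le => [|i j]; first by rewrite !mulr_ge0.
rewrite mxE (le_trans (ler_norm_sum _ _ _))//.
rewrite -mulrA mulr_natl -[X in _ *+ X]card_ord -sumr_const.
by apply: ler_sum => k _; rewrite normrM ler_pM// le_mx_norm.
Qed.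

End mx_norm_bounds.

(** * Open sets and continuous functions are measurable *)

Section open_measurable.
Context {R : realType} {n : nat}.

Lemma measurable_ball_cV (x : 'cV[R]_n) e : measurable (ball x e).
Proof.
have [e0|e0] := leP e 0.
  rewrite (_ : ball x e = set0)//; apply/seteqP; split=> // y [].
  by rewrite ltNge e0.
rewrite (_ : ball x e = \bigcap_(i in [set: 'I_n])
    ((fun y : 'cV[R]_n => y i 0) @^-1` (ball (x i 0) e))).
  apply: fin_bigcap_measurable => // i _; rewrite -[X in measurable X]setTI.
  by apply: measurable_coord => //; exact: measurable_ball.
apply/seteqP; split=> [y [_ h] i _|y h]; first exact: h.
by split=> // i j; rewrite ord1; exact: h.
Qed.

(** An open set is the countable union of the balls with rational centre and radius that it
    contains, and a max norm ball is a finite intersection of coordinate strips. *)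
Lemma open_measurable_cV (U : set 'cV[R]_n) : open U -> measurable U.
Proof.
move=> oU.
pose D := [set p : 'cV[rat]_n * rat | ball (map_mx ratr p.1 : 'cV[R]_n) (ratr p.2) `<=` U].
rewrite (_ : U = \bigcup_p (if p \in D then ball (map_mx ratr p.1 : 'cV[R]_n) (ratr p.2) else set0)).
  apply: countable_bigcupT_measurable => [|p]; first exact: countableP.
  by case: ifP => // _; exact: measurable_ball_cV.
apply/seteqP; split=> [x Ux|x [p _]]; last by case: ifPn => // /[!inE] pD; exact: pD.
have /nbhs_ballP[e /= e0 xeU] : nbhs x U by exact: open_nbhs_nbhs.
have [r] : exists r, ratr r \in `]0, e / 2[%R by apply: rat_in_itvoo; rewrite divr_gt0.
rewrite in_itv/= => /andP[r0 re].
have /choice[q qP] : forall i, exists q, (ratr q : R) \in `]x i 0 - ratr r, x i 0 + ratr r[%R.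
  by move=> i; apply: rat_in_itvoo; rewrite ltrD2l; lra.
pose Q : 'cV[rat]_n := \col_i q i.
have xQ : ball (map_mx ratr Q : 'cV[R]_n) (ratr r) x.
  split=> // i j; rewrite !mxE ord1; have := qP i; rewrite in_itv/= => h.
  by rewrite /ball/= ltr_norml; lra.
have DQ : (Q, r) \in D.
  rewrite inE => y /= Qy; apply: xeU; apply: le_ball (ball_triangle (ball_sym xQ) Qy).
  by lra.
by exists (Q, r) => //; rewrite DQ.
Qed.

Lemma continuous_measurable_cV (D : set 'cV[R]_n) (g : 'cV[R]_n -> R) :
  open D -> (forall x, D x -> {for x, continuous g}) -> measurable_fun D g.
Proof.
move=> oD cg; apply: (@measurability _ _ _ (measurableTypeR R) D g (@RGenOpens.G R) (RGenOpens.measurableE R)) => _ [_ [a [b ->]] <-].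
apply: open_measurable_cV; rewrite openE => x [Dx gx].
apply: filterI; first exact: open_nbhs_nbhs.
by apply: cg => //; apply: open_nbhs_nbhs; split=> //; exact: interval_open.
Qed.

End open_measurable.

(** * Half-open boxes as a generating class closed under intersection *)

Section boxes.
Context {R : realType} {n : nat}.
Implicit Types a b : 'cV[R]_n.

Definition oc_box a b : set 'cV[R]_n := [set x | forall i, a i 0 < x i 0 <= b i 0].

Lemma measurable_oc_box a b : measurable (oc_box a b).
Proof.
rewrite (_ : oc_box a b = \bigcap_(i in [set: 'I_n])
    ((fun x : 'cV[R]_n => x i 0) @^-1` `]a i 0, b i 0]%classic)).
  apply: fin_bigcap_measurable => // i _; rewrite -[X in measurable X]setTI.
  exact: measurable_coord.
apply/seteqP; split=> [x h i _|x h i] /=; first by rewrite in_itv/=.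
by have := h i I; rewrite /= in_itv.
Qed.

Definition oc_boxes : set (set 'cV[R]_n) := [set oc_box p.1 p.2 | p in [set: 'cV[R]_n * 'cV[R]_n]].

Lemma oc_boxesI : setI_closed oc_boxes.
Proof.
move=> _ _ [[a b] _ <-] [[c d] _ <-].
exists (\col_i Num.max (a i 0) (c i 0), \col_i Num.min (b i 0) (d i 0)) => //.
apply/seteqP; split=> [x h|x [h1 h2] i] /=.
  by split=> i; have := h i; rewrite !mxE gt_max le_min => /andP[/andP[h1 h2] /andP[h3 h4]]; apply/andP.
by have := h1 i; have := h2 i; rewrite !mxE gt_max le_min => /andP[-> ->] /andP[-> ->].
Qed.

Definition cube (k : nat) : set 'cV[R]_n := oc_box (const_mx (- k%:R)) (const_mx k%:R).

Lemma bigcup_cube : \bigcup_k cube k = [set: 'cV[R]_n].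
Proof.
apply/seteqP; split=> // x _; exists (Num.truncn `|x|).+1 => // i; rewrite !mxE.
have := truncnS_gt `|x|; have := le_mx_norm x i 0.
rewrite ler_norml => /andP[h1 h2] h3; apply/andP; split.
  by apply: lt_le_trans h1; rewrite ltrN2.
by apply: le_trans h2 (ltW h3).
Qed.

(** A strip that confines one coordinate to []c, d]] is the countable union of the boxes whose other
    sides are []-k, k]]. *)
Lemma measurable_oc_boxesE : (@measurable _ 'cV[R]_n) = <<s oc_boxes >>.
Proof.
apply/seteqP; split; last first.
  apply: smallest_sub; first exact: sigma_algebra_measurable.
  by move=> _ [[a b] _ <-]; exact: measurable_oc_box.
apply: smallest_sub; first exact: smallest_sigma_algebra.
rewrite -bigcup_seq; apply: bigcup_sub => i _ A [B mB <-].
have : measurable_fun [set: g_sigma_algebraType oc_boxes]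
    (fun x : 'cV[R]_n => x i 0 : measurableTypeR R).
  apply: (@measurability _ _ _ _ _ _ (@ocitv R)) => //.
  move=> _ [_ [[c d] _ <-] <-]; rewrite setTI.
  rewrite (_ : _ @^-1` _ = \bigcup_k oc_box
     (\col_j if j == i then c else - k%:R) (\col_j if j == i then d else k%:R)).
    apply: bigcupT_measurable => k; apply: sub_sigma_algebra.
    by eexists (_, _) => //.
  apply/seteqP; split=> [x /=|x [k _ /(_ i)]]; last by rewrite !mxE eqxx /= in_itv.
  rewrite in_itv/= => xcd; have : (\bigcup_k cube k) x by rewrite bigcup_cube.
  move=> [k _ kx]; exists k => // j; rewrite !mxE; case: eqP => [->//|_].
  by have := kx j; rewrite !mxE.
by move=> /(_ measurableT _ mB); rewrite setTI.
Qed.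

(** Boxes without positive sides are empty, so they need not be compared; the change of variables
    can thus assume positive sides. *)
Lemma cV_measure_unique (m1 m2 : {measure set 'cV[R]_n -> \bar R}) :
  (forall a b, (forall i, a i 0 < b i 0) -> m1 (oc_box a b) = m2 (oc_box a b)) ->
  (forall k, (m1 (cube k) < +oo)%E) ->
  forall A, measurable A -> m1 A = m2 A.
Proof.
move=> m12 m1oo; apply: (@measure_unique _ _ _ oc_boxes cube) => //; [exact: measurable_oc_boxesE|exact: oc_boxesI| |exact: bigcup_cube|].
  by move=> k; eexists (_, _) => //.
move=> _ [[a b] _ <-] /=; have [ab|] := pselect (forall i, a i 0 < b i 0); first exact: m12.
move=> /existsNP[i /negP]; rewrite -leNgt => ba.
rewrite (_ : oc_box a b = set0) ?measure0//; apply/seteqP; split=> // x /(_ i).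
by move=> /andP[/lt_le_trans/[apply]]; rewrite ltNge ba.
Qed.

End boxes.

(** * Change of variables *)

Section box_induction.
Context {R : realType} {n : nat}.
Implicit Types c d : 'cV[R]_n.

Definition set_coord c i (v : R) : 'cV[R]_n := \col_j if j == i then v else c j 0.

Definition midpoint c d i : R := (c i 0 + d i 0) / 2.

Variable P : 'cV[R]_n -> 'cV[R]_n -> Prop.
Hypothesis P_glue : forall c d i, (forall j, c j 0 <= d j 0) ->
  P c (set_coord d i (midpoint c d i)) ->
  P (set_coord c i (midpoint c d i)) d -> P c d.

(** The coordinates are bisected one at a time, keeping a half on which [P] fails. After [n] cuts
    the box is an exact half-scale copy, which is how its shape survives the iteration. *)
Let halve c d : (forall j, c j 0 <= d j 0) -> ~ P c d ->
  exists c' d', [/\ ~ P c' d', d' - c' = 2^-1 *: (d - c) &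
    forall j, [/\ c j 0 <= c' j 0, c' j 0 <= d' j 0 & d' j 0 <= d j 0]].
Proof.
move=> cd nP.
suff /(_ n (leqnn _)) [c' [d' [nP' h]]] : forall k, (k <= n)%N -> exists c' d', ~ P c' d' /\
    forall j : 'I_n, if (j < k)%N then
      [/\ c j 0 <= c' j 0, d' j 0 <= d j 0 & d' j 0 - c' j 0 = 2^-1 * (d j 0 - c j 0)]
      else c' j 0 = c j 0 /\ d' j 0 = d j 0.
  exists c', d'; split=> //.
    by apply/colP => j; have := h j; rewrite ltn_ord !mxE => -[].
  move=> j; have := h j; rewrite ltn_ord => -[h1 h2 h3]; split=> //.
  by rewrite -subr_ge0 h3 mulr_ge0// ?invr_ge0// subr_ge0.
elim=> [_|k IH kn]; first by exists c, d; split.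
have [c' [d' [nP' h]]] := IH (ltnW kn).
have cd' j : c' j 0 <= d' j 0.
  have := h j; case: ifP => _ [].
    by move=> h1 h2 h3; rewrite -subr_ge0 h3 mulr_ge0// ?invr_ge0// subr_ge0.
  by move=> -> ->.
pose i := Ordinal kn; have [ci di] : c' i 0 = c i 0 /\ d' i 0 = d i 0.
  by have := h i; rewrite ltnn.
have cdi := cd i.
have [nP1|nP1] := pselect (P c' (set_coord d' i (midpoint c' d' i))).
- exists (set_coord c' i (midpoint c' d' i)), d'; split.
    by move=> P2; apply: nP'; exact: (P_glue cd' nP1).
  move=> j; rewrite !mxE; case: eqVneq => [->|ji].
    by rewrite ltnS leqnn /midpoint ci di; split; lra.
  have -> : (j < k.+1)%N = (j < k)%N; last exact: h.
  by rewrite ltnS leq_eqVlt; case: eqVneq => //= jk; case/eqP: ji; exact: val_inj.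
- exists c', (set_coord d' i (midpoint c' d' i)); split => //.
  move=> j; rewrite !mxE; case: eqVneq => [->|ji].
    by rewrite ltnS leqnn /midpoint ci di; split; lra.
  have -> : (j < k.+1)%N = (j < k)%N; last exact: h.
  by rewrite ltnS leq_eqVlt; case: eqVneq => //= jk; case/eqP: ji; exact: val_inj.
Qed.

(* Cousin's lemma: bisect, and apply the local hypothesis at the common point. *)
Lemma box_induction (a b : 'cV[R]_n) : (forall j, a j 0 <= b j 0) ->
  (forall x : 'cV[R]_n, (forall j, a j 0 <= x j 0 <= b j 0) ->
     exists2 e : R, 0 < e & forall (c d : 'cV[R]_n) (s : R), 0 < s < e -> d - c = s *: (b - a) ->
       (forall j, c j 0 <= x j 0 <= d j 0) -> P c d) ->
  P a b.
Proof.
move=> ab hloc; apply: contrapT => nP.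
pose good (p : 'cV[R]_n * 'cV[R]_n) := (forall j, p.1 j 0 <= p.2 j 0) /\ ~ P p.1 p.2.
have /choice[f fP] : forall p, exists q, good p -> good q /\
    (q.2 - q.1 = 2^-1 *: (p.2 - p.1) /\ forall j, p.1 j 0 <= q.1 j 0 /\ q.2 j 0 <= p.2 j 0).
  move=> p; have [[g1 g2]|ng] := pselect (good p); last by exists p.
  have [c' [d' [h1 h2 h3]]] := halve g1 g2; exists (c', d') => _; split; [split|split] => //= j.
  - by have [] := h3 j.
  - by have [] := h3 j.
pose s k := iter k f (a, b).
have gs k : good (s k) by elim: k => [|k IH] /=; [split|have [] := fP _ IH].
have ss k : (s k).2 - (s k).1 = (2^-1) ^+ k *: (b - a).
  elim: k => [|k IH] /=; first by rewrite expr0 scale1r.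
  by have [_ [-> _]] := fP _ (gs k); rewrite IH scalerA exprS.
have sm k m j : (k <= m)%N -> (s k).1 j 0 <= (s m).1 j 0 /\ (s m).2 j 0 <= (s k).2 j 0.
  elim: m => [|m IH]; first by rewrite leqn0 => /eqP ->.
  rewrite leq_eqVlt => /predU1P[->//|]; rewrite ltnS => /IH[h1 h2].
  have [_ [_ /(_ j)[h3 h4]]] := fP _ (gs m).
  by split; [exact: le_trans h1 h3|exact: le_trans h4 h2].
have slt k m j : (s k).1 j 0 <= (s m).2 j 0.
  have [h1 _] := sm _ _ j (leq_maxl k m); have [_ h2] := sm _ _ j (leq_maxr k m).
  by apply: le_trans h1 (le_trans _ h2); have [] := gs (maxn k m).
(* Lower corners increase and stay below every upper corner, so their supremum lies in all the
   boxes. *)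
pose x : 'cV[R]_n := \col_j sup [set (s k).1 j 0 | k in [set: nat]].
have xs k j : (s k).1 j 0 <= x j 0 <= (s k).2 j 0.
  rewrite mxE; apply/andP; split.
    apply: ub_le_sup; last by exists k.
    by exists ((s 0).2 j 0) => _ [m _ <-]; exact: slt.
  apply: ge_sup; first by exists ((s 0).1 j 0); exists 0.
  by move=> _ [m _ <-]; exact: slt.
have [e e0 he] := hloc x (xs 0).
have [k ke] : exists k, (2^-1 : R) ^+ k < e.
  exists (Num.truncn e^-1).+1; rewrite exprVn invf_plt ?posrE ?exprn_gt0//.
  apply: lt_le_trans (truncnS_gt _) _.
  by rewrite -natrX ler_nat ltnW// ltn_expl.
have [_] := gs k; apply; apply: (he _ _ (2^-1 ^+ k)) => //.
by rewrite exprn_gt0//= invr_gt0.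
Qed.

End box_induction.

Section oc_box_split.
Context {R : realType} {n : nat}.
Implicit Types c d : 'cV[R]_n.

Lemma oc_box_split c d i (m : R) : c i 0 <= m <= d i 0 ->
  oc_box c d = oc_box c (set_coord d i m) `|` oc_box (set_coord c i m) d.
Proof.
move=> /andP[cm md]; apply/seteqP; split=> [x h|x [h|h] j].
- have [xm|mx] := leP (x i 0) m; [left|right] => j; rewrite mxE; case: eqVneq => [->|//].
    by have /andP[-> _] := h i.
  by have /andP[_ ->] := h i; rewrite mx.
- have := h j; rewrite mxE; case: eqVneq => [->|//] /andP[-> h2] /=; exact: le_trans h2 md.
- have := h j; rewrite mxE; case: eqVneq => [->|//] /andP[h2 ->]; rewrite andbT.
  exact: le_lt_trans cm h2.
Qed.

Lemma oc_box_split_disj c d i (m : R) :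
  oc_box c (set_coord d i m) `&` oc_box (set_coord c i m) d = set0.
Proof.
apply/seteqP; split=> // x [/(_ i) + /(_ i)]; rewrite !mxE eqxx.
by move=> /andP[_ h1] /andP[/(le_lt_trans h1)]; rewrite ltxx.
Qed.

Lemma measure_oc_box_split (m : {measure set 'cV[R]_n -> \bar R}) c d i :
  (forall j, c j 0 <= d j 0) ->
  m (oc_box c d) = (m (oc_box c (set_coord d i (midpoint c d i))) +
    m (oc_box (set_coord c i (midpoint c d i)) d))%E.
Proof.
move=> cd; rewrite (@oc_box_split c d i (midpoint c d i)); last first.
  by have := cd i; rewrite /midpoint => h; apply/andP; split; lra.
by rewrite measureU//; [exact: measurable_oc_box..|exact: oc_box_split_disj].
Qed.

End oc_box_split.

Section measure_le_locally.
Context {R : realType} {n : nat}.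

(* Boxes shrinking to a point keep their shape (here: the shape of (a, b)). *)
Lemma oc_box_le_locally (m1 m2 m3 : {measure set 'cV[R]_n -> \bar R}) (a b : 'cV[R]_n) :
  (forall j, a j 0 <= b j 0) ->
  (forall x : 'cV[R]_n, (forall j, a j 0 <= x j 0 <= b j 0) ->
     exists2 e : R, 0 < e & forall (c d : 'cV[R]_n) (s : R), 0 < s < e -> d - c = s *: (b - a) ->
       (forall j, c j 0 <= x j 0 <= d j 0) ->
       (m1 (oc_box c d) <= m2 (oc_box c d) + m3 (oc_box c d))%E) ->
  (m1 (oc_box a b) <= m2 (oc_box a b) + m3 (oc_box a b))%E.
Proof.
move=> ab h; apply: (@box_induction R n (fun c d =>
  (m1 (oc_box c d) <= m2 (oc_box c d) + m3 (oc_box c d))%E)) => // c d i cd h1 h2.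
by rewrite (measure_oc_box_split m1 i cd) (measure_oc_box_split m2 i cd)
  (measure_oc_box_split m3 i cd) addeACA; exact: leeD.
Qed.

Lemma oc_box_lty_locally (m : {measure set 'cV[R]_n -> \bar R}) (a b : 'cV[R]_n) :
  (forall j, a j 0 <= b j 0) ->
  (forall x : 'cV[R]_n, (forall j, a j 0 <= x j 0 <= b j 0) ->
     exists2 e : R, 0 < e & forall (c d : 'cV[R]_n) (s : R), 0 < s < e -> d - c = s *: (b - a) ->
       (forall j, c j 0 <= x j 0 <= d j 0) -> (m (oc_box c d) < +oo)%E) ->
  (m (oc_box a b) < +oo)%E.
Proof.
move=> ab h; apply: (@box_induction R n (fun c d => (m (oc_box c d) < +oo)%E)) => //.
by move=> c d i cd h1 h2; rewrite (measure_oc_box_split m i cd) lte_add_pinfty.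
Qed.

End measure_le_locally.

Section density.
Context {R : realType} d (T : measurableType d).
Variables (mu : {measure set T -> \bar R}) (w : T -> R).
Hypotheses (mw : measurable_fun setT w) (w0 : forall x, 0 <= w x).
Local Open Scope ereal_scope.

Let nu A := \int[mu]_(x in A) (w x)%:E.
Let nu0 : nu set0 = 0. Proof. by rewrite /nu integral_set0. Qed.
Let nu_ge0 A : 0 <= nu A. Proof. by apply: integral_ge0 => x _; rewrite lee_fin. Qed.
Let nu_add : semi_sigma_additive nu.
Proof.
apply: (@semi_sigma_additive_nng_induced _ _ _ mu (EFin \o w)) => //.
exact/measurable_EFinP.
Qed.
HB.instance Definition _ := isMeasure.Build _ _ _ nu nu0 nu_ge0 nu_add.

Lemma density_measure :
  {m : {measure set T -> \bar R} | forall A, m A = \int[mu]_(x in A) (w x)%:E}.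
Proof. by exists nu. Qed.

End density.

(** Each side of a box of shape [L] is moved by [t] at both ends, hence the factor 2; the last
    clause keeps the shrunken box nondegenerate. *)
Lemma prod_addr_near (R : realType) n (L : 'cV[R]_n) (w e : R) : 0 < e -> (forall i, 0 < L i 0) ->
  exists2 h : R, 0 < h & (forall t : R, `|t| <= h ->
     `|w * \prod_i L i 0 - w * \prod_i (L i 0 + 2 * t)| <= e * \prod_i L i 0) /\
     forall i, 2 * h < L i 0.
Proof.
move=> e0 L0; have p0 : 0 < \prod_i L i 0 by apply: prodr_gt0 => i _.
have : w * \prod_i (L i 0 + 2 * t) @[t --> (0 : R)] --> w * \prod_i L i 0.
  apply: cvgMl_tmp; apply: cvg_big => [|i _]; first exact: mul_continuous.
  rewrite -[X in _ --> X]addr0; apply: cvgD; first exact: cvg_cst.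
  by rewrite -[X in _ --> X](mulr0 2); apply: cvgMl_tmp; exact: cvg_id.
move=> /cvgrPdist_le/(_ _ (mulr_gt0 e0 p0)) near1.
have : \forall t \near (0 : R), forall i, 2 * t < L i 0.
  apply: (@filter_forall R 'I_n (fun i (t : R) => 2 * t < L i 0) _ (nbhs_filter (0 : R))) => i.
  have := @cvgr_lt _ _ _ _ (fun t : R => 2 * t) (0 : R); apply; last exact: L0.
  by rewrite -[X in _ --> X](mulr0 2); apply: cvgMl_tmp; exact: cvg_id.
move=> /(filterI near1)/nbhs_ballP[d /= d0 hd].
have in_d t : `|t| <= d / 2 -> ball (0 : R) d t.
  by rewrite /ball/= sub0r normrN => /le_lt_trans; apply; lra.
exists (d / 2); first by rewrite divr_gt0.
split=> [t /in_d/hd[]//|]; have /in_d/hd[_] // : `|d / 2| <= d / 2.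
by rewrite ger0_norm// divr_ge0// ltW.
Qed.

Section change_of_variables.
Context {R : realType} {n : nat}.
Variables (G H : 'cV[R]_n -> 'cV[R]_n) (T S : 'cV[R]_n -> 'M[R]_n).
Hypotheses (GK : cancel G H) (HK : cancel H G).
Hypothesis dG : forall (x : 'cV[R]_n) (e : R), 0 < e -> exists2 d : R, 0 < d &
  forall y : 'cV[R]_n, `|y - x| < d -> `|G y - G x - T x *m (y - x)| <= e * `|y - x|.
Hypothesis dH : forall (x : 'cV[R]_n) (e : R), 0 < e -> exists2 d : R, 0 < d &
  forall y : 'cV[R]_n, `|y - x| < d -> `|H y - H x - S x *m (y - x)| <= e * `|y - x|.
Hypothesis ST : forall x, S (G x) *m T x = 1%:M.
Hypothesis cT : continuous (fun x => \det (T x)).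
Hypothesis mH : measurable_fun setT H.

Let w (x : 'cV[R]_n) : R := `|\det (T x)|.
Notation lam := (@lebesgue_cV R n).
Let cw : continuous w.
Proof. move=> x; apply: (@continuous_comp _ _ _ (fun x => \det (T x)) (fun y : R => `|y|)).
  exact: cT.
exact: norm_continuous. Qed.

(** [B] is the image of the box under the affine approximation of [G] at [x], written as a preimage
    under the inverse affine map. *)
Let affine_box x (u v : 'cV[R]_n) : (forall j, u j 0 <= v j 0) ->
  let B := [set z | oc_box u v (S (G x) *m (z - G x) + x)] in
  measurable B /\ lam B = (w x * \prod_j (v j 0 - u j 0))%:E.
Proof.
move=> uv B.
have m1 : measurable ((fun y : 'cV[R]_n => y + x) @^-1` oc_box u v).
  by apply: (measurable_preimage_setT (measurable_addcV x)); exact: measurable_oc_box.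
have m2 := measurable_preimage_setT (measurable_mulmx (S (G x))) m1.
have BE : B = (fun z => z + - G x) @^-1` (mulmx (S (G x)) @^-1`
   ((fun y : 'cV[R]_n => y + x) @^-1` oc_box u v)) by [].
split; first by rewrite BE; exact: (measurable_preimage_setT (measurable_addcV (- G x))).
rewrite BE lebesgue_cV_addr//.
have uS : S (G x) \in unitmx by have [] := mulmx1_unit (ST x).
have := unit_scales_volume uS m1.
rewrite lebesgue_cV_addr; last exact: measurable_oc_box.
rewrite [X in _ = X -> _]lebesgue_cV_box//.
set V := lam _ => VE.
have st : `|\det (S (G x))| * w x = 1 by rewrite -normrM -det_mulmx ST det1 normr1.
have -> : V = (V * `|\det (S (G x))|%:E * (w x)%:E)%E by rewrite -muleA -EFinM st mule1.
by rewrite VE -EFinM mulrC.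
Qed.

Let bound_mx m (M : 'M[R]_(m, n)) : exists2 k : R, 0 < k & forall v : 'cV[R]_n, `|M *m v| <= k * `|v|.
Proof.
exists (n%:R * `|M| + 1) => [|v]; first by rewrite ltr_pwDr// mulr_ge0.
by rewrite (le_trans (norm_mulmx_le _ _))// ler_wpM2r// lerDl.
Qed.

Let dist_box (c d x y : 'cV[R]_n) (s : R) (L : 'cV[R]_n) : 0 < s -> d - c = s *: L ->
  (forall j, c j 0 <= x j 0 <= d j 0) -> (forall j, c j 0 <= y j 0 <= d j 0) ->
  `|y - x| <= s * `|L|.
Proof.
move=> s0 dc hx hy; apply: cV_norm_le => [|j]; first by rewrite mulr_ge0// ltW.
have dcj : d j 0 - c j 0 <= s * `|L|.
  have -> : d j 0 - c j 0 = s * L j 0 by move/colP: dc => /(_ j); rewrite !mxE.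
  by rewrite (ler_wpM2l (ltW s0))// (le_trans (ler_norm (L j 0)))// le_mx_norm.
by rewrite !mxE ler_norml; have := hx j; have := hy j; lra.
Qed.

(** The preimage under [H] is the image under [G]. On a box of size [s] the linearization error of
    [G] is o(s), so it is absorbed by pushing every face out by [s * h]. *)
Let preimage_upper (x L : 'cV[R]_n) (h : R) : 0 < h ->
  exists2 e : R, 0 < e & forall (c d : 'cV[R]_n) (s : R), 0 < s < e -> d - c = s *: L ->
    (forall j, c j 0 <= x j 0 <= d j 0) ->
    H @^-1` oc_box c d `<=` [set z | oc_box (c - const_mx (s * h)) (d + const_mx (s * h))
       (S (G x) *m (z - G x) + x)].
Proof.
move=> h0; have [k k0 hk] := bound_mx (S (G x)).
have L1 : 0 < `|L| + 1 by rewrite ltr_pwDr.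
(* The tolerance makes the error, after multiplication by [S (G x)], at most [s * h]; adding 1 to
   the norm of [L] covers [L = 0]. *)
have [e e0 he] := dG x (divr_gt0 h0 (mulr_gt0 k0 L1)).
exists (e / (`|L| + 1)) => [|c d s /andP[s0 se] dc hx z /= Hz]; first by rewrite divr_gt0.
have dxy : `|H z - x| <= s * `|L|.
  by apply: (dist_box s0 dc hx) => j; have /andP[/ltW -> ->] := Hz j.
have sL : s * `|L| <= s * (`|L| + 1) by rewrite (ler_wpM2l (ltW s0))// lerDl.
have : `|H z - x| < e by rewrite (le_lt_trans dxy)// (le_lt_trans sL)// -ltr_pdivlMr.
move=> /he; rewrite HK => hr.
set r := z - G x - _ in hr.
have zE : S (G x) *m (z - G x) + x = H z + S (G x) *m r.
  rewrite /r [in RHS]mulmxBr mulmxA ST mul1mx; move: (S (G x) *m (z - G x)) => u.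
  by apply/colP => i; rewrite !mxE; ring.
have hj j : `|(S (G x) *m r) j 0| <= s * h.
  rewrite (le_trans (le_mx_norm _ _ _))// (le_trans (hk _))// (le_trans (ler_wpM2l (ltW k0) hr))//.
  rewrite (le_trans (ler_wpM2l _ (ler_wpM2l _ (le_trans dxy sL))))//; [exact: ltW| |].
    by rewrite divr_ge0 ?mulr_ge0 ?ltW.
  by rewrite le_eqVlt; apply/orP; left; apply/eqP; field; rewrite !gt_eqF.
move=> j; rewrite zE !mxE; have := Hz j; have := hj j; rewrite ler_norml !mxE.
by move=> /andP[? ?] /andP[? ?]; apply/andP; split; lra.
Qed.

(** The opposite inclusion linearizes [H] at [G x]: differentiability of the inverse takes the place
    of an argument that [G] covers the shrunken parallelepiped. *)
Let preimage_lower (x L : 'cV[R]_n) (h : R) : 0 < h ->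
  exists2 e : R, 0 < e & forall (c d : 'cV[R]_n) (s : R), 0 < s < e -> d - c = s *: L ->
    (forall j, c j 0 <= x j 0 <= d j 0) ->
    [set z | oc_box (c + const_mx (s * h)) (d - const_mx (s * h))
       (S (G x) *m (z - G x) + x)] `<=` H @^-1` oc_box c d.
Proof.
move=> h0; have [k k0 hk] := bound_mx (T x).
have L1 : 0 < `|L| + 1 by rewrite ltr_pwDr.
have [e e0 he] := dH (G x) (divr_gt0 h0 (mulr_gt0 k0 L1)).
exists (e / (k * (`|L| + 1))) => [|c d s /andP[s0 se] dc hx z /=].
  by rewrite divr_gt0// mulr_gt0.
set y := S (G x) *m (z - G x) + x => By.
have sh0 : 0 < s * h by rewrite mulr_gt0.
have hy j : c j 0 + s * h < y j 0 <= d j 0 - s * h by have := By j; rewrite !mxE.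
have dxy : `|y - x| <= s * `|L|.
  by apply: (dist_box s0 dc hx) => j; have /andP[? ?] := hy j; apply/andP; split; lra.
have sL : s * `|L| <= s * (`|L| + 1) by rewrite (ler_wpM2l (ltW s0))// lerDl.
have zE : z - G x = T x *m (y - x).
  by rewrite /y addrK mulmxA (mulmx1C (ST x)) mul1mx.
have dz : `|z - G x| <= k * (s * (`|L| + 1)).
  by rewrite zE (le_trans (hk _))// (ler_wpM2l (ltW k0))// (le_trans dxy).
have : `|z - G x| < e.
  by rewrite (le_lt_trans dz)// mulrCA -ltr_pdivlMr// mulr_gt0.
move=> /he; rewrite GK => hr j.
have := hy j; have : `|H z j 0 - y j 0| <= s * h.
  have -> : H z j 0 - y j 0 = (H z - x - S (G x) *m (z - G x)) j 0.
    by rewrite /y !mxE opprD addrA addrAC.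
  rewrite (le_trans (le_mx_norm _ _ _))// (le_trans hr)//.
  rewrite (le_trans (ler_wpM2l _ dz))//; first by rewrite divr_ge0 ?mulr_ge0 ?ltW.
  by rewrite le_eqVlt; apply/orP; left; apply/eqP; field; rewrite !gt_eqF.
by rewrite ler_norml => /andP[? ?] /andP[? ?]; apply/andP; split; lra.
Qed.

(** The image of a small box lies between two parallelepipeds whose volumes, by [prod_addr_near],
    are within a relative error [e] of [w x] times the volume of the box. *)
Let volume_near (x L : 'cV[R]_n) (e : R) : 0 < e -> (forall j, 0 < L j 0) ->
  exists2 t : R, 0 < t & forall (c d : 'cV[R]_n) (s : R), 0 < s < t -> d - c = s *: L ->
    (forall j, c j 0 <= x j 0 <= d j 0) ->
    (((w x - e) * \prod_j (d j 0 - c j 0))%:E <= lam (H @^-1` oc_box c d) /\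
     lam (H @^-1` oc_box c d) <= ((w x + e) * \prod_j (d j 0 - c j 0))%:E)%E.
Proof.
move=> e0 L0; have [h h0 [hprod hL]] := prod_addr_near (w x) e0 L0.
have [e1 e10 h1] := preimage_upper x L h0; have [e2 e20 h2] := preimage_lower x L h0.
exists (Num.min e1 e2) => [|c d s /andP[s0]]; first by rewrite lt_min e10.
rewrite lt_min => /andP[se1 se2] dc hx.
have dcj j : d j 0 - c j 0 = s * L j 0 by move/colP: dc => /(_ j); rewrite !mxE.
have prodE t : \prod_j (s * (L j 0 + 2 * t)) = s ^+ n * \prod_j (L j 0 + 2 * t).
  by rewrite big_split/= prodr_const card_ord.
have prod0 : \prod_j (d j 0 - c j 0) = s ^+ n * \prod_j L j 0.
  by under eq_bigr do rewrite dcj; rewrite big_split/= prodr_const card_ord.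
have sn0 : 0 <= s ^+ n by rewrite exprn_ge0// ltW.
have mB : measurable (H @^-1` oc_box c d).
  by apply: (measurable_preimage_setT mH); exact: measurable_oc_box.
have sh0 : 0 < s * h by rewrite mulr_gt0.
split.
- have cd j : (c + const_mx (s * h)) j 0 <= (d - const_mx (s * h)) j 0.
    have := hL j; rewrite !mxE -(ltr_pM2l s0) -dcj; lra.
  have [mA AE] := affine_box x cd.
  apply: le_trans (le_measure lam _ _ (h2 c d s _ dc hx)); rewrite ?inE ?s0//.
  have PE : \prod_j ((d - const_mx (s * h)) j 0 - (c + const_mx (s * h)) j 0) =
      \prod_j (s * (L j 0 + 2 * - h)).
    by apply: eq_bigr => j _; rewrite !mxE -(subrK (c j 0) (d j 0)) dcj; ring.
  rewrite [leRHS]AE lee_fin prod0 PE.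
    have := hprod (- h); rewrite normrN (gtr0_norm h0) => /(_ (lexx _)).
    rewrite prodE !(mulrCA _ (s ^+ n)) => hp; rewrite ler_wpM2l//.
    by move: hp; rewrite ler_norml mulrBl; lra.
- have cd j : (c - const_mx (s * h)) j 0 <= (d + const_mx (s * h)) j 0.
    have := hL j; rewrite !mxE -(ltr_pM2l s0) -dcj; lra.
  have [mA AE] := affine_box x cd.
  apply: le_trans (le_measure lam _ _ (h1 c d s _ dc hx)) _; rewrite ?inE ?s0//.
  have PE : \prod_j ((d + const_mx (s * h)) j 0 - (c - const_mx (s * h)) j 0) =
      \prod_j (s * (L j 0 + 2 * h)).
    by apply: eq_bigr => j _; rewrite !mxE -(subrK (c j 0) (d j 0)) dcj; ring.
  rewrite [leLHS]AE lee_fin prod0 PE.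
    have := hprod h; rewrite (gtr0_norm h0) => /(_ (lexx _)).
    rewrite prodE !(mulrCA _ (s ^+ n)) => hp; rewrite ler_wpM2l//.
    by move: hp; rewrite ler_norml mulrDl; lra.
Qed.

(** Continuity of [w] gives the integral the same two bounds, so it can be compared with the volume
    of the image box by box. *)
Let integral_near (x L : 'cV[R]_n) (e : R) : 0 < e -> (forall j, 0 < L j 0) ->
  exists2 t : R, 0 < t & forall (c d : 'cV[R]_n) (s : R), 0 < s < t -> d - c = s *: L ->
    (forall j, c j 0 <= x j 0 <= d j 0) ->
    (((w x - e) * \prod_j (d j 0 - c j 0))%:E <= \int[lam]_(y in oc_box c d) (w y)%:E /\
     \int[lam]_(y in oc_box c d) (w y)%:E <= ((w x + e) * \prod_j (d j 0 - c j 0))%:E)%E.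
Proof.
move=> e0 L0.
have : {for x, continuous w} by exact: cw.
move=> /cvgrPdist_le/(_ _ e0)/nbhs_ballP[d0 /= d00 hd].
have L1 : 0 < `|L| + 1 by rewrite ltr_pwDr.
exists (d0 / (`|L| + 1)) => [|c d s /andP[s0 se] dc hx]; first by rewrite divr_gt0.
have mB := measurable_oc_box c d.
have lB : lam (oc_box c d) = (\prod_j (d j 0 - c j 0))%:E.
  by rewrite [LHS]lebesgue_cV_box// => j; have /andP[] := hx j; exact: le_trans.
have iC (r : R) : (\int[lam]_(y in oc_box c d) r%:E = (r * \prod_j (d j 0 - c j 0))%:E)%E.
  by rewrite integral_cst// [X in (_ * X)%E]lB EFinM.
have wx y : oc_box c d y -> w x - e <= w y <= w x + e.
  move=> By; have : `|y - x| < d0.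
    apply: le_lt_trans (_ : s * (`|L| + 1) < _); last by rewrite -ltr_pdivlMr.
    rewrite (le_trans (@dist_box c d x y s L _ _ _ _))//; last first.
      by rewrite (ler_wpM2l (ltW s0))// lerDl.
    by move=> j; have /andP[/ltW -> ->] := By j.
  move=> yx; have /hd : ball x d0 y by rewrite -ball_normE/= distrC.
  by rewrite /= ler_norml; lra.
have mw : measurable_fun (oc_box c d) (EFin \o w).
  apply/measurable_EFinP; apply: measurable_funS measurableT _ _ => //.
  apply: continuous_measurable_cV openT _ => y _; exact: cw.
split.
(* [w x - e] may be negative, and monotonicity is applied to nonnegative integrands. *)
- apply: (@le_trans _ _ (\int[lam]_(y in oc_box c d) (Num.max 0 (w x - e))%:E)%E).
    rewrite iC lee_fin ler_wpM2r ?le_max ?lexx ?orbT//.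
    by apply: prodr_ge0 => j _; rewrite subr_ge0; have /andP[] := hx j; exact: le_trans.
  apply: ge0_le_integral => //.
  + by move=> y _; rewrite lee_fin le_max lexx.
  + by move=> y /wx/andP[h1 _]; rewrite lee_fin ge_max h1 normr_ge0.
- apply: (@le_trans _ _ (\int[lam]_(y in oc_box c d) (w x + e)%:E)%E).
    apply: ge0_le_integral => //.
    + by move=> y _; rewrite lee_fin normr_ge0.
    + by move=> y /wx/andP[_ h1]; rewrite lee_fin.
  by rewrite iC.
Qed.

(** Near every point each of the two measures is at most the other plus a small multiple of Lebesgue
    measure on small boxes. Bisection extends this to any box, and the multiple is then sent to
    zero. *)
Theorem lebesgue_cV_preimage A : measurable A ->
  lam (H @^-1` A) = (\int[lam]_(y in A) `|\det (T y)|%:E)%E.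
Proof.
move=> mA.
have mw : measurable_fun setT w.
  apply: continuous_measurable_cV openT _ => y _; exact: cw.
have [m mE] := density_measure lam mw (fun x => normr_ge0 _).
rewrite -mE; apply: (@cV_measure_unique _ _ (pushforward lam H) m) => // {A mA}.
- move=> a b ab; have ba0 j : 0 < (b - a) j 0 by rewrite !mxE subr_gt0.
  have ab' j : a j 0 <= b j 0 by exact: ltW.
  (* The error has to be a measure itself, so that it adds up over the pieces of a bisected box. *)
  have e3 (e : R) : 0 < e -> exists m3 : {measure set 'cV[R]_n -> \bar R},
      forall c d : 'cV[R]_n, (forall j, c j 0 <= d j 0) ->
      m3 (oc_box c d) = (e * \prod_j (d j 0 - c j 0))%:E.
    move=> e0; have e0' := ltW e0; exists (mscale (NngNum e0') lam) => c d cd.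
    by rewrite EFinM -lebesgue_cV_box.
  have small (t1 t2 : R) : 0 < t1 -> 0 < t2 -> exists2 e, 0 < e & forall s, 0 < s < e ->
      (0 < s < t1) && (0 < s < t2).
    move=> t10 t20; exists (Num.min t1 t2); first by rewrite lt_min t10.
    by move=> s /andP[->]; rewrite lt_min => /andP[-> ->].
  apply/eqP; rewrite eq_le; apply/andP; split; apply/lee_addgt0Pr => e e0.
  + pose V := \prod_j (b j 0 - a j 0).
    have V0 : 0 < V by apply: prodr_gt0 => j _; have := ba0 j; rewrite !mxE.
    (* The total error [e] is spread with density [e / V] over the box, half for each of the two
       local estimates. *)
    have e2 : 0 < e / V / 2 by rewrite !divr_gt0.
    have [m3 m3E] := e3 _ (divr_gt0 e0 V0).
    rewrite [e in (_ + e%:E)%E](_ : e = e / V * V); last by rewrite divfK ?gt_eqF.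
    rewrite -m3E//; apply: oc_box_le_locally => // x _.
    have [t1 t10 h1] := volume_near x e2 ba0; have [t2 t20 h2] := integral_near x e2 ba0.
    have [t t0 ht] := small _ _ t10 t20; exists t => // c d s /ht/andP[st1 st2] dc hx.
    have [_ h3] := h1 c d s st1 dc hx; have [h4 _] := h2 c d s st2 dc hx.
    apply: (le_trans h3); rewrite m3E => [|j]; last by have /andP[] := hx j; exact: le_trans.
    rewrite mE; apply: le_trans (leeD h4 (lexx _)); rewrite -EFinD lee_fin -mulrDl.
    by rewrite ler_wpM2r//; [apply: prodr_ge0 => j _; rewrite subr_ge0; have /andP[] := hx j; exact: le_trans|lra].
  + pose V := \prod_j (b j 0 - a j 0).
    have V0 : 0 < V by apply: prodr_gt0 => j _; have := ba0 j; rewrite !mxE.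
    have e2 : 0 < e / V / 2 by rewrite !divr_gt0.
    have [m3 m3E] := e3 _ (divr_gt0 e0 V0).
    rewrite [e in (_ + e%:E)%E](_ : e = e / V * V); last by rewrite divfK ?gt_eqF.
    rewrite -m3E//; apply: oc_box_le_locally => // x _.
    have [t1 t10 h1] := volume_near x e2 ba0; have [t2 t20 h2] := integral_near x e2 ba0.
    have [t t0 ht] := small _ _ t10 t20; exists t => // c d s /ht/andP[st1 st2] dc hx.
    have [h3 _] := h1 c d s st1 dc hx; have [_ h4] := h2 c d s st2 dc hx.
    rewrite mE; apply: (le_trans h4).
    rewrite m3E => [|j]; last by have /andP[] := hx j; exact: le_trans.
    apply: le_trans (leeD h3 (lexx _)); rewrite -EFinD lee_fin -mulrDl.
    by rewrite ler_wpM2r//; [apply: prodr_ge0 => j _; rewrite subr_ge0; have /andP[] := hx j; exact: le_trans|lra].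
- move=> k; rewrite /pushforward.
  (* In positive dimension [cube 0] is empty and has sides of length zero, while [volume_near] asks
     for positive ones. *)
  apply: le_lt_trans (_ : lam (H @^-1` cube k.+1) < _)%E.
    apply: (le_measure lam); rewrite ?inE; [exact: (measurable_preimage_setT mH (measurable_oc_box _ _))..|].
    move=> z hz i; have := hz i; rewrite !mxE -natr1 => /andP[? ?]; apply/andP; split; lra.
  have c0 : forall j : 'I_n, (const_mx (- k.+1%:R) : 'cV[R]_n) j 0 < (const_mx k.+1%:R : 'cV[R]_n) j 0.
    by move=> j; rewrite !mxE; have : 0 < k.+1%:R :> R by []; lra.
  apply: (@oc_box_lty_locally _ _ (pushforward lam H)) => [j|x _]; first exact: ltW.
  have L0 : forall j : 'I_n, 0 < (const_mx k.+1%:R - const_mx (- k.+1%:R) : 'cV[R]_n) j 0.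
    by move=> j; rewrite !mxE; have : 0 < k.+1%:R :> R by []; lra.
  have [t t0 ht] := volume_near x ltr01 L0; exists t => // c d s st dc hx.
  by have [_ h] := ht c d s st dc hx; apply: le_lt_trans h _; rewrite ltry.
Qed.

End change_of_variables.

(** * Integrals and null sets under a change of variables with density *)

Section integral_density.
Local Open Scope ereal_scope.
Context {R : realType} d1 d2 (X : measurableType d1) (Y : measurableType d2).
Variables (m1 : {measure set X -> \bar R}) (m2 : {measure set Y -> \bar R}).
Variables (phi : X -> Y) (w : X -> R).
Hypotheses (mphi : measurable_fun setT phi) (mw : measurable_fun setT w).
Hypothesis w0 : forall x, (0 <= w x)%R.
Hypothesis m2E : forall B, measurable B -> m2 B = \int[m1]_(x in phi @^-1` B) (w x)%:E.
Import HBNNSimple.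

Let integral_piece (f : {nnsfun Y >-> R}) (r : R) :
  \int[m2]_y (r * \1_(f @^-1` [set r]) y)%:E =
  \int[m1]_x (r * \1_(f @^-1` [set r]) (phi x) * w x)%:E.
Proof.
have [r0|r0] := ltP r 0%R.
  by rewrite preimage_nnfun0// !integral0_eq// => x _; rewrite indic0 ?mulr0 ?mul0r.
have mB : measurable (f @^-1` [set r]) by [].
rewrite integralZl_indic_nnsfun// integral_indic// setIT m2E//.
under [RHS]eq_integral do rewrite -mulrA EFinM.
rewrite ge0_integralZl//; last 2 first.
- apply/measurable_EFinP; apply: measurable_funM => //.
  exact: (measurableT_comp (measurable_indic mB)).
- by move=> x _; rewrite lee_fin mulr_ge0.
congr (_ * _); rewrite integral_mkcond; apply: eq_integral => x _.
rewrite patchE indicE.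
have -> : (x \in phi @^-1` (f @^-1` [set r])) = (phi x \in f @^-1` [set r]) by [].
by case: ifP => _; rewrite ?mul1r ?mul0r.
Qed.

Let integral_sfun (f : {nnsfun Y >-> R}) :
  \int[m2]_y (f y)%:E = \int[m1]_x (f (phi x) * w x)%:E.
Proof.
under eq_integral do rewrite fimfunE -fsumEFin//.
rewrite ge0_integral_fsum//; last 2 first.
- by move=> r; exact/measurable_EFinP/measurable_funM.
- by move=> r y _; rewrite nnfun_muleindic_ge0.
under eq_fsbigr do rewrite integral_piece.
have piece_ge0 r x : (0 <= r * \1_(f @^-1` [set r]) (phi x) * w x)%R.
  by rewrite mulr_ge0//; have := nnfun_muleindic_ge0 f r (phi x); rewrite -lee_fin EFinM.
rewrite -ge0_integral_fsum//; last 2 first.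
- move=> r; apply/measurable_EFinP/measurable_funM => //; apply: measurable_funM => //.
  exact: (measurableT_comp (measurable_indic _)).
- by move=> r x _; rewrite lee_fin.
apply: eq_integral => x _; rewrite fsumEFin// -mulr_fsuml; congr (_ * _)%:E.
by rewrite [RHS]fimfunE.
Qed.

(** The hypothesis [m2E] is the case of indicators; it extends to simple functions by linearity and
    to [u] by monotone convergence. *)
Lemma ge0_integral_density_pushforward (u : Y -> \bar R) :
  measurable_fun setT u -> (forall y, 0 <= u y) ->
  \int[m2]_y u y = \int[m1]_x (u (phi x) * (w x)%:E).
Proof.
move=> mu u0; pose f_ := nnsfun_approx measurableT mu.
transitivity (limn (fun n => \int[m2]_y (f_ n y)%:E)).
  rewrite -monotone_convergence//.
  - apply: eq_integral => y _; apply/esym/cvg_lim => //.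
    by apply: cvg_nnsfun_approx.
  - by move=> n; exact/measurable_EFinP/measurable_funP.
  - by move=> n y _; rewrite lee_fin.
  - by move=> y _ m n mn; rewrite lee_fin; exact/lefP/nd_nnsfun_approx.
under eq_fun do rewrite integral_sfun.
rewrite -monotone_convergence//.
- apply: eq_integral => x _; apply/cvg_lim => //.
  under eq_fun do rewrite EFinM.
  by apply: cvgeZr => //; apply: cvg_nnsfun_approx.
- move=> n; apply/measurable_EFinP; apply: measurable_funM => //.
  exact: (measurableT_comp (measurable_funP (f_ n))).
- by move=> n x _; rewrite lee_fin mulr_ge0.
- move=> x _ m n mn; rewrite lee_fin ler_wpM2r//.
  exact/lefP/nd_nnsfun_approx.
Qed.

(** The integral of [w] over the preimage of a null set is zero, so [w] vanishes almost everywhere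
    there; as it is positive, the preimage is null. *)
Lemma negligible_preimage (N : set Y) : (forall x, (0 < w x)%R) ->
  m2.-negligible N -> m1.-negligible (phi @^-1` N).
Proof.
move=> w_gt0 [B [mB B0 NB]].
have mpB : measurable (phi @^-1` B) by rewrite -[X in measurable X]setTI; exact: mphi.
have mEw : measurable_fun (phi @^-1` B) (EFin \o w).
  by apply/measurable_EFinP; exact: measurable_funTS.
have [+ _] := ae_eq_integral_abs m1 mpB mEw.
move=> /(_ _) []; last first.
  move=> N' [mN' N'0 sub]; exists N'; split=> // x px; apply: sub => /=.
  move=> /(_ (NB _ px)) /eqP; rewrite /= eqe => /eqP wx0.
  by have := w_gt0 x; rewrite wx0 ltxx.
rewrite -B0 m2E//; apply: eq_integral => x _ /=.
by rewrite ger0_norm.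
Qed.

End integral_density.

(** * Differential calculus *)

Section differentiable_eps.
Context {R : realType} {V W : normedModType R}.
Implicit Types (F : V -> W) (x y v : V).

Lemma differentiable_eps F x e : differentiable F x -> 0 < e ->
  exists2 d : R, 0 < d & forall y, `|y - x| < d ->
    `|F y - F x - 'd F x (y - x)| <= e * `|y - x|.
Proof.
move=> /diff_locally dF e0; move: dF; set k := 'o _ => dF.
have /(littleoP [littleo of k])/nbhs_ballP[d /= d0 hd] := e0.
exists d => // y yx; have := congr1 (@^~ (y - x)) dF; rewrite /= subrK => ->.
have -> : (cst (F x) + 'd F x + k) (y - x) - F x - 'd F x (y - x) = k (y - x).
  rewrite -[(cst (F x) + 'd F x + k) (y - x)]/(F x + 'd F x (y - x) + k (y - x)).
  by rewrite -addrA -opprD addrC addKr.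
by apply: hd; rewrite -ball_normE/= sub0r normrN.
Qed.

Lemma eps_differentiable F x (L : {linear V -> W}) : continuous L ->
  (forall e : R, 0 < e -> exists2 d : R, 0 < d & forall y, `|y - x| < d ->
    `|F y - F x - L (y - x)| <= e * `|y - x|) ->
  differentiable F x /\ 'd F x = L :> (V -> W).
Proof.
move=> cL hF.
have H : F \o shift x = cst (F x) + L +o_ (0 : V) id.
  apply/eqaddoP => e e0; have [d d0 hd] := hF e e0.
  apply/nbhs_ballP; exists d => //= y; rewrite -ball_normE/= sub0r normrN => yd.
  by have := hd (y + x); rewrite addrK => /(_ yd); rewrite /= opprD addrA.
have dE := diff_unique cL H.
by split => //; apply/diff_locallyP; rewrite dE.
Qed.

(** Transfers estimates on finite increments, such as Gronwall bounds, to directional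
    derivatives. *)
Lemma derive_dist_le F x v (c : W) (e : R) : derivable F x v ->
  (\forall h \near 0^', `|h^-1 *: (F (h *: v + x) - F x) - c| <= e) ->
  `|'D_v F x - c| <= e.
Proof.
move=> dF H; apply: (@cvgr_to_le _ _ _ _ (fun h : R => `|h^-1 *: (F (h *: v + x) - F x) - c|)) H.
by apply: cvg_norm; apply: cvgB; [exact: dF|exact: cvg_cst].
Qed.

End differentiable_eps.

Section is_derive_lemmas.
Context {R : realType}.

Lemma eps_is_derive1 (F : R -> R) (t d : R) :
  (forall e : R, 0 < e -> exists2 r : R, 0 < r & forall s, `|s - t| < r ->
    `|F s - F t - (s - t) * d| <= e * `|s - t|) ->
  is_derive t 1 F d.
Proof.
move=> H.
have lin : linear (fun y : R => y * d) by move=> a x y; rewrite mulrDl scalerAl.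
pose L : {linear R -> R} := HB.pack (fun y : R => y * d)
  (GRing.isLinear.Build _ _ _ _ (fun y : R => y * d) lin).
have cL : continuous L by move=> y; apply: cvgMr_tmp; exact: cvg_id.
have [dF dE] := eps_differentiable cL H.
apply: DeriveDef; first exact: diff_derivable.
by rewrite deriveE// dE/= mul1r.
Qed.

Variables (V : normedModType R) (m n : nat).
Implicit Types (M : V -> 'M[R]_(m, n)).

Lemma is_derive_coord M x v (D : 'M[R]_(m, n)) i j : is_derive x v M D ->
  is_derive x v (fun y => M y i j) (D i j).
Proof.
move=> [dM <-]; apply: DeriveDef; first by move/derivable_mxP: dM.
by rewrite derive_mx// mxE.
Qed.

Lemma coord_is_derive M x v (D : 'M[R]_(m, n)) : (forall i j, is_derive x v (fun y => M y i j) (D i j)) ->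
  is_derive x v M D.
Proof.
move=> h; have dM : derivable M x v.
  by apply/derivable_mxP => i j; exact: (@ex_derive _ _ _ _ _ _ _ (h i j)).
apply: DeriveDef => //; rewrite derive_mx//; apply/matrixP => i j; rewrite mxE.
exact: (@derive_val _ _ _ _ _ _ _ (h i j)).
Qed.

Lemma differentiable_coords M x : (forall i j, differentiable (fun y => M y i j : R) x) ->
  differentiable M x.
Proof.
move=> h.
have -> : M = (fun y => \sum_(i < m) \sum_(j < n) (M y i j *: delta_mx i j)).
  by apply/funext => y; rewrite {1}(matrix_sum_delta (M y)).
rewrite (_ : (fun y => _) = \sum_(i < m) (fun y => \sum_(j < n) (M y i j *: delta_mx i j))).
  apply: differentiable_sum => i.
  rewrite (_ : (fun y => _) = \sum_(j < n) (fun y => M y i j *: delta_mx i j)).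
    by apply: differentiable_sum => j; exact: differentiableZl.
  by apply/funext => y; rewrite fct_sumE.
by apply/funext => y; rewrite fct_sumE.
Qed.

Lemma differentiable_coord_of M x i j : differentiable M x ->
  differentiable (fun y => M y i j : R) x.
Proof.
move=> dM; apply: (differentiable_comp (f := M) (g := fun N : 'M[R]_(m, n) => N i j : R)) => //.
exact: differentiable_coord.
Qed.

Lemma derive_coord M x v i j : derivable M x v ->
  'D_v (fun y => M y i j) x = 'D_v M x i j.
Proof. by move=> dM; rewrite derive_mx// mxE. Qed.

End is_derive_lemmas.

Section chain.
Context {R : realType} {V W : normedModType R}.

Lemma derive_comp (U : normedModType R) (c : U -> V) (F : V -> W) x u :
  differentiable c x -> differentiable F (c x) ->
  'D_u (F \o c) x = 'D_('D_u c x) F (c x).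
Proof.
move=> dc dF; rewrite !deriveE//; last exact: differentiable_comp.
by rewrite diff_comp.
Qed.

Lemma is_derive1_compV (c : R -> V) (F : V -> W) (t : R) v :
  is_derive t 1 c v -> differentiable F (c t) -> is_derive t 1 (F \o c) ('D_v F (c t)).
Proof.
move=> [dc <-] dF; have dc' : differentiable c t by exact/derivable1_diffP.
apply: DeriveDef; last exact: derive_comp.
by apply/derivable1_diffP; exact: differentiable_comp.
Qed.

Lemma deriveDl (F : V -> W) x u v (a b : R) : differentiable F x ->
  'D_(a *: u + b *: v) F x = a *: 'D_u F x + b *: 'D_v F x.
Proof. by move=> dF; rewrite !deriveE// linearD !linearZ. Qed.

Lemma derive_suml (F : V -> W) x (I : Type) (r : seq I) (a : I -> R) (u : I -> V) : differentiable F x ->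
  'D_(\sum_(i <- r) a i *: u i) F x = \sum_(i <- r) a i *: 'D_(u i) F x.
Proof.
by move=> dF; rewrite deriveE// linear_sum; apply: eq_bigr => i _; rewrite linearZ deriveE.
Qed.

End chain.

Section jacobian.
Context {R : realType} {n : nat}.
Notation V := 'cV[R]_n.

Lemma cV_sum_basis (v : V) : v = \sum_i v i 0 *: basis_vec i.
Proof.
rewrite {1}(matrix_sum_delta v); apply: eq_bigr => i _.
by rewrite big_ord_recl big_ord0 addr0.
Qed.

Lemma derive_sum_basis (W : normedModType R) (F : V -> W) x v : differentiable F x ->
  'D_v F x = \sum_i v i 0 *: 'D_(basis_vec i) F x.
Proof. by move=> dF; rewrite {1}(cV_sum_basis v) derive_suml. Qed.

Lemma jacobian_mxE (F : V -> V) x i j : differentiable F x ->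
  jacobian_mx F x i j = 'D_(basis_vec j) F x i 0.
Proof. by move=> dF; rewrite mxE derive_coord//; exact: diff_derivable. Qed.

Lemma derive_jacobian (F : V -> V) x v : differentiable F x ->
  'D_v F x = jacobian_mx F x *m v.
Proof.
move=> dF; apply/colP => i; rewrite derive_sum_basis// summxE !mxE.
by apply: eq_bigr => j _; rewrite jacobian_mxE// mxE mulrC.
Qed.

Lemma jacobian_comp (F G : V -> V) x : differentiable G x -> differentiable F (G x) ->
  jacobian_mx (F \o G) x = jacobian_mx F (G x) *m jacobian_mx G x.
Proof.
move=> dG dF; apply/matrixP => i j; rewrite jacobian_mxE; last exact: differentiable_comp.
rewrite derive_comp// derive_jacobian// !mxE; apply: eq_bigr => k _.
by rewrite (jacobian_mxE k j dG).
Qed.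

Lemma mulmx_continuous m p (M : 'M[R]_(m, p)) : continuous (mulmx M : 'cV[R]_p -> 'cV[R]_m).
Proof.
move=> x; apply/(@cvgrPdist_le _ _ _ (nbhs x) (nbhs_filter x)) => e e0; have K0 : 0 < p%:R * `|M| + 1 by rewrite ltr_pwDr// mulr_ge0.
near=> y; rewrite -mulmxBr (le_trans (norm_mulmx_le _ _))//.
rewrite (@le_trans _ _ ((p%:R * `|M| + 1) * `|x - y|))// ?ler_wpM2r ?lerDl//.
rewrite -ler_pdivlMl//; near: y; apply: cvgr_dist_le; first exact: cvg_id.
by rewrite mulr_gt0// invr_gt0.
Unshelve. all: by end_near. Qed.

Lemma differentiable_mulmx m p (M : 'M[R]_(m, p)) x :
  differentiable (mulmx M : 'cV[R]_p -> 'cV[R]_m) x.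
Proof. exact/linear_differentiable/mulmx_continuous. Qed.

Lemma jacobian_mulmx (M : 'M[R]_n) x : jacobian_mx (mulmx M) x = M.
Proof.
apply/matrixP => i j; rewrite jacobian_mxE; last exact: differentiable_mulmx.
rewrite deriveE; last exact: differentiable_mulmx.
rewrite diff_lin; last exact: mulmx_continuous.
rewrite mxE (bigD1 j)//= mxE !eqxx mulr1 big1 ?addr0// => k kj.
by rewrite mxE (negbTE kj) mulr0.
Qed.

Lemma jacobian_id x : jacobian_mx (id : V -> V) x = 1%:M.
Proof.
by apply/matrixP => i j; rewrite jacobian_mxE// derive_id !mxE andbT.
Qed.

Lemma jacobian_eps (F : V -> V) x (e : R) : differentiable F x -> 0 < e ->
  exists2 d : R, 0 < d & forall y, `|y - x| < d ->
    `|F y - F x - jacobian_mx F x *m (y - x)| <= e * `|y - x|.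
Proof.
move=> dF e0; have [d d0 hd] := differentiable_eps dF e0; exists d => // y /hd.
by rewrite -deriveE// derive_jacobian.
Qed.

End jacobian.

Section partial.
Context {R : realType} {n : nat}.
Notation V := 'cV[R]_n.

Lemma derive_pair (W : normedModType R) (F : R * V -> W) p (k : R) v : differentiable F p ->
  'D_(k, v) F p = k *: 'D_(1, 0) F p + \sum_i v i 0 *: 'D_(0, basis_vec i) F p.
Proof.
move=> dF; rewrite -[X in _ + X]scale1r.
have -> : (k, v) = k *: (1, 0) + 1 *: (0, v) :> R * V.
  congr pair; first by rewrite /= -[k *: 1]/(k * 1) -[1 *: 0]/(1 * 0) mulr1 mulr0 addr0.
  by rewrite /= scaler0 add0r scale1r.
rewrite deriveDl//; congr (_ + _ *: _).
have -> : (0, v) = \sum_i v i 0 *: (0, basis_vec i) :> R * V.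
  rewrite {1}(cV_sum_basis v); elim/big_rec2: _ => // i y1 y2 _ <-.
  by congr pair; rewrite /= -[v i 0 *: 0]/(v i 0 * 0) mulr0 addr0.
exact: derive_suml.
Qed.

Lemma differentiable_pairl (W : normedModType R) (F : R * V -> W) t x :
  differentiable F (t, x) -> differentiable (fun y => F (t, y)) x.
Proof.
move=> dF; apply: (differentiable_comp (f := fun y : V => (t, y))) => //.
Qed.

Lemma derive_pairl (W : normedModType R) (F : R * V -> W) t x v :
  'D_v (fun y => F (t, y)) x = 'D_(0, v) F (t, x).
Proof.
rewrite /derive; apply: (congr1 (fun G : R -> W => lim (G @ 0^'))); apply/funext => h; congr (_ *: (F _ - _)).
by congr pair; rewrite /= -[h *: 0]/(h * 0) mulr0 add0r.
Qed.

Lemma derive_pairr (W : normedModType R) (F : R * V -> W) (t : R) x :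
  'D_1 (fun s => F (s, x)) t = 'D_(1, 0) F (t, x).
Proof.
rewrite /derive; apply: (congr1 (fun G : R -> W => lim (G @ 0^'))); apply/funext => h; congr (_ *: (F _ - _)).
by congr pair; rewrite /= scaler0 add0r.
Qed.

End partial.

Section mean_value.
Context {R : realType}.

(** The end points come in either order, because flows are followed both forwards and backwards in
    time. *)
Lemma MVT_between (f df : R -> R) (a b : R) :
  (forall x, Num.min a b <= x <= Num.max a b -> is_derive x 1 f (df x)) ->
  exists2 c, Num.min a b <= c <= Num.max a b & f b - f a = (b - a) * df c.
Proof.
move=> h; have H (u v : R) : u <= v ->
    (forall x : R, u <= x <= v -> is_derive x 1 f (df x)) ->
    exists2 c : R, u <= c <= v & f v - f u = (v - u) * df c.
  move=> uv hd; have [||c] := @MVT_segment _ f df u v uv.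
  - by move=> x; rewrite in_itv/= => /andP[? ?]; apply: hd; rewrite !ltW.
  - apply: derivable_within_continuous => x; rewrite in_itv/= => /hd[]//.
  by rewrite in_itv/= mulrC => ? ?; exists c.
move: h; have [ab|ba] := leP a b => h; first exact: H.
have [c hc fE] := H _ _ (ltW ba) h; exists c => //.
by rewrite -opprB fE -mulNr opprB.
Qed.

Lemma between_dist (a b c : R) : Num.min a b <= c <= Num.max a b ->
  `|c - a| <= `|b - a| /\ `|c - b| <= `|b - a|.
Proof.
rewrite ge_min le_max => /andP[h1 h2]; rewrite !ler_norml.
have [ab|ba] := leP a b.
  by move: h1 h2; rewrite (ger0_norm (_ : 0 <= b - a)) ?subr_ge0//; lra.
by move: h1 h2; rewrite (ltr0_norm (_ : b - a < 0)) ?subr_lt0//; lra.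
Qed.

End mean_value.

Lemma is_derive_affine (R : realType) (a b u : R) : is_derive u 1 (fun y => a + y * b) b.
Proof.
apply: eps_is_derive1 => e e0; exists 1 => // s _.
by rewrite (_ : _ - _ - _ = 0) ?normr0 ?mulr_ge0// ?ltW//; ring.
Qed.

Section strict_partial.
Context {R : realType} {n : nat}.
Notation V := 'cV[R]_n.

Lemma ler_sum_norm (c : 'I_n -> R) (v : V) (e : R) : 0 <= e -> (forall i, `|c i| <= e / n.+1%:R) ->
  `|\sum_i v i 0 * c i| <= e * `|v|.
Proof.
move=> e0 hc; rewrite (le_trans (ler_norm_sum _ _ _))//.
rewrite (@le_trans _ _ (\sum_(i < n) (e / n.+1%:R) * `|v|))//.
  by apply: ler_sum => i _; rewrite normrM mulrC ler_pM// le_mx_norm.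
rewrite sumr_const card_ord -mulrnAl ler_wpM2r// -mulr_natr -mulrA ler_piMr//.
by rewrite mulrC ler_pdivrMr// mul1r ler_nat.
Qed.

(* Differentiability in x with an error uniform in the increment (a, b) and in s:
   no continuity of the time derivative is needed. *)
Lemma strict_partial (F : R * V -> R) (t : R) (x : V) (e : R) :
  (forall q, differentiable F q) ->
  (forall k, {for (t, x), continuous ('D_(0, basis_vec k) F)}) -> 0 < e ->
  exists2 r : R, 0 < r & forall s (a b : V), `|s - t| < r -> `|a - x| < r -> `|b - x| < r ->
    `|F (s, b) - F (s, a) - \sum_k (b - a) k 0 * 'D_(0, basis_vec k) F (t, x)| <= e * `|b - a|.
Proof.
move=> dF cF e0.
have : \forall q \near (t, x), forall k,
    `|'D_(0, basis_vec k) F (t, x) - 'D_(0, basis_vec k) F q| <= e / n.+1%:R.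
  apply: (@filter_forall _ 'I_n _ _ (nbhs_filter (t, x))) => k.
  have := @cvgrPdist_le _ _ _ (nbhs (t, x)) (nbhs_filter (t, x)) ('D_(0, basis_vec k) F) ('D_(0, basis_vec k) F (t, x)).
  by move=> [+ _]; move=> /(_ (cF k)); apply; rewrite divr_gt0.
move=> /nbhs_ballP[r /= r0 hr]; exists r => // s a b st ax bx.
pose c (u : R) := a + u *: (b - a).
have dc (u : R) : is_derive u 1 c (b - a).
  apply: coord_is_derive => i j.
  rewrite (_ : (fun y => c y i j) = (fun y => a i j + y * (b - a) i j)).
    exact: is_derive_affine.
  by apply/funext => y; rewrite !mxE.
have dFc (u : R) : is_derive u 1 (fun u => F (s, c u)) ('D_(0, b - a) F (s, c u)).
  rewrite -derive_pairl; apply: (is_derive1_compV (F := fun y => F (s, y)) (dc u)).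
  exact: differentiable_pairl.
have [u hu] := @MVT_between _ (fun u => F (s, c u)) (fun u => 'D_(0, b - a) F (s, c u)) 0 1 (fun u _ => dFc u).
rewrite /c scale1r scale0r addr0 [a + (b - a)]addrC subrK subr0 mul1r => ->.
rewrite -/(c u) derive_pair// scale0r add0r -sumrB.
under eq_bigr do rewrite -mulrBr.
apply: ler_sum_norm; first exact: ltW.
(* The point given by the mean value theorem lies on the segment from [a] to [b], hence by convexity
   in the ball where the partial derivatives are close to those at [(t, x)]. *)
move=> k; rewrite distrC; apply: hr; rewrite -ball_normE/= prod_normE gt_max/=.
rewrite distrC st/=.
have : 0 <= u <= 1 by move: hu; rewrite min_l ?ler01// max_r ?ler01.
move=> /andP[u0 u1]; have -> : x - c u = (1 - u) *: (x - a) + u *: (x - b).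
  by rewrite /c; apply/colP => i; rewrite !mxE; ring.
rewrite (le_lt_trans (ler_normD _ _))// !normrZ (ger0_norm u0) ger0_norm ?subr_ge0//.
rewrite [`|x - a|]distrC [`|x - b|]distrC.
(* The strict bound comes from the distance to [a] when [u = 0], and from the distance to [b]
   otherwise. *)
have [->|un0] := eqVneq u 0; first by rewrite subr0 mul1r mul0r addr0.
have up : 0 < u by rewrite lt0r un0.
apply: (@le_lt_trans _ _ ((1 - u) * r + u * `|b - x|)).
  by rewrite lerD2r ler_wpM2l ?subr_ge0// ltW.
have : u * `|b - x| < u * r by rewrite ltr_pM2l.
by lra.
Qed.

(* Only the time derivative P has to be continuous: the mean value theorem is
   applied in t alone. *)
Lemma differentiable_of_partials (F P : R * V -> R) (t : R) (x : V) :
  (forall (s : R) (y : V), is_derive s 1 (fun s => F (s, y)) (P (s, y))) ->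
  {for (t, x), continuous P} -> differentiable (fun y => F (t, y)) x ->
  differentiable F (t, x) /\
  forall k v, 'D_(k, v) F (t, x) = k * P (t, x) + 'D_v (fun y => F (t, y)) x.
Proof.
move=> dF cP dFx; set d := 'd (fun y => F (t, y)) x.
have lin : linear (fun q : R * V => q.1 * P (t, x) + d q.2).
  move=> a q1 q2 /=; rewrite linearD linearZ/= -[a *: (_ + _)]/(a * (_ + _)).
  by rewrite -[a *: q1.1]/(a * q1.1) -[a *: d _]/(a * d _); ring.
pose L : {linear (R * V)%type -> R^o} := HB.pack (fun q : R * V => q.1 * P (t, x) + d q.2)
  (GRing.isLinear.Build _ _ _ _ (fun q : R * V => q.1 * P (t, x) + d q.2) lin).
have cL : continuous L.
  move=> q; apply: cvgD; first by apply: cvgMr_tmp; exact: cvg_fst.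
  apply: (@continuous_comp _ _ _ snd d); first exact: cvg_snd.
  exact: diff_continuous.
have [dFp dE] : differentiable F (t, x) /\ 'd F (t, x) = L :> (R * V -> R).
  apply: eps_differentiable => // e e0; have e2 : 0 < e / 2 by rewrite divr_gt0.
  have [r1 r10 h1] := differentiable_eps dFx e2.
  have /(@cvgrPdist_le _ _ _ (nbhs (t, x)) (nbhs_filter (t, x)))/(_ _ e2)/nbhs_ballP[r2 /= r20 h2] := cP.
  exists (Num.min r1 r2) => [|[s y]]; first by rewrite lt_min r10.
  rewrite prod_normE gt_max !lt_min => /andP[/andP[_ s2] /andP[y1 y2]] /=.
  have -> : F (s, y) - F (t, x) - ((s - t) * P (t, x) + d (y - x)) =
      (F (s, y) - F (t, y) - (s - t) * P (t, x)) + (F (t, y) - F (t, x) - d (y - x)) by ring.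
  have [c hc ->] := @MVT_between _ (fun s => F (s, y)) (fun s => P (s, y)) t s (fun s _ => dF s y).
  have [hc1 _] := between_dist hc.
  rewrite (le_trans (ler_normD _ _))// [leRHS](_ : _ = e / 2 * `|(s, y) - (t, x)| + e / 2 * `|(s, y) - (t, x)|); last first.
    by rewrite -mulrDl -splitr.
  rewrite lerD//.
    rewrite -mulrBr normrM mulrC ler_pM//; last by rewrite prod_normE le_max lexx.
    rewrite distrC; apply: h2; rewrite -ball_normE/= prod_normE gt_max/=.
    by rewrite ![`|_ - c|]distrC ![`|x - y|]distrC y2 (le_lt_trans hc1).
  by rewrite (le_trans (h1 _ y1))// ler_wpM2l ?(ltW e2)// prod_normE le_max lexx orbT.
split=> // k v; rewrite deriveE// dE /= -deriveE//.
Qed.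

End strict_partial.

Section C1_functions.
Context {R : realType} {W : normedModType R}.

Definition C1fun (F : W -> R) := (forall x, differentiable F x) /\ forall v, continuous ('D_v F).

Lemma C1fun_cst c : C1fun (fun=> c).
Proof.
split=> [x|v]; first exact: differentiable_cst.
by rewrite (_ : 'D_v _ = cst 0); [move=> x; exact: cvg_cst|apply/funext => x; exact: derive_cst].
Qed.

Lemma C1funD F G : C1fun F -> C1fun G -> C1fun (fun x => F x + G x).
Proof.
move=> [dF cF] [dG cG]; split=> [x|v]; first exact: differentiableD.
rewrite (_ : 'D_v _ = (fun x => 'D_v F x + 'D_v G x)).
  by move=> x; apply: cvgD; [exact: cF|exact: cG].
by apply/funext => x; rewrite -[LHS]/('D_v (F + G) x) deriveD//; exact: diff_derivable.
Qed.

Lemma C1funM F G : C1fun F -> C1fun G -> C1fun (fun x => F x * G x).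
Proof.
move=> [dF cF] [dG cG]; split=> [x|v]; first exact: differentiableM.
rewrite (_ : 'D_v _ = (fun x => F x * 'D_v G x + G x * 'D_v F x)).
  move=> x; apply: cvgD; apply: cvgM; [|exact: cG| |exact: cF];
    by apply: differentiable_continuous.
by apply/funext => x; rewrite -[LHS]/('D_v (F * G) x) deriveM//; exact: diff_derivable.
Qed.

Lemma C1fun_sum (I : Type) (r : seq I) (F : I -> W -> R) :
  (forall i, C1fun (F i)) -> C1fun (fun x => \sum_(i <- r) F i x).
Proof.
move=> hF; elim: r => [|i r IH].
  by under [X in C1fun X]eq_fun do rewrite big_nil; exact: C1fun_cst.
by under [X in C1fun X]eq_fun do rewrite big_cons; exact: C1funD.
Qed.

Lemma C1fun_prod (I : Type) (r : seq I) (F : I -> W -> R) :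
  (forall i, C1fun (F i)) -> C1fun (fun x => \prod_(i <- r) F i x).
Proof.
move=> hF; elim: r => [|i r IH].
  by under [X in C1fun X]eq_fun do rewrite big_nil; exact: C1fun_cst.
by under [X in C1fun X]eq_fun do rewrite big_cons; exact: C1funM.
Qed.

Lemma C1fun_det n (J : W -> 'M[R]_n) : (forall i j, C1fun (fun x => J x i j)) ->
  C1fun (fun x => \det (J x)).
Proof.
move=> hJ; apply: C1fun_sum => s; apply: C1funM; first exact: C1fun_cst.
by apply: C1fun_prod => i; exact: hJ.
Qed.

End C1_functions.

(** * Derivative of the determinant at the identity *)

Section derive_det.
Context {R : realType}.

Lemma is_derive_prod (I : eqType) (F : I -> R -> R) (d : I -> R) (t : R) (r : seq I) : uniq r ->
  (forall i, is_derive t 1 (F i) (d i)) ->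
  is_derive t 1 (fun s => \prod_(i <- r) F i s)
    (\sum_(k <- r) d k * \prod_(i <- r | i != k) F i t).
Proof.
move=> + dF; elim: r => [_|k r IH /= /andP[kr ur]].
  by under eq_fun do rewrite big_nil; rewrite big_nil; exact: is_derive_cst.
under eq_fun do rewrite big_cons.
apply: (@is_derive_eq _ _ _ (F k * (fun s => \prod_(i <- r) F i s))).
  by apply: is_deriveM; exact: IH.
rewrite [RHS]big_cons addrC; congr (_ + _).
  rewrite mulrC big_cons eqxx /=; congr (_ * _); rewrite [LHS]big_seq [RHS]big_seq_cond.
  apply: eq_bigl => i; case: (boolP (i \in r)) => //= ir.
  by apply/esym/(memPn kr).
rewrite -[LHS]/(_ * _) mulr_sumr !big_seq; apply: eq_bigr => i ir.
by rewrite big_cons eq_sym (memPn kr _ ir) mulrCA.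
Qed.

Lemma is_derive_bigsum (I : Type) (F : I -> R -> R) (d : I -> R) (t : R) (r : seq I) :
  (forall i, is_derive t 1 (F i) (d i)) ->
  is_derive t 1 (fun s => \sum_(i <- r) F i s) (\sum_(i <- r) d i).
Proof.
move=> dF; elim: r => [|k r IH].
  by under eq_fun do rewrite big_nil; rewrite big_nil; exact: is_derive_cst.
under eq_fun do rewrite big_cons; rewrite big_cons.
exact: (@is_deriveD _ _ _ (F k) (fun s => \sum_(i <- r) F i s)).
Qed.

(** In the Leibniz expansion only the identity permutation contributes: any other one moves at least
    two indices, so after one factor is differentiated an off-diagonal zero remains. The identity is
    the only base point needed, since flows compose. *)
Lemma is_derive_det1 n (M : R -> 'M[R]_n) (N : 'M[R]_n) (t : R) :
  (forall i j, is_derive t 1 (fun s => M s i j) (N i j)) -> M t = 1%:M ->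
  is_derive t 1 (fun s => \det (M s)) (\tr N).
Proof.
move=> dM M1.
have dp (s : {perm 'I_n}) : is_derive t 1 (fun u => (-1) ^+ (s : bool) * \prod_i M u i (s i))
    ((-1) ^+ (s : bool) * \sum_k N k (s k) * \prod_(i | i != k) M t i (s i)).
  apply: (@is_derive_eq _ _ _ (cst ((-1) ^+ (s : bool)) * (fun u => \prod_i M u i (s i)))).
    by apply: is_deriveM; apply: is_derive_prod => //; exact: index_enum_uniq.
  by rewrite scaler0 addr0.
apply: is_derive_eq; first exact: is_derive_bigsum.
rewrite (bigD1 (1%g : {perm 'I_n}))//= odd_perm1 expr0 mul1r [X in _ + X]big1 ?addr0 => [|s s1].
  apply: eq_bigr => k _; rewrite perm1 big1 ?mulr1// => i _.
  by rewrite perm1 M1 mxE eqxx.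
(* A permutation fixing every index other than [k] fixes [k] too, by injectivity. *)
rewrite big1 ?mulr0// => k _; suff [i ik si] : exists2 i, i != k & s i != i.
  by rewrite (bigD1 i)//= M1 mxE eq_sym (negbTE si) mul0r mulr0.
apply/not_exists2P => h; move/eqP: s1; apply; apply/permP => i; rewrite perm1.
have fixs j : j != k -> s j = j by move=> jk; have [|/negP/negPn/eqP] := h j.
have [->|] := eqVneq i k; last exact: fixs.
have [//|/fixs] := eqVneq (s k) k; exact: perm_inj.
Qed.

End derive_det.

(** * Flows of Lipschitz systems *)

Section gronwall.
Context {R : realType}.

(** [S + E / c] times [expR (- c * x)] is nonincreasing and times [expR (c * x)] nondecreasing; the
    first settles later times, the second earlier ones. *)
Lemma gronwall_scalar (S dS : R -> R) (c E a b : R) : 0 < c ->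
  (forall x : R, a <= x <= b -> is_derive x 1 S (dS x)) ->
  (forall x, a <= x <= b -> `|dS x| <= c * S x + E) ->
  forall s t, a <= s <= b -> a <= t <= b -> S t + E / c <= (S s + E / c) * expR (c * `|t - s|).
Proof.
move=> c0 dS1 dS2.
have dW (k x : R) : a <= x <= b -> is_derive x 1 (fun x => (S x + E / c) * expR (k * x))
    ((dS x + k * (S x + E / c)) * expR (k * x)).
  move=> xab; have := dS1 x xab => dSx.
  have de : is_derive x 1 (fun x => expR (k * x)) (expR (k * x) * k).
    apply: (@is_derive1_comp _ expR (fun x => k * x)).
    rewrite (_ : (fun x => k * x) = (fun x => 0 + x * k)); first exact: is_derive_affine.
    by apply/funext => y; rewrite add0r mulrC.
  apply: (@is_derive_eq _ _ _ ((S + cst (E / c)) * (fun x => expR (k * x)))).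
  by rewrite /GRing.scale/= !fctE; ring.
have mono (k s t : R) : a <= s <= b -> a <= t <= b ->
    (forall x, a <= x <= b -> 0 <= (t - s) * (dS x + k * (S x + E / c))) ->
    (S s + E / c) * expR (k * s) <= (S t + E / c) * expR (k * t).
  move=> sab tab hk.
  have ab x : Num.min s t <= x <= Num.max s t -> a <= x <= b.
    rewrite ge_min le_max => /andP[/orP h1 /orP h2]; move: sab tab => /andP[? ?] /andP[? ?].
    by apply/andP; split; [case: h1|case: h2]; lra.
  have [x xst] := @MVT_between _ (fun x => (S x + E / c) * expR (k * x)) _ s t (fun x hx => dW k x (ab x hx)).
  move=> xE; rewrite -subr_ge0 xE mulrA mulr_ge0 ?expR_ge0//; exact/hk/ab.
move=> s t sab tab.
have Ec x : c * (S x + E / c) = c * S x + E by rewrite mulrDr mulrCA divff ?gt_eqF// mulr1.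
have [st|ts] := leP s t.
- have := @mono (- c) t s tab sab.
  have h x : a <= x <= b -> 0 <= (s - t) * (dS x + - c * (S x + E / c)).
    move=> /dS2; rewrite mulNr Ec ler_norml => /andP[? ?].
    by rewrite mulr_le0// ?subr_le0//; lra.
  move=> /(_ h) le1; rewrite ger0_norm ?subr_ge0// mulrBr expRB mulrA.
  rewrite ler_pdivlMr ?expR_gt0//.
  move: le1; rewrite !mulNr !expRN ler_pdivrMr ?expR_gt0// mulrAC ler_pdivlMr ?expR_gt0//.
- have := @mono c t s tab sab.
  have h x : a <= x <= b -> 0 <= (s - t) * (dS x + c * (S x + E / c)).
    move=> /dS2; rewrite Ec ler_norml => /andP[? ?].
    by rewrite mulr_ge0// ?subr_ge0 ?(ltW ts)//; lra.
  move=> /(_ h) le1; rewrite ltr0_norm ?subr_lt0// opprB mulrBr expRB mulrA.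
  by rewrite ler_pdivlMr ?expR_gt0.
Qed.

(** The estimate is run on the sum of squares, which is differentiable where the max norm is not,
    and the increment is recovered by the mean value theorem. [C] is chosen before [u] and [e], so
    increments of initial data may later tend to zero. *)
Lemma gronwall m (L D : R) : 0 <= L -> exists2 C : R, 0 <= C &
  forall (u du : R -> 'cV[R]_m) (e a b : R), 0 <= e -> b - a <= D ->
  (forall x : R, a <= x <= b -> is_derive x 1 u (du x)) ->
  (forall x, a <= x <= b -> `|du x| <= L * `|u x| + e) ->
  forall s t, a <= s <= b -> a <= t <= b -> `|u t - u s| <= C * `|t - s| * (`|u s| + e).
Proof.
(* [c] arises from [2 u u' <= u^2 + u'^2] and [u'^2 <= 2 L^2 |u|^2 + 2 e^2], summed over the [m]
   coordinates. The 1 added in [K] gives [K <= K^2], used when passing from squares back to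
   norms. *)
move=> L0; pose c := 1 + 2 * m%:R * L ^+ 2; pose K := 2 * m%:R * expR (c * D) + 1.
have c1 : 1 <= c by rewrite lerDl !mulr_ge0.
have c0 : 0 < c by exact: lt_le_trans c1.
have K1 : 1 <= K by rewrite lerDr !mulr_ge0// expR_ge0.
have K0 : 0 <= K by exact: le_trans K1.
exists (L * K + 1) => [|u du e a b e0 abD du1 du2 s t sab tab]; first by rewrite addr_ge0// mulr_ge0.
pose S x := \sum_i (u x i 0) ^+ 2.
have S_ge x : `|u x| ^+ 2 <= S x.
  have S0 : 0 <= S x by apply: sumr_ge0 => i _; rewrite sqr_ge0.
  rewrite -(sqr_sqrtr S0) lerXn2r ?nnegrE ?sqrtr_ge0//.
  apply: cV_norm_le => [|i]; first exact: sqrtr_ge0.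
  rewrite -sqrtr_sqr ler_sqrt// /S (bigD1 i)//= lerDl.
  by apply: sumr_ge0 => j _; rewrite sqr_ge0.
have dS1 (x : R) : a <= x <= b -> is_derive x 1 S (\sum_i 2 * u x i 0 * du x i 0).
  move=> /du1 dux; apply: is_derive_bigsum => i.
  have dui := is_derive_coord i 0 dux.
  rewrite (_ : (fun x => _) = (fun x => u x i 0) * (fun x => u x i 0)); last first.
    by apply/funext => y; rewrite expr2.
  by apply: is_derive_eq; rewrite /GRing.scale/=; ring.
have dS2 x : a <= x <= b -> `|\sum_i 2 * u x i 0 * du x i 0| <= c * S x + 2 * m%:R * e ^+ 2.
  move=> /du2 dux; rewrite (le_trans (ler_norm_sum _ _ _))//.
  have dui i : du x i 0 ^+ 2 <= 2 * L ^+ 2 * S x + 2 * e ^+ 2.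
    have h0 : `|du x i 0| <= L * `|u x| + e by apply: le_trans dux; exact: le_mx_norm.
    have h1 : du x i 0 ^+ 2 <= (L * `|u x| + e) ^+ 2.
      by rewrite -real_normK ?num_real// lerXn2r ?nnegrE// addr_ge0// mulr_ge0.
    have h2 : (L * `|u x| + e) ^+ 2 <= 2 * L ^+ 2 * `|u x| ^+ 2 + 2 * e ^+ 2.
      by rewrite -subr_ge0 (_ : _ - _ = (L * `|u x| - e) ^+ 2) ?sqr_ge0//; ring.
    have h3 : 2 * L ^+ 2 * `|u x| ^+ 2 <= 2 * L ^+ 2 * S x.
      by rewrite ler_wpM2l// mulr_ge0// sqr_ge0.
    lra.
  apply: (@le_trans _ _ (\sum_i ((u x i 0) ^+ 2 + (2 * L ^+ 2 * S x + 2 * e ^+ 2)))).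
    apply: ler_sum => i _; apply: le_trans (lerD (lexx _) (dui i)).
    have := sqr_ge0 (u x i 0 + du x i 0); have := sqr_ge0 (u x i 0 - du x i 0).
    by rewrite ler_norml !expr2 => ? ?; apply/andP; split; lra.
  rewrite big_split/= sumr_const card_ord -/(S x) -mulr_natl /c.
  by rewrite le_eqVlt; apply/orP; left; apply/eqP; ring.
have uK x : a <= x <= b -> `|u x| <= K * (`|u s| + e).
  move=> xab; rewrite -ler_sqr ?nnegrE ?mulr_ge0 ?addr_ge0//.
  apply: (le_trans (S_ge x)).
  have := gronwall_scalar c0 dS1 dS2 sab xab.
  set E := 2 * m%:R * e ^+ 2 => H.
  have E0 : 0 <= E by rewrite !mulr_ge0// sqr_ge0.
  have Ec0 : 0 <= E / c by rewrite divr_ge0// ltW.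
  have EcE : E / c <= E by rewrite ler_pdivrMr// ler_peMr.
  have Ss : S s <= 2 * m%:R * `|u s| ^+ 2.
    apply: (@le_trans _ _ (\sum_(i < m) `|u s| ^+ 2)).
      apply: ler_sum => i _; rewrite -real_normK ?num_real// lerXn2r ?nnegrE//.
      exact: le_mx_norm.
    rewrite sumr_const card_ord -mulr_natl -mulrA.
    have : 0 <= m%:R * `|u s| ^+ 2 :> R by rewrite mulr_ge0// sqr_ge0.
    by lra.
  have eD : expR (c * `|x - s|) <= expR (c * D).
    rewrite ler_expR ler_wpM2l ?(ltW c0)//; apply: le_trans abD.
    by rewrite ler_norml; move: sab xab => /andP[? ?] /andP[? ?]; apply/andP; split; lra.
  apply: (@le_trans _ _ ((2 * m%:R * (`|u s| + e) ^+ 2) * expR (c * D))).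
    apply: (@le_trans _ _ ((S s + E / c) * expR (c * `|x - s|))); first by lra.
    have ES0 : 0 <= S s + E / c by rewrite addr_ge0//; apply: sumr_ge0 => i _; exact: sqr_ge0.
    apply: (ler_pM ES0 (expR_ge0 _)) => //.
    apply: le_trans (lerD Ss EcE) _; rewrite /E -mulrDr ler_wpM2l ?mulr_ge0//.
    rewrite sqrrD -addrA lerD2l lerDr -mulr_natl !mulr_ge0//.
  rewrite exprMn mulrAC ler_wpM2r ?sqr_ge0//.
  apply: (@le_trans _ _ K); first by rewrite lerDl.
  by rewrite expr2 ler_peMr.
have C0 : 0 <= `|u s| + e by rewrite addr_ge0.
apply: cV_norm_le => [|i]; first by rewrite !mulr_ge0// addr_ge0// mulr_ge0.
have ab x : Num.min s t <= x <= Num.max s t -> a <= x <= b.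
  rewrite ge_min le_max => /andP[/orP h1 /orP h2]; move: sab tab => /andP[? ?] /andP[? ?].
  by apply/andP; split; [case: h1|case: h2]; lra.
have [x /ab xab] := @MVT_between _ (fun x => u x i 0) (fun x => du x i 0) s t
  (fun x hx => is_derive_coord i 0 (du1 x (ab x hx))).
rewrite !mxE => ->; rewrite normrM mulrAC mulrC ler_wpM2r//.
rewrite (le_trans (le_mx_norm _ _ _))// (le_trans (du2 _ xab))// mulrDl mul1r lerD ?lerDr//.
by rewrite -mulrA ler_wpM2l// uK.
Qed.

Lemma gronwall1 (L D : R) : 0 <= L -> exists2 C : R, 0 <= C &
  forall (u du : R -> R) (e a b : R), 0 <= e -> b - a <= D ->
  (forall x : R, a <= x <= b -> is_derive x 1 u (du x)) ->
  (forall x, a <= x <= b -> `|du x| <= L * `|u x| + e) ->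
  forall s t, a <= s <= b -> a <= t <= b -> `|u t - u s| <= C * `|t - s| * (`|u s| + e).
Proof.
move=> L0; have [C C0 hC] := gronwall 1 D L0; exists C => // u du e a b e0 abD du1 du2 s t sab tab.
have nc (x : R) : `|const_mx x : 'cV[R]_1| = `|x|.
  apply/eqP; rewrite eq_le; apply/andP; split.
    by apply: cV_norm_le => // i; rewrite mxE.
  by have := le_mx_norm (const_mx x : 'cV[R]_1) 0 0; rewrite mxE.
have := hC (fun x => const_mx (u x)) (fun x => const_mx (du x)) e a b e0 abD _ _ s t sab tab.
rewrite -raddfB !nc; apply => x /[dup] xab; last by move=> /du2; rewrite !nc.
move=> /du1 dux; apply: coord_is_derive => i j; rewrite mxE.
by under eq_fun do rewrite mxE.
Qed.

End gronwall.

(** * Equivalence of an arbitrary norm with the max norm *)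

Section norm_equivalence.
Context {R : realType} {n : nat} (N : 'cV[R]_n.+1 -> R) (NP : is_norm N).

Lemma is_norm0 : N 0 = 0.
Proof. by have [_ NZ _] := NP; rewrite -(scale0r 0) NZ normr0 mul0r. Qed.

Lemma is_normN x : N (- x) = N x.
Proof. by have [_ NZ _] := NP; rewrite -scaleN1r NZ normrN1 mul1r. Qed.

Lemma is_norm_ge0 x : 0 <= N x.
Proof.
have [ND _ _] := NP; have := ND x (- x); rewrite subrr is_norm0 is_normN => ?.
lra.
Qed.

Lemma is_norm_le_mx_norm : exists2 c : R, 0 < c & forall x, N x <= c * `|x|.
Proof.
have [ND NZ _] := NP; exists (\sum_i N (basis_vec i) + 1) => [|x].
  by rewrite ltr_pwDr// sumr_ge0// => i _; exact: is_norm_ge0.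
rewrite (@le_trans _ _ ((\sum_i N (basis_vec i)) * `|x|))//; last first.
  by rewrite ler_wpM2r// lerDl.
rewrite {1}(cV_sum_basis x) mulr_suml.
elim/big_rec2: _ => [|i y1 y2 _ h]; first by rewrite is_norm0.
rewrite (le_trans (ND _ _))// lerD// NZ mulrC ler_wpM2l ?is_norm_ge0//.
exact: le_mx_norm.
Qed.

(** [N] is continuous, so it has a minimum on the compact max norm sphere, positive because [N]
    vanishes only at 0; the sphere is nonempty as the dimension is positive. Transposition brings
    the argument to row vectors, where [EVT_min_rV] applies. *)
Lemma mx_norm_le_is_norm : exists2 c : R, 0 < c & forall x, `|x| <= c * N x.
Proof.
have [ND NZ N0] := NP; have [c c0 Nc] := is_norm_le_mx_norm.
have trN (p q : nat) (y : 'M[R]_(p, q)) : `|y^T| = `|y|.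
  apply/eqP; rewrite eq_le; apply/andP; split; apply: mx_norm_le => // i j.
    by rewrite mxE le_mx_norm.
  by have := le_mx_norm y^T j i; rewrite mxE.
pose A := [set y : 'rV[R]_n.+1 | `|y| = 1].
have An0 : A !=set0.
  exists (const_mx 1); rewrite /A/=; apply/eqP; rewrite eq_le; apply/andP; split.
    by apply: mx_norm_le => // i j; rewrite mxE normr1.
  by have := le_mx_norm (const_mx 1 : 'rV[R]_n.+1) 0 0; rewrite mxE normr1.
have cA : compact A.
  apply: bounded_closed_compact.
    by exists 1; split=> // r r1 y /= ->; exact: ltW.
  rewrite (_ : A = (fun y => `|y|) @^-1` [set 1]); last by [].
  by apply: preimage_closed; [move=> y _; exact: norm_continuous|exact: closed_eq].
have cf : continuous (fun y : 'rV[R]_n.+1 => N y^T).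
  move=> y; apply/(@cvgrPdist_le _ _ _ (nbhs y) (nbhs_filter y)) => e e0.
  near=> z; have Nyz : `|N y^T - N z^T| <= c * `|y - z|.
    have h u v : N u - N v <= N (u - v) by rewrite lerBlDr; have := ND (u - v) v; rewrite subrK.
    rewrite -(trN _ _ (y - z)) raddfB/= ler_norml.
    have := h y^T z^T; have := h z^T y^T; rewrite -[z^T - y^T]opprB is_normN.
    by have := Nc (y^T - z^T); lra.
  rewrite (le_trans Nyz)// -ler_pdivlMl//; near: z; apply: cvgr_dist_le; first exact: cvg_id.
  by rewrite mulr_gt0// invr_gt0.
have [y Ay ymin] := EVT_min_rV An0 cA (continuous_subspaceT cf).
have Ny0 : 0 < N y^T.
  rewrite lt0r is_norm_ge0 andbT; apply/eqP => /N0 yT0.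
  by move: Ay; rewrite inE /A/= -trN yT0 normr0 => /esym/eqP; rewrite oner_eq0.
exists (N y^T)^-1 => [|x]; first by rewrite invr_gt0.
have [->|x0] := eqVneq x 0; first by rewrite normr0 is_norm0 mulr0.
have nx0 : 0 < `|x| by rewrite normr_gt0.
rewrite ler_pdivlMl//.
have : N y^T <= N (`|x|^-1 *: x^T)^T.
  by apply: ymin; rewrite inE /A/= normrZ trN normfV normr_id mulVf// gt_eqF.
by rewrite linearZ/= trmxK NZ normfV normr_id mulrC ler_pdivlMr.
Unshelve. all: by end_near. Qed.

End norm_equivalence.

Lemma continuous_eps (R : realType) (U W : normedModType R) (F : U -> W) x (e : R) :
  {for x, continuous F} -> 0 < e ->
  exists2 r : R, 0 < r & forall y, `|y - x| < r -> `|F y - F x| <= e.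
Proof.
move=> /(@cvgrPdist_le _ _ _ (nbhs x) (nbhs_filter x))/[apply]/nbhs_ballP[r /= r0 hr].
exists r => // y yx; rewrite distrC; apply: hr.
by rewrite -ball_normE/= distrC.
Qed.

Lemma eps_continuous (R : realType) (U W : normedModType R) (F : U -> W) x :
  (forall e : R, 0 < e -> exists2 r : R, 0 < r & forall y, `|y - x| < r -> `|F y - F x| <= e) ->
  {for x, continuous F}.
Proof.
move=> h; apply/(@cvgrPdist_le _ _ _ (nbhs x) (nbhs_filter x)) => e /h[r r0 hr].
apply/nbhs_ballP; exists r => // y; rewrite -ball_normE/= distrC => /hr.
by rewrite distrC.
Qed.

Lemma common_radius (R : realType) (r1 r2 : R) : 0 < r1 -> 0 < r2 ->
  exists2 r : R, 0 < r & forall x : R, x < r -> x < r1 /\ x < r2.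
Proof.
move=> r10 r20; exists (Num.min r1 r2); first by rewrite lt_min r10.
by move=> x; rewrite lt_min => /andP[].
Qed.

Section flow.
Context {R : realType} {n : nat}.
Notation V := 'cV[R]_n.+1.
Variables (g : R -> V -> V) (L : R).
Hypotheses (L0 : 0 <= L) (gL : forall t x y, `|g t x - g t y| <= L * `|x - y|).

Lemma solution_unique (z w : R -> V) (a b s : R) :
  (forall t : R, a <= t <= b -> is_derive t 1 z (g t (z t))) ->
  (forall t : R, a <= t <= b -> is_derive t 1 w (g t (w t))) ->
  a <= s <= b -> z s = w s -> forall t, a <= t <= b -> z t = w t.
Proof.
move=> dz dw sab zw t tab; have [C _ hC] := gronwall n.+1 (b - a) L0.
have := hC (z - w) (fun t => g t (z t) - g t (w t)) 0 a b (lexx _) (lexx _) _ _ s t sab tab.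
rewrite !fctE zw subrr normr0 addr0 mulr0 subr0 => h.
apply/eqP; rewrite -subr_eq0 -normr_le0; apply: h => u uab.
- by have := dz u uab; have := dw u uab => ? ?; exact: is_deriveB.
- by rewrite addr0; exact: gL.
Qed.

Variable phi : R -> R -> V -> V.
Hypothesis phiP : general_solution g phi.

Let dphi (s : R) x (t : R) : is_derive t 1 (fun t => phi t s x) (g t (phi t s x)).
Proof. by have [h _] := phiP s x; exact: h. Qed.

Lemma flow_init s x : phi s s x = x. Proof. by have [] := phiP s x. Qed.

Lemma flow_unique z s : solution_on setT g z -> forall t, z t = phi t s (z s).
Proof.
move=> dz t; apply: (@solution_unique z (fun t => phi t s (z s)) (Num.min s t) (Num.max s t) s).
- by move=> u _; exact: dz.
- by move=> u _; exact: dphi.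
- by rewrite ge_min le_max !lexx.
- by rewrite flow_init.
- by rewrite ge_min le_max !lexx !orbT.
Qed.

Lemma flow_comp t r s x : phi t r (phi r s x) = phi t s x.
Proof. by rewrite -(@flow_unique (fun t => phi t s x) r)// => u _; exact: dphi. Qed.

(** Gronwall on the difference of two solutions. Bounding [phi t s] minus the identity keeps the
    factor [|t - s|], from which derivatives at coinciding times are read off. *)
Lemma flow_dist : exists2 C : R, 0 <= C & forall s t x y, `|t - s| <= 1 ->
  `|phi t s x - phi t s y - (x - y)| <= C * `|t - s| * `|x - y|.
Proof.
have [C C0 hC] := gronwall n.+1 1 L0; exists C => // s t x y ts.
have := hC (fun t => phi t s x - phi t s y) (fun t => g t (phi t s x) - g t (phi t s y)) 0
  (Num.min s t) (Num.max s t) (lexx _) _ _ _ s t.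
rewrite !flow_init addr0; apply.
- by apply: le_trans ts; have [st|st] := leP s t; rewrite ?ler_norm// distrC ler_norm.
- by move=> u _; have := dphi s x u; have := dphi s y u => ? ?; exact: is_deriveB.
- by move=> u _; rewrite addr0; exact: gL.
- by rewrite ge_min le_max !lexx.
- by rewrite ge_min le_max !lexx !orbT.
Qed.

Hypothesis g0 : forall t, g t 0 = 0.

Lemma flow0 t s : phi t s 0 = 0.
Proof.
apply/esym; apply: (@flow_unique (cst 0)) => u _.
by rewrite g0; exact: is_derive_cst.
Qed.

(** Comparison with the zero solution bounds the displacement [phi t s x - x] by
    [C * |t - s| * |x|]. *)
Lemma flow_near t0 x0 (e : R) : 0 < e -> exists2 r : R, 0 < r & forall s t x,
  `|s - t0| < r -> `|t - t0| < r -> `|x - x0| < r -> `|phi t s x - x0| < e.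
Proof.
move=> e0; have [C C0 hC] := flow_dist.
pose K := 2 * C * (`|x0| + 1) + 1; have K0 : 0 < K by rewrite ltr_pwDr// !mulr_ge0// addr_ge0.
have eK : 0 < Num.min 1 (e / K) / 2 by rewrite divr_gt0// lt_min ltr01 divr_gt0.
exists (Num.min 1 (e / K) / 2) => // s t x.
set r := _ / 2 => sr tr xr.
have r2 : r * 2 = Num.min 1 (e / K) by rewrite divfK.
have r1 : r * 2 <= 1 by rewrite r2 ge_min lexx.
have reK : r * 2 * K <= e by rewrite r2 -ler_pdivlMr// ge_min lexx orbT.
have tsr : `|t - s| <= r * 2.
  have -> : t - s = (t - t0) - (s - t0) by ring.
  by rewrite (le_trans (ler_normB _ _))//; lra.
have := hC s t x 0 (le_trans tsr r1); rewrite flow0 !subr0 => h.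
have -> : phi t s x - x0 = (phi t s x - x) + (x - x0) by rewrite addrA subrK.
rewrite (le_lt_trans (ler_normD _ _))//.
have nx : `|x| <= `|x0| + 1.
  by rewrite -(subrK x0 x) (le_trans (ler_normD _ _))// addrC lerD2l; lra.
have : C * `|t - s| * `|x| <= C * (r * 2) * (`|x0| + 1).
  by rewrite ler_pM ?mulr_ge0// ler_wpM2l.
move: reK h xr; rewrite /K; lra.
Qed.

Variables (Dg : R -> V -> 'M[R]_n.+1).
Hypothesis cg : forall t x, {for (t, x), continuous (fun p : R * V => g p.1 p.2)}.
Hypothesis sdg : forall t x (e : R), 0 < e -> exists2 r : R, 0 < r & forall s (a b : V),
  `|s - t| < r -> `|a - x| < r -> `|b - x| < r ->
  `|g s b - g s a - Dg t x *m (b - a)| <= e * `|b - a|.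

(** The differential equation governs the final time, whereas here the initial time varies. In each
    coordinate the mean value theorem along the solution from [(s, x)] gives
    [phi t s x - x = (t - s) g u (phi u s x)], and joint continuity of [g] concludes. *)
Lemma flow_derive_init (t : R) x : is_derive t 1 (fun s => phi t s x) (- g t x).
Proof.
apply: coord_is_derive => i j; rewrite !ord1 mxE {j}; apply: eps_is_derive1 => e e0.
have [r1 r10 h1] := continuous_eps (cg (t := t) (x := x)) e0.
have [r2 r20 h2] := flow_near t x r10.
have [r r0 hr] := common_radius r10 r20; exists r => // s /hr[s1 s2].
have [u hu] := @MVT_between _ (fun u => phi u s x i 0) (fun u => g u (phi u s x) i 0) s t
  (fun u _ => is_derive_coord i 0 (dphi s x u)).
rewrite !flow_init => E; have [u1 u2] := between_dist hu.
have -> : phi t s x i 0 - x i 0 - (s - t) * - g t x i 0 =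
    (t - s) * (g u (phi u s x) i 0 - g t x i 0) by rewrite E; ring.
rewrite normrM [`|s - t|]distrC [leLHS]mulrC ler_wpM2r//.
have := le_mx_norm (g u (phi u s x) - g t x) i 0; rewrite !mxE => /le_trans; apply.
have ut : `|u - t| <= `|s - t| by rewrite (le_trans u2)// distrC.
apply: (h1 (u, phi u s x)); rewrite prod_normE gt_max/= (le_lt_trans ut)//=.
by apply: h2; rewrite ?subrr ?normr0// (le_lt_trans ut).
Qed.

Hypothesis diff_phi : forall t s x, differentiable (phi t s) x.
Notation M t s x := (jacobian_mx (phi t s) x).

Lemma jacobian_flow_init s x : M s s x = 1%:M.
Proof.
rewrite -(jacobian_id x); congr (jacobian_mx _ x); apply/funext => y.
exact: flow_init.
Qed.

Lemma jacobian_flow_comp t r s x : M t s x = M t r (phi r s x) *m M r s x.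
Proof.
rewrite -jacobian_comp//; congr (jacobian_mx _ x); apply/funext => y /=.
by rewrite flow_comp.
Qed.

Lemma jacobian_flow_dist : exists2 C : R, 0 <= C & forall s t x (v : V), `|t - s| <= 1 ->
  `|M t s x *m v - v| <= C * `|t - s| * `|v|.
Proof.
have [C C0 hC] := flow_dist; exists C => // s t x v ts.
rewrite -derive_jacobian//; apply: derive_dist_le; first exact: diff_derivable.
near=> h; have h0 : h != 0 by near: h; exact: nbhs_dnbhs_neq.
have -> : h^-1 *: (phi t s (h *: v + x) - phi t s x) - v =
    h^-1 *: (phi t s (h *: v + x) - phi t s x - (h *: v + x - x)).
  by rewrite addrK [in RHS]scalerBr scalerA mulVf// scale1r.
rewrite normrZ normfV ler_pdivrMl ?normr_gt0//.
by rewrite (le_trans (hC _ _ _ _ ts))// addrK normrZ mulrCA.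
Unshelve. all: by end_near. Qed.

(** The expansion is uniform in both times, so it gives the derivative in the final time ([s = t])
    and in the initial time ([u = t]). The mean value theorem in time is applied to finite
    increments, before [h] tends to 0, so no time regularity of the Jacobian is presupposed. *)
Lemma jacobian_flow_eps t x (e : R) : 0 < e -> exists2 r : R, 0 < r & forall u s,
  `|u - t| < r -> `|s - t| < r -> forall i j,
  `|M u s x i j - (i == j)%:R - (u - s) * Dg t x i j| <= e * `|u - s|.
Proof.
move=> e0; have [C C0 hC] := flow_dist.
pose B := n.+1%:R * `|Dg t x|; have B0 : 0 <= B by rewrite mulr_ge0.
pose e1 := e / (2 * (C + 1)).
have e10 : 0 < e1 by rewrite divr_gt0// mulr_gt0// ltr_pwDr.
have [r1 r10 h1] := sdg t x e10.
have [r2 r20 h2] := flow_near t x r10.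
have eB : 0 < e / (4 * (B * C + 1)) by rewrite divr_gt0// mulr_gt0// ltr_pwDr// mulr_ge0.
(* The thirds allow for the intermediate time [w], within [|u - t| + 2 |s - t|] of [t]; 1/2 ensures
   [|u - s| <= 1] for [flow_dist]; the last bound controls the distortion of the increment by the
   flow. *)
pose r := Num.min (Num.min (Num.min (r1 / 3) (r2 / 3)) (1 / 2)) (e / (4 * (B * C + 1))).
have r0 : 0 < r by rewrite /r !lt_min eB andbT !divr_gt0.
exists r => // u s; rewrite /r !lt_min => /andP[/andP[/andP[u1 u2] u3] ue] /andP[/andP[/andP[s1 s2] s3] se] i j.
have us1 : `|u - s| <= 1.
  have -> : u - s = (u - t) - (s - t) by ring.
  by rewrite (le_trans (ler_normB _ _))//; lra.
have use : `|u - s| <= e / (2 * (B * C + 1)).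
  have -> : u - s = (u - t) - (s - t) by ring.
  rewrite (le_trans (ler_normB _ _))//.
  have -> : e / (2 * (B * C + 1)) = e / (4 * (B * C + 1)) + e / (4 * (B * C + 1)).
    by field; rewrite gt_eqF// ltr_pwDr// mulr_ge0.
  by rewrite ltW// ltrD.
rewrite -addrA -opprD jacobian_mxE//.
rewrite -derive_coord; last exact: diff_derivable.
apply: derive_dist_le; first by apply: diff_derivable; exact: differentiable_coord_of.
near=> h; have h0 : h != 0 by near: h; exact: nbhs_dnbhs_neq.
set v := basis_vec j; pose y := h *: v + x.
have nv : `|v| = 1.
  apply/eqP; rewrite eq_le; apply/andP; split.
    by apply: cV_norm_le => // k; rewrite mxE; case: (_ && _); rewrite ?normr1 ?normr0.
  by have := le_mx_norm v j 0; rewrite mxE !eqxx normr1.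
have yx : `|y - x| = `|h| by rewrite /y addrK normrZ nv mulr1.
have yx2 : `|y - x| < r2 by rewrite yx; near: h; exact: dnbhs0_lt.
pose q w := phi w s y - phi w s x.
have dq (w : R) : is_derive w 1 q (g w (phi w s y) - g w (phi w s x)).
  by have := dphi s y w; have := dphi s x w => ? ?; exact: is_deriveB.
have [w hw] := @MVT_between _ (fun w => q w i 0) (fun w => (g w (phi w s y) - g w (phi w s x)) i 0) s u
  (fun w _ => is_derive_coord i 0 (dq w)).
have [ws wu] := between_dist hw.
rewrite {1}/q {1}/q !flow_init => E.
have -> : h^-1 *: (phi u s y i 0 - phi u s x i 0) - ((i == j)%:R + (u - s) * Dg t x i j) =
    (u - s) * (h^-1 * ((g w (phi w s y) - g w (phi w s x)) i 0) - Dg t x i j).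
  have E' : phi u s y i 0 - phi u s x i 0 = h * (i == j)%:R +
      (u - s) * (g w (phi w s y) - g w (phi w s x)) i 0.
    rewrite -E; rewrite ![(_ - _ : 'cV[R]_n.+1) i 0]mxE; rewrite /y !mxE andbT; ring.
  by rewrite E' /GRing.scale/=; field.
rewrite normrM mulrC ler_wpM2r//.
have wt : `|w - t| <= `|u - t| + 2 * `|s - t|.
  have -> : w - t = (w - s) + (s - t) by ring.
  rewrite (le_trans (ler_normD _ _))//.
  have : `|u - s| <= `|u - t| + `|s - t|.
    have -> : u - s = (u - t) - (s - t) by ring.
    by rewrite ler_normB.
  lra.
set a := phi w s x; set b := phi w s y.
have ax : `|a - x| < r1 by apply: h2; rewrite ?subrr ?normr0//; lra.
have bx : `|b - x| < r1 by apply: h2 => //; lra.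
have ws1 : `|w - s| <= 1 by exact: le_trans us1.
have ba : `|b - a - h *: v| <= C * `|u - s| * `|h|.
  have := hC s w y x ws1; rewrite yx (_ : y - x = h *: v) ?addrK// => /le_trans; apply.
  by rewrite ler_wpM2r// ler_wpM2l.
have ba1 : `|b - a| <= (C + 1) * `|h|.
  rewrite -(subrK (h *: v) (b - a)) (le_trans (ler_normD _ _))// mulrDl mul1r lerD//.
    by rewrite (le_trans ba)// ler_wpM2r// ler_piMr.
  by rewrite normrZ nv mulr1.
have DgE : Dg t x i j = h^-1 * (Dg t x *m (h *: v)) i 0.
  rewrite -scalemxAr mxE mulrA mulVf// mul1r mxE (bigD1 j)//= !mxE !eqxx mulr1 big1 ?addr0//.
  by move=> k kj; rewrite mxE (negbTE kj) mulr0.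
rewrite DgE -mulrBr normrM normfV ler_pdivrMl ?normr_gt0//.
(* Two errors, each at most half of the tolerance: linearizing [g], and replacing the transported
   increment [b - a] by [h *: v]. *)
have -> : (g w b - g w a) i 0 - (Dg t x *m (h *: v)) i 0 =
    ((g w b - g w a - Dg t x *m (b - a)) + Dg t x *m (b - a - h *: v)) i 0.
  by rewrite [Dg t x *m (b - a - _)]mulmxBr addrA subrK [RHS]mxE [X in _ = _ + X]mxE.
rewrite (le_trans (le_mx_norm _ _ _))// (le_trans (ler_normD _ _))//.
have p1 : `|g w b - g w a - Dg t x *m (b - a)| <= e / 2 * `|h|.
  rewrite (le_trans (h1 _ _ _ _ ax bx))//; first lra.
  rewrite (le_trans (ler_wpM2l (ltW e10) ba1))//.
  by rewrite /e1 le_eqVlt; apply/orP; left; apply/eqP; field; rewrite gt_eqF// ltr_pwDr.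
have p2 : `|Dg t x *m (b - a - h *: v)| <= e / 2 * `|h|.
  rewrite (le_trans (norm_mulmx_le _ _))// -/B (le_trans (ler_wpM2l B0 ba))//.
  rewrite !mulrA ler_wpM2r// (le_trans (ler_wpM2l _ use)) ?mulr_ge0//.
  rewrite mulrCA ler_pM2l// ler_pdivrMr ?mulr_gt0 ?ltr_pwDr ?mulr_ge0//.
  have : 0 <= B * C by rewrite mulr_ge0.
  by lra.
by rewrite mulrC (splitr e) mulrDl lerD.
Unshelve. all: by end_near. Qed.

End flow.

(** * Liouville's formula for the Jacobian determinant of the flow *)

Section liouville.
Context {R : realType} {n : nat}.
Notation V := 'cV[R]_n.+1.
Variables (g : R -> V -> V) (L : R).
Hypotheses (L0 : 0 <= L) (gL : forall t x y, `|g t x - g t y| <= L * `|x - y|).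
Variable phi : R -> R -> V -> V.
Hypothesis phiP : general_solution g phi.
Hypothesis g0 : forall t, g t 0 = 0.
Variables (Dg : R -> V -> 'M[R]_n.+1).
Hypothesis sdg : forall t x (e : R), 0 < e -> exists2 r : R, 0 < r & forall s (a b : V),
  `|s - t| < r -> `|a - x| < r -> `|b - x| < r ->
  `|g s b - g s a - Dg t x *m (b - a)| <= e * `|b - a|.
Hypothesis diff_phi : forall t s x, differentiable (phi t s) x.
Notation M t s x := (jacobian_mx (phi t s) x).
Notation delta t s x := (\det (M t s x)).
Notation divg t x := (\tr (Dg t x)).

Let M_eps := jacobian_flow_eps L0 gL phiP g0 sdg diff_phi.
Let M1 := jacobian_flow_init phiP.

Let I1 i j : (1%:M : 'M[R]_n.+1) i j = (i == j)%:R. Proof. by rewrite mxE. Qed.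

Let dMl (t : R) x i j : is_derive t 1 (fun u => M u t x i j) (Dg t x i j).
Proof.
apply: eps_is_derive1 => e e0; have [r r0 hr] := M_eps t x e0.
exists r => // u ut; have := hr u t ut; rewrite subrr normr0 => /(_ r0 i j).
by rewrite M1 I1.
Qed.

Let dMr (t : R) x i j : is_derive t 1 (fun s => M t s x i j) (- Dg t x i j).
Proof.
apply: eps_is_derive1 => e e0; have [r r0 hr] := M_eps t x e0.
exists r => // s st; have := hr t s; rewrite subrr normr0 => /(_ r0 st i j).
by rewrite M1 I1 mulrN -mulNr opprB [`|t - s|]distrC.
Qed.

(** Restarting the flow at time [t] factors the determinant, so only a derivative at the identity
    has to be computed. *)
Lemma is_derive_det_flow (t s : R) x :
  is_derive t 1 (fun t => delta t s x) (divg t (phi t s x) * delta t s x).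
Proof.
have dd := is_derive_det1 (dMl t (phi t s x)) (M1 t (phi t s x)).
rewrite (_ : (fun t => _) = (fun u => delta u t (phi t s x)) * cst (delta t s x)); last first.
  apply/funext => u; rewrite -[RHS]/(delta u t (phi t s x) * delta t s x).
  by rewrite -det_mulmx -(jacobian_flow_comp L0 gL phiP diff_phi).
by apply: is_derive_eq; rewrite scaler0 add0r /GRing.scale/= mulrC.
Qed.

Lemma is_derive_det_flow_init (t : R) x :
  is_derive t 1 (fun s => delta t s x) (- divg t x).
Proof.
rewrite -raddfN/=; apply: is_derive_det1; last exact: M1.
by move=> i j; rewrite [X in is_derive _ _ _ X]mxE; exact: dMr.
Qed.

Hypothesis divgL : forall t x, exists K r : R, [/\ 0 <= K, 0 < r & forall s (y z : V),
  `|s - t| < r -> `|y - x| < r -> `|z - x| < r ->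
  `|divg s y| <= K /\ `|divg s y - divg s z| <= K * `|y - z|].
Hypothesis diff_delta : forall t s x, differentiable (fun y => delta t s y) x.

(* Liouville's formula: delta t s y solves u' = divg (phi t s y) u, so both bounds
   are Gronwall estimates on a scalar equation. *)
Lemma det_flow_bounds t x : exists C r : R, [/\ 0 <= C, 0 < r & forall s (y : V),
  `|s - t| < r -> `|y - x| < r -> `|delta t s y - 1| <= C * `|t - s| /\
  forall v, `|'D_v (fun y => delta t s y) y| <= C * `|t - s| * `|v|].
Proof.
have [K [ra [K0 ra0 hK]]] := divgL t x.
have [C0 C00 hC0] := flow_dist L0 gL phiP.
have [C1 C10 hC1] := gronwall1 1 K0.
have [r1 r10 hr1] := flow_near L0 gL phiP g0 t x ra0.
(* Product of the Lipschitz constant of the divergence, the expansion of the flow and a bound on the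
   determinant: it bounds the inhomogeneous term in the equation for the difference of two
   determinants. *)
pose B := K * (C0 + 1) * (C1 + 1).
have B0 : 0 <= B by rewrite !mulr_ge0// addr_ge0.
exists (C1 + C1 * B), (Num.min (Num.min r1 ra) 1); split.
- by rewrite addr_ge0// mulr_ge0.
- by rewrite !lt_min r10 ra0 ltr01.
move=> s y; rewrite !lt_min => /andP[/andP[sr1 sra] s1] /andP[/andP[yr1 _] _].
have t1 : `|t - s| <= 1 by rewrite distrC ltW.
pose a := Num.min s t; pose b := Num.max s t.
have ab : b - a <= 1.
  by apply: le_trans t1; rewrite /a /b; have [st|st] := leP s t; rewrite ?ler_norm// distrC ler_norm.
have sab : a <= s <= b by rewrite /a /b ge_min le_max !lexx.
have tab : a <= t <= b by rewrite /a /b ge_min le_max !lexx !orbT.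
have near_u u z : a <= u <= b -> `|z - x| < r1 -> `|u - t| < ra /\ `|phi u s z - x| < ra.
  move=> /between_dist[_ ut] zx; have ust : `|u - t| <= `|s - t| by rewrite [leRHS]distrC.
  by split; [exact: le_lt_trans sra|apply: hr1 => //; exact: le_lt_trans sr1].
have delta1 u z : a <= u <= b -> `|z - x| < r1 -> `|delta u s z - 1| <= C1 * `|u - s|.
  move=> uab zx; have := hC1 (fun u => delta u s z) (fun u => divg u (phi u s z) * delta u s z)
    0 a b (lexx _) ab _ _ s u sab uab; rewrite M1 det1 normr1 addr0 mulr1; apply.
    by move=> w _; exact: is_derive_det_flow.
  move=> w wab; have [w1 w2] := near_u w z wab zx.
  by rewrite addr0 normrM ler_wpM2r//; have [] := hK w _ _ w1 w2 w2.
split.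
  rewrite (le_trans (delta1 t y tab yr1))// ler_wpM2r// lerDl mulr_ge0//.
move=> v; have [->|v0] := eqVneq v 0; first by rewrite derive0 !normr0 mulr0.
rewrite -[X in `|X|]subr0; apply: derive_dist_le; first exact: diff_derivable.
near=> h; have h0 : h != 0 by near: h; exact: nbhs_dnbhs_neq.
pose z := h *: v + y.
have zr1 : `|z - x| < r1.
  rewrite /z -addrA (le_lt_trans (ler_normD _ _))// -ltrBrDr.
  rewrite normrZ -ltr_pdivlMr ?normr_gt0//; near: h; apply: dnbhs0_lt.
  by rewrite divr_gt0 ?normr_gt0 ?subr_gt0.
pose e := B * (`|h| * `|v|).
have e0 : 0 <= e by rewrite mulr_ge0// mulr_ge0.
(* Both determinants equal 1 at time [s], so their difference starts from 0 and Gronwall leaves only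
   the inhomogeneity [e], which is linear in the increment. *)
have := hC1 (fun u => delta u s z - delta u s y)
  (fun u => divg u (phi u s z) * delta u s z - divg u (phi u s y) * delta u s y) e a b e0 ab _ _ s t sab tab.
rewrite !M1 !subrr normr0 add0r subr0 => H.
rewrite subr0 normrZ normfV ler_pdivrMl ?normr_gt0//.
apply: (le_trans (H _ _)).
- by move=> u _; have := is_derive_det_flow u s z; have := is_derive_det_flow u s y => ? ?; exact: is_deriveB.
- move=> u uab.
  have [u1 u2] := near_u u y uab yr1; have [_ u3] := near_u u z uab zr1.
  have [d1 d2] := hK u _ _ u1 u3 u2.
  have -> : divg u (phi u s z) * delta u s z - divg u (phi u s y) * delta u s y =
     divg u (phi u s z) * (delta u s z - delta u s y) +
     (divg u (phi u s z) - divg u (phi u s y)) * delta u s y by ring.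
  rewrite (le_trans (ler_normD _ _))// !normrM lerD//; first by rewrite ler_wpM2r.
  have us1 : `|u - s| <= 1 by have [us _] := between_dist uab; exact: le_trans t1.
  have dy : `|delta u s y| <= C1 + 1.
    rewrite -(subrK 1 (delta u s y)) (le_trans (ler_normD _ _))// normr1 lerD2r.
    by rewrite (le_trans (delta1 u y uab yr1))// ler_piMr.
  have zy : z - y = h *: v by rewrite /z addrK.
  have pd : `|phi u s z - phi u s y| <= (C0 + 1) * (`|h| * `|v|).
    rewrite -(subrK (z - y) (phi u s z - phi u s y)) (le_trans (ler_normD _ _))//.
    rewrite mulrDl mul1r lerD ?(le_trans (hC0 s u z y us1))// zy normrZ//.
    by rewrite ler_wpM2r ?mulr_ge0// ler_piMr.
  apply: (@le_trans _ _ (K * ((C0 + 1) * (`|h| * `|v|)) * (C1 + 1))).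
    rewrite ler_pM//; apply: (le_trans d2); rewrite ler_wpM2l//.
  by rewrite /e /B le_eqVlt; apply/orP; left; apply/eqP; ring.
- rewrite /e -subr_ge0.
  have -> : `|h| * ((C1 + C1 * B) * `|t - s| * `|v|) - C1 * `|t - s| * (B * (`|h| * `|v|)) =
    C1 * (`|t - s| * (`|h| * `|v|)) by ring.
  by rewrite !mulr_ge0.
Unshelve. all: by end_near. Qed.

End liouville.

Section continuity_closure.
Context {R : realType} {U : normedModType R} (p : U).

Lemma continuous_sum_for (I : Type) (r : seq I) (F : I -> U -> R) :
  (forall i, {for p, continuous (F i)}) -> {for p, continuous (fun q => \sum_(i <- r) F i q)}.
Proof.
move=> hF; apply: (@cvg_big _ _ +%R 0 xpredT) => [|i _]; first exact: add_continuous.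
exact: hF.
Qed.

Lemma continuous_prod_for (I : Type) (r : seq I) (F : I -> U -> R) :
  (forall i, {for p, continuous (F i)}) -> {for p, continuous (fun q => \prod_(i <- r) F i q)}.
Proof.
move=> hF; elim: r => [|i r IH].
  by rewrite (_ : (fun q => _) = cst 1); [exact: cvg_cst|apply/funext => q; rewrite big_nil].
rewrite (_ : (fun q => _) = (fun q => F i q * \prod_(j <- r) F j q)).
  by apply: cvgM; [exact: hF|exact: IH].
by apply/funext => q; rewrite big_cons.
Qed.

Lemma continuousM_for (F G : U -> R) : {for p, continuous F} -> {for p, continuous G} ->
  {for p, continuous (fun q => F q * G q)}.
Proof. by move=> cF cG; apply: cvgM; [exact: cF|exact: cG]. Qed.

Lemma continuousD_for (F G : U -> R) : {for p, continuous F} -> {for p, continuous G} ->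
  {for p, continuous (fun q => F q + G q)}.
Proof. by move=> cF cG; apply: cvgD; [exact: cF|exact: cG]. Qed.

Lemma continuousB_for (F G : U -> R) : {for p, continuous F} -> {for p, continuous G} ->
  {for p, continuous (fun q => F q - G q)}.
Proof. by move=> cF cG; apply: cvgB; [exact: cF|exact: cG]. Qed.

Lemma continuous_det_for n (J : U -> 'M[R]_n) :
  (forall i j, {for p, continuous (fun q => J q i j)}) -> {for p, continuous (fun q => \det (J q))}.
Proof.
move=> hJ; apply: continuous_sum_for => s; apply: continuousM_for; first exact: cvg_cst.
by apply: continuous_prod_for => i; exact: hJ.
Qed.

Lemma continuous_mulmx_for m n k (J : U -> 'M[R]_(m, n)) (K : U -> 'M[R]_(n, k)) i j :
  (forall l, {for p, continuous (fun q => J q i l)}) ->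
  (forall l, {for p, continuous (fun q => K q l j)}) ->
  {for p, continuous (fun q => (J q *m K q) i j)}.
Proof.
move=> hJ hK; rewrite (_ : (fun q => _) = (fun q => \sum_l J q i l * K q l j)).
  by apply: continuous_sum_for => l; apply: continuousM_for.
by apply/funext => q; rewrite mxE.
Qed.

Lemma continuous_coord_for m n (J : U -> 'M[R]_(m, n)) i j :
  {for p, continuous J} -> {for p, continuous (fun q => J q i j)}.
Proof. by move=> cJ; apply: (@continuous_comp _ _ _ J (fun N : 'M[R]_(m, n) => N i j)) => //; exact: coord_continuous. Qed.

End continuity_closure.

(** * Regularity of a conjugacy to a linear system *)

Section conjugacy.
Context {R : realType} {n : nat}.
Notation V := 'cV[R]_n.+1.
Variables (g : R -> V -> V) (L : R).
Hypotheses (L0 : 0 <= L) (gL : forall t x y, `|g t x - g t y| <= L * `|x - y|).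
Variable phi : R -> R -> V -> V.
Hypothesis phiP : general_solution g phi.
Hypothesis g0 : forall t, g t 0 = 0.
Variables (Dg : R -> V -> 'M[R]_n.+1).
Hypothesis cg : forall t x, {for (t, x), continuous (fun p : R * V => g p.1 p.2)}.
Hypothesis sdg : forall t x (e : R), 0 < e -> exists2 r : R, 0 < r & forall s (a b : V),
  `|s - t| < r -> `|a - x| < r -> `|b - x| < r ->
  `|g s b - g s a - Dg t x *m (b - a)| <= e * `|b - a|.
Hypothesis diff_phi : forall t s x, differentiable (phi t s) x.
Notation M t s x := (jacobian_mx (phi t s) x).
Notation delta t s x := (\det (M t s x)).
Notation divg t x := (\tr (Dg t x)).
Hypothesis divgL : forall t x, exists K r : R, [/\ 0 <= K, 0 < r & forall s (y z : V),
  `|s - t| < r -> `|y - x| < r -> `|z - x| < r ->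
  `|divg s y| <= K /\ `|divg s y - divg s z| <= K * `|y - z|].
Hypothesis cdivg : forall t x, {for (t, x), continuous (fun p : R * V => divg p.1 p.2)}.
Hypothesis diff_delta : forall t s x, differentiable (fun y => delta t s y) x.

Variables (A : R -> 'M[R]_n.+1) (U : R -> R -> 'M[R]_n.+1).
Hypothesis cA : continuous A.
Hypothesis dU : forall (t : R) i j, is_derive t 1 (fun s => U s t i j) (A t i j).
Hypothesis U1 : forall t, U t t = 1%:M.

Variable H : R -> V -> V.
Hypothesis HE : forall s t x, H s x = U s t *m H t (phi t s x).
Hypothesis diffH : forall t x, differentiable (H t) x.
Hypothesis C1J : forall t i j, C1fun (fun x => jacobian_mx (H t) x i j).
Notation J t x := (jacobian_mx (H t) x).
Notation h t x := (\det (J t x)).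

Let C1h t : C1fun (fun x => h t x). Proof. exact: C1fun_det. Qed.

(** The base point has its initial time equal to the fixed final time: this is the only case that
    arises when [t] is frozen in [HE]. *)
Lemma flow_continuous t x : {for (t, x), continuous (fun p : R * V => phi t p.1 p.2)}.
Proof.
apply: eps_continuous => e e0; have [r r0 hr] := flow_near L0 gL phiP g0 t x e0.
exists r => // -[s y]; rewrite prod_normE gt_max/= => /andP[sr yr].
by rewrite (flow_init phiP) ltW// hr// subrr normr0.
Qed.

Let c_comp_phi (F : V -> R) t x : {for x, continuous F} ->
  {for (t, x), continuous (fun p : R * V => F (phi t p.1 p.2))}.
Proof.
move=> cF; apply: (@continuous_comp _ _ _ (fun p : R * V => phi t p.1 p.2) F).
  exact: flow_continuous.
by rewrite /= (flow_init phiP).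
Qed.

Let c_fst (F : R -> R) t (x : V) : {for t, continuous F} ->
  {for (t, x), continuous (fun p : R * V => F p.1)}.
Proof.
move=> cF; apply: eps_continuous => e /(continuous_eps cF)[r r0 hr]; exists r => // p.
by rewrite prod_normE gt_max/= => /andP[/hr].
Qed.

Let cU t x i j : {for (t, x), continuous (fun p : R * V => U p.1 t i j)}.
Proof.
apply: (c_fst (F := fun s => U s t i j)).
by have [dd _] := dU t i j; apply: differentiable_continuous; exact/derivable1_diffP.
Qed.

Let cM t x i j : {for (t, x), continuous (fun p : R * V => M t p.1 p.2 i j)}.
Proof.
apply: eps_continuous => e e0; have [C C0 hC] := jacobian_flow_dist L0 gL phiP diff_phi.
have C1 : 0 < C + 1 by rewrite ltr_pwDr.
have [r r0 hr] := common_radius ltr01 (divr_gt0 e0 C1).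
exists r => // -[s y]; rewrite prod_normE gt_max/= => /andP[/hr[s1 se] _].
rewrite (jacobian_flow_init phiP).
have v1 : `|basis_vec j : V| <= 1.
  by apply: cV_norm_le => // k; rewrite mxE; case: (_ && _); rewrite ?normr1 ?normr0.
have ts : `|t - s| <= 1 by rewrite distrC ltW.
have := hC s t y (basis_vec j) ts.
rewrite -derive_jacobian// => hb.
rewrite jacobian_mxE//.
have -> : 'D_(basis_vec j) (phi t s) y i 0 - (1%:M : 'M[R]_n.+1) i j =
   ('D_(basis_vec j) (phi t s) y - basis_vec j) i 0.
  by rewrite [RHS]mxE [X in _ = _ + X]mxE !mxE andbT.
rewrite (le_trans (le_mx_norm _ _ _))// (le_trans hb)//.
rewrite (@le_trans _ _ (C * `|t - s|))//; first by rewrite ler_piMr// mulr_ge0.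
rewrite distrC (@le_trans _ _ ((C + 1) * `|s - t|))//; first by rewrite ler_wpM2r// lerDl.
by rewrite mulrC -ler_pdivlMr// ltW.
Qed.

Lemma jacobian_conjugacy s t x : J s x = U s t *m (J t (phi t s x) *m M t s x).
Proof.
rewrite -jacobian_comp// -{1}(jacobian_mulmx (U s t) ((H t \o phi t s) x)) -jacobian_comp.
- by congr (jacobian_mx _ x); apply/funext => y; rewrite (HE s t).
- exact: differentiable_comp.
- exact: differentiable_mulmx.
Qed.

Let hE s t x : h s x = \det (U s t) * h t (phi t s x) * delta t s x.
Proof. by rewrite (jacobian_conjugacy s t) !det_mulmx mulrA. Qed.

Let cF_coord (F : V -> V) x i j : differentiable F x -> {for x, continuous (fun y => F y i j)}.
Proof. by move=> dF; apply: differentiable_continuous; exact: differentiable_coord_of. Qed.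

Lemma conjugacy_continuous t x i : {for (t, x), continuous (fun p : R * V => H p.1 p.2 i 0)}.
Proof.
rewrite (_ : (fun p => _) = (fun p : R * V => (U p.1 t *m H t (phi t p.1 p.2)) i 0)).
  apply: continuous_mulmx_for => l; first exact: cU.
  by apply: (c_comp_phi (F := fun y => H t y l 0)); exact: cF_coord.
by apply/funext => p; rewrite -HE.
Qed.

Lemma conjugacy_jacobian_continuous t x i j :
  {for (t, x), continuous (fun p : R * V => J p.1 p.2 i j)}.
Proof.
rewrite (_ : (fun p => _) =
  (fun p : R * V => (U p.1 t *m (J t (phi t p.1 p.2) *m M t p.1 p.2)) i j)).
  apply: continuous_mulmx_for => l; first exact: cU.
  apply: continuous_mulmx_for => k; last exact: cM.
  apply: (c_comp_phi (F := fun y => J t y l k)).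
  by have [dJ _] := C1J t l k; exact: differentiable_continuous.
by apply/funext => p; rewrite -jacobian_conjugacy.
Qed.

Lemma conjugacy_det_continuous t x : {for (t, x), continuous (fun p : R * V => h p.1 p.2)}.
Proof. by apply: continuous_det_for => i j; exact: conjugacy_jacobian_continuous. Qed.

Let delta_continuous t x : {for (t, x), continuous (fun p : R * V => delta t p.1 p.2)}.
Proof. by apply: continuous_det_for => i j; exact: cM. Qed.

(** At [s = t] the determinant is constantly 1, so the limit must be 0; [det_flow_bounds] provides
    it with a factor [|t - s|]. *)
Let derive_delta_continuous t x v :
  {for (t, x), continuous (fun p : R * V => 'D_v (fun y => delta t p.1 y) p.2)}.
Proof.
apply: eps_continuous => e e0.
have [C [r [C0 r0 hr]]] := det_flow_bounds L0 gL phiP g0 sdg diff_phi divgL diff_delta t x.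
have K0 : 0 < C * `|v| + 1 by rewrite ltr_pwDr// mulr_ge0.
have [d d0 hd] := common_radius r0 (divr_gt0 e0 K0).
exists d => // -[s y]; rewrite prod_normE gt_max/= => /andP[/hd[s1 se] /hd[y1 _]].
have [_ /(_ v) hb] := hr s y s1 y1.
have -> : 'D_v (fun y => delta t t y) x = 0.
  rewrite (_ : (fun y => _) = cst 1); first exact: derive_cst.
  by apply/funext => z; rewrite (jacobian_flow_init phiP) det1.
rewrite subr0 (le_trans hb)// mulrAC (@le_trans _ _ ((C * `|v| + 1) * `|t - s|))//.
  by rewrite ler_wpM2r// lerDl.
by rewrite mulrC -ler_pdivlMr// distrC ltW.
Qed.

(** With [t] frozen, the product and chain rules applied to [hE] express the derivative through
    factors already known to be continuous at [(t, x)]. *)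
Lemma derive_conjugacy_det_continuous t x v :
  {for (t, x), continuous (fun p : R * V => 'D_v (fun y => h p.1 y) p.2)}.
Proof.
have [dh ch] := C1h t.
rewrite (_ : (fun p => _) = (fun p : R * V => \det (U p.1 t) *
  (h t (phi t p.1 p.2) * 'D_v (fun y => delta t p.1 y) p.2 +
   (\sum_k (M t p.1 p.2 *m v) k 0 * 'D_(basis_vec k) (fun y => h t y) (phi t p.1 p.2)) * delta t p.1 p.2))).
  apply: continuousM_for; first by apply: continuous_det_for => i j; exact: cU.
  apply: continuousD_for; apply: continuousM_for.
  - by apply: (c_comp_phi (F := fun y => h t y)); exact: differentiable_continuous.
  - exact: derive_delta_continuous.
  - apply: continuous_sum_for => k; apply: continuousM_for.
      by apply: continuous_mulmx_for => l; [exact: cM|exact: cvg_cst].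
    by apply: (c_comp_phi (F := 'D_(basis_vec k) (fun y => h t y))); exact: ch.
  - exact: delta_continuous.
apply/funext => -[s y] /=.
have dhp : differentiable ((fun y => h t y) \o phi t s) y by exact: differentiable_comp.
rewrite (_ : (fun y => h s y) = \det (U s t) \*: (((fun y => h t y) \o phi t s) * (fun y => delta t s y))).
  rewrite deriveZ; last by apply: derivableM; exact: diff_derivable.
  rewrite -[LHS]/(_ * _); congr (_ * _).
  rewrite deriveM; [|exact: diff_derivable..].
  rewrite (derive_comp (F := fun y => h t y) v (diff_phi t s y))//.
  rewrite (derive_jacobian v (diff_phi t s y)) (derive_sum_basis _ (dh _)).
  by rewrite -[LHS]/(_ * _ + _ * _) [in X in _ + X]mulrC.
by apply/funext => z; rewrite (hE s t) -mulrA.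
Qed.

Let is_derive_comp_phi (F : V -> R) (t : R) x : differentiable F x ->
  is_derive t 1 (fun s => F (phi t s x)) (- 'D_(g t x) F x).
Proof.
move=> dF; have dp := flow_derive_init L0 gL phiP g0 cg t x.
have dF' : differentiable F (phi t t x) by rewrite (flow_init phiP).
apply: (is_derive_eq (is_derive1_compV dp dF')).
by rewrite (flow_init phiP) !deriveE// linearN.
Qed.

(** In [HE] at [s = t], the factor [U s t] contributes [A], and the flow contributes [- g] because
    [s] is its initial time. *)
Lemma is_derive_conjugacy (t : R) x i : is_derive t 1 (fun s => H s x i 0)
  ((A t *m H t x) i 0 - 'D_(g t x) (fun y => H t y i 0) x).
Proof.
rewrite (_ : (fun s => _) = (fun s => \sum_k U s t i k * H t (phi t s x) k 0)); last first.
  by apply/funext => s; rewrite (HE s t) mxE.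
apply: is_derive_eq.
  apply: is_derive_bigsum => k.
  apply: (@is_deriveM _ _ (fun s => U s t i k) (fun s => H t (phi t s x) k 0)).
  by apply: (is_derive_comp_phi (F := fun y => H t y k 0)); exact: differentiable_coord_of.
rewrite big_split/= U1 (flow_init phiP) addrC mxE; congr (_ + _).
  by apply: eq_bigr => k _; rewrite /GRing.scale/= mulrC.
rewrite (bigD1 i)//= big1 ?addr0 => [|k ki]; rewrite mxE /GRing.scale/=.
  by rewrite eqxx mul1r.
by rewrite eq_sym (negbTE ki) mul0r.
Qed.

Lemma is_derive_conjugacy_det (t : R) x : is_derive t 1 (fun s => h s x)
  ((\tr (A t) - divg t x) * h t x - 'D_(g t x) (fun y => h t y) x).
Proof.
have [dh ch] := C1h t.
have d1 := is_derive_det1 (dU t) (U1 t).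
have d2 := is_derive_comp_phi t (dh x).
have d3 := is_derive_det_flow_init L0 gL phiP g0 sdg diff_phi t x.
rewrite (_ : (fun s => _) = ((fun s => \det (U s t)) * (fun s => h t (phi t s x))) * (fun s => delta t s x)); last first.
  by apply/funext => s; rewrite (hE s t).
apply: is_derive_eq; rewrite /GRing.scale/= -[((fun s => \det (U s t)) * _) t]/(_ * _).
by rewrite U1 (flow_init phiP) (jacobian_flow_init phiP) !det1; ring.
Qed.

Let c_derive_along (F : R -> V -> R) t x :
  (forall t y, differentiable (F t) y) ->
  (forall v, {for (t, x), continuous (fun p : R * V => 'D_v (F p.1) p.2)}) ->
  {for (t, x), continuous (fun p : R * V => 'D_(g p.1 p.2) (F p.1) p.2)}.
Proof.
move=> dF cF.
rewrite (_ : (fun p => _) = (fun p : R * V => \sum_k g p.1 p.2 k 0 * 'D_(basis_vec k) (F p.1) p.2)).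
  apply: continuous_sum_for => k; apply: continuousM_for; last exact: cF.
  by apply: (continuous_coord_for (J := fun p : R * V => g p.1 p.2)); exact: cg.
by apply/funext => p; rewrite derive_sum_basis.
Qed.

Let cD_H t x i v : {for (t, x), continuous (fun p : R * V => 'D_v (fun y => H p.1 y i 0) p.2)}.
Proof.
rewrite (_ : (fun p => _) = (fun p : R * V => (J p.1 p.2 *m v) i 0)).
  apply: continuous_mulmx_for => l; first exact: conjugacy_jacobian_continuous.
  exact: cvg_cst.
apply/funext => p; rewrite derive_coord; last exact: diff_derivable.
by rewrite derive_jacobian.
Qed.

Let cA_coord t (x : V) i j : {for (t, x), continuous (fun p : R * V => A p.1 i j)}.
Proof.
by apply: (c_fst (F := fun s => A s i j)); apply: continuous_coord_for; exact: cA.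
Qed.

(** The formula for the time derivative involves only jointly continuous quantities, so
    [differentiable_of_partials] applies at every point and also gives all the directional
    derivatives. *)
Lemma conjugacy_C1 i : C1fun (fun p : R * V => H p.1 p.2 i 0).
Proof.
pose P (p : R * V) := (A p.1 *m H p.1 p.2) i 0 - 'D_(g p.1 p.2) (fun y => H p.1 y i 0) p.2.
have cP t x : {for (t, x), continuous P}.
  apply: continuousB_for.
    by apply: continuous_mulmx_for => l; [exact: cA_coord|exact: conjugacy_continuous].
  apply: (c_derive_along (F := fun t y => H t y i 0)) => [s y|v]; last exact: cD_H.
  exact: differentiable_coord_of.
have main t x := @differentiable_of_partials _ _ (fun p : R * V => H p.1 p.2 i 0) P t x
  (fun s y => is_derive_conjugacy s y i) (cP t x) (differentiable_coord_of i 0 (diffH t x)).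
split=> [[t x]|[k v] [t x]]; first by have [] := main t x.
rewrite (_ : 'D_(k, v) _ = (fun p : R * V => k * P p + 'D_v (fun y => H p.1 y i 0) p.2)).
  apply: (continuousD_for (F := fun p : R * V => k * P p)
    (G := fun p : R * V => 'D_v (fun y => H p.1 y i 0) p.2)); last exact: cD_H.
  by apply: continuousM_for; [exact: cvg_cst|exact: cP].
by apply/funext => -[s y]; have [_ ->] := main s y.
Qed.

Lemma conjugacy_det_C1 : C1fun (fun p : R * V => h p.1 p.2).
Proof.
pose P (p : R * V) := (\tr (A p.1) - divg p.1 p.2) * h p.1 p.2 - 'D_(g p.1 p.2) (fun y => h p.1 y) p.2.
have dh t x : differentiable (fun y => h t y) x by have [] := C1h t.
have cP t x : {for (t, x), continuous P}.
  apply: continuousB_for.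
    apply: continuousM_for; last exact: conjugacy_det_continuous.
    apply: continuousB_for; last exact: cdivg.
    by apply: continuous_sum_for => k; exact: cA_coord.
  apply: (c_derive_along (F := fun t y => h t y)) => // v.
  exact: derive_conjugacy_det_continuous.
have main t x := @differentiable_of_partials _ _ (fun p : R * V => h p.1 p.2) P t x
  (fun s y => is_derive_conjugacy_det s y) (cP t x) (dh t x).
split=> [[t x]|[k v] [t x]]; first by have [] := main t x.
rewrite (_ : 'D_(k, v) _ = (fun p : R * V => k * P p + 'D_v (fun y => h p.1 y) p.2)).
  apply: (continuousD_for (F := fun p : R * V => k * P p)
    (G := fun p : R * V => 'D_v (fun y => h p.1 y) p.2)); last exact: derive_conjugacy_det_continuous.
  by apply: continuousM_for; [exact: cvg_cst|exact: cP].
by apply/funext => -[s y]; have [_ ->] := main s y.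
Qed.

End conjugacy.

Lemma uniform_radius (R : realType) n (Q : 'I_n -> R -> Prop) :
  (forall i (r r' : R), r' <= r -> Q i r -> Q i r') ->
  (forall i, exists2 r : R, 0 < r & Q i r) -> exists2 r : R, 0 < r & forall i, Q i r.
Proof.
move=> Qle hQ; pose r i := projT1 (cid2 (hQ i)).
have hr i : 0 < r i /\ Q i (r i) by rewrite /r; case: cid2.
exists (\big[Num.min/1]_i r i); first by apply: lt_bigmin => // i _; have [] := hr i.
by move=> i; have [_] := hr i; apply: Qle; exact: bigmin_le.
Qed.

Section C2_functions.
Context {R : realType} {W : normedModType R}.

Lemma C1_C1fun n (F : W -> 'cV[R]_n) i : Ck_on 1 setT F -> C1fun (fun x => F x i 0).
Proof.
move=> [dF cF]; split=> [x|v x]; first by apply: differentiable_coord_of; exact: dF.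
rewrite (_ : 'D_v _ = (fun y => 'D_v F y i 0)).
  by apply: (continuous_coord_for (J := 'D_v F)); exact: cF.
by apply/funext => y; apply: derive_coord; apply: diff_derivable; exact: dF.
Qed.

Lemma C2_derive_C1fun n (F : W -> 'cV[R]_n) v i : Ck_on 2 setT F -> C1fun (fun x => 'D_v F x i 0).
Proof. by move=> [_ cF]; exact: C1_C1fun. Qed.

Lemma C2_differentiable (V' : normedModType R) (F : W -> V') x : Ck_on 2 setT F -> differentiable F x.
Proof. by move=> [dF _]; exact: dF. Qed.

End C2_functions.

Lemma C2_jacobian_C1fun (R : realType) n (F : 'cV[R]_n -> 'cV[R]_n) i j :
  Ck_on 2 setT F -> C1fun (fun x => jacobian_mx F x i j).
Proof.
move=> CF; under [X in C1fun X]eq_fun do rewrite (jacobian_mxE _ _ (C2_differentiable _ CF)).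
exact: C2_derive_C1fun.
Qed.

Lemma divergence_tr (R : realType) n (g : 'cV[R]_n -> 'cV[R]_n) x :
  divergence g x = \tr (jacobian_mx g x).
Proof. by apply: eq_bigr => i _; rewrite [RHS]mxE. Qed.

Lemma divergence_mulE (R : realType) n (p : 'cV[R]_n -> R) g x : differentiable p x ->
  divergence_mul p g x = 'D_(g x) p x + p x * \tr (jacobian_mx g x).
Proof.
move=> dp; rewrite /divergence_mul -divergence_tr; congr (_ + _).
rewrite mxE derive_sum_basis//; apply: eq_bigr => i _.
by rewrite [_^T _ _]mxE [gradient _ _ _ _]mxE mulrC.
Qed.

(** * The linear system and its perturbation *)

Section perturbed.
Context {R : realType} {n : nat}.
Notation V := 'cV[R]_n.+1.
Variables (A : R -> 'M[R]_n.+1) (f : R -> V -> V).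
Hypothesis cA : continuous A.
Hypothesis Cf : Ck_on 2 setT (fun p : R * V => f p.1 p.2).
Notation F := (fun p : R * V => f p.1 p.2).
Notation g := (perturbed_system A f).

Let dF p : differentiable F p. Proof. exact: C2_differentiable. Qed.

Let df t x : differentiable (f t) x.
Proof. exact: (differentiable_pairl (dF (t, x))). Qed.

Lemma jacobian_slice t x i j : jacobian_mx (f t) x i j = 'D_(0, basis_vec j) F (t, x) i 0.
Proof. by rewrite (jacobian_mxE _ _ (df t x)) -(derive_pairl F). Qed.

Lemma differentiable_perturbed t x : differentiable (g t) x.
Proof. by apply: differentiableD; [exact: differentiable_mulmx|exact: df]. Qed.

Lemma jacobian_perturbed t x : jacobian_mx (g t) x = A t + jacobian_mx (f t) x.
Proof.
apply/matrixP => i j; rewrite jacobian_mxE; last exact: differentiable_perturbed.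
rewrite [RHS]mxE (jacobian_mxE _ _ (df t x)) -[in RHS](jacobian_mulmx (A t) x) jacobian_mxE; last exact: differentiable_mulmx.
rewrite (_ : g t = (mulmx (A t) : V -> V) + f t) // deriveD ?mxE//.
  by apply: diff_derivable; exact: differentiable_mulmx.
exact: diff_derivable.
Qed.

Lemma perturbed_continuous t x : {for (t, x), continuous (fun p : R * V => g p.1 p.2)}.
Proof.
have cf : {for (t, x), continuous F} by exact: differentiable_continuous.
suff cAx : {for (t, x), continuous (fun p : R * V => A p.1 *m p.2)} by apply: cvgD; [exact: cAx|exact: cf].
apply: eps_continuous => e e0.
have [r1 r10 h1] := continuous_eps (@cA t) (ltr01 : 0 < 1 :> R).
pose B := n.+1%:R * (`|A t| + 1); have B0 : 0 < B by rewrite mulr_gt0// ltr_wpDl.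
pose B' := n.+1%:R * (`|x| + 1); have B'0 : 0 < B' by rewrite mulr_gt0// ltr_wpDl.
have e2 : 0 < e / 2 by rewrite divr_gt0.
have [r2 r20 h2] := continuous_eps (@cA t) (divr_gt0 e2 B'0).
have [r3 r30 h3] := common_radius r10 r20.
have [r r0 hr] := common_radius r30 (divr_gt0 e2 B0).
exists r => // -[s y]; rewrite prod_normE gt_max/= => /andP[/hr[/h3[s1 s2] _] /hr[_ yx]].
have /= -> : A s *m y - A t *m x = A s *m (y - x) + (A s - A t) *m x.
  by rewrite mulmxBr mulmxBl addrA subrK.
rewrite (le_trans (ler_normD _ _))// (splitr e) lerD//.
  rewrite (le_trans (norm_mulmx_le _ _))// (@le_trans _ _ (B * `|y - x|))//.
    rewrite ler_wpM2r// /B ler_wpM2l// -(subrK (A t) (A s)) (le_trans (ler_normD _ _))//.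
    by rewrite addrC lerD2l; exact: h1.
  by rewrite mulrC -ler_pdivlMr// ltW.
rewrite (le_trans (norm_mulmx_le _ _))// (@le_trans _ _ (B' * `|A s - A t|))//.
  by rewrite /B' mulrAC ler_wpM2r// ler_wpM2l// lerDl.
by rewrite mulrC -ler_pdivlMr//; exact: h2.
Qed.

(** [f] is treated coordinatewise by [strict_partial]; the linear part adds
    [(A s - A t) *m (b - a)], small by mere continuity of [A]. *)
Lemma perturbed_strict_derivative t x (e : R) : 0 < e -> exists2 r : R, 0 < r & forall s (a b : V),
  `|s - t| < r -> `|a - x| < r -> `|b - x| < r ->
  `|g s b - g s a - (A t + jacobian_mx (f t) x) *m (b - a)| <= e * `|b - a|.
Proof.
move=> e0; have e2 : 0 < e / 2 by rewrite divr_gt0.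
pose Q i (r : R) := forall s (a b : V), `|s - t| < r -> `|a - x| < r -> `|b - x| < r ->
  `|(f s b - f s a - jacobian_mx (f t) x *m (b - a)) i 0| <= e / 2 * `|b - a|.
have [|i|r1 r10 h1] := @uniform_radius R _ Q.
- by move=> i r r' rr h s a b sr ar br; apply: h; exact: lt_le_trans rr.
- have [] := @strict_partial _ _ (fun p => F p i 0) t x (e / 2) _ _ e2.
  + by move=> q; exact: differentiable_coord_of.
  + move=> k; have [dFk _] := C2_derive_C1fun (0, basis_vec k) i Cf.
    rewrite (_ : 'D_(0, basis_vec k) _ = (fun p => 'D_(0, basis_vec k) F p i 0)).
      exact: differentiable_continuous.
    by apply/funext => p; apply: derive_coord; exact: diff_derivable.
  move=> r r0 hr; exists r => // s a b sr ar br; have := hr s a b sr ar br => /=.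
  congr (`|_| <= _); rewrite !mxE; congr (_ - _); apply: eq_bigr => k _.
  by rewrite mulrC jacobian_slice -derive_coord//; exact: diff_derivable.
have N0 : 0 < n.+1%:R :> R by [].
have [r2 r20 h2] := continuous_eps (@cA t) (divr_gt0 e2 N0).
have [r r0 hr] := common_radius r10 r20; exists r => // s a b /hr[s1 s2] /hr[a1 _] /hr[b1 _].
have -> : g s b - g s a - (A t + jacobian_mx (f t) x) *m (b - a) =
    (A s - A t) *m (b - a) + (f s b - f s a - jacobian_mx (f t) x *m (b - a)).
  rewrite /perturbed_system mulmxDl mulmxBl [A s *m (b - a)]mulmxBr.
  move: (A s *m b) (A s *m a) (A t *m (b - a)) (jacobian_mx _ _ *m _) (f s b) (f s a) => p q u v y z.
  by apply/colP => i; rewrite !mxE; ring.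
rewrite (le_trans (ler_normD _ _))// (splitr e) mulrDl lerD//.
  rewrite (le_trans (norm_mulmx_le _ _))// ler_wpM2r// mulrC -ler_pdivlMr//; exact: h2.
by apply: cV_norm_le => [|i]; [rewrite mulr_ge0// ltW|exact: h1].
Qed.

Let T (p : R * V) := \sum_i 'D_(0, basis_vec i) F p i 0.

Let C1T : C1fun T. Proof. by apply: C1fun_sum => i; exact: C2_derive_C1fun. Qed.

Let divE t x : \tr (A t + jacobian_mx (f t) x) = \tr (A t) + T (t, x).
Proof. by rewrite mxtraceD; congr (_ + _); apply: eq_bigr => i _; rewrite jacobian_slice. Qed.

Let ctrA : continuous (fun t => \tr (A t)).
Proof.
move=> t; apply: continuous_sum_for => i.
by apply: continuous_coord_for; exact: cA.
Qed.

Lemma perturbed_div_continuous t x :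
  {for (t, x), continuous (fun p : R * V => \tr (A p.1 + jacobian_mx (f p.1) p.2))}.
Proof.
rewrite (_ : (fun p => _) = (fun p : R * V => \tr (A p.1) + T p)).
  apply: continuousD_for; last by have [dT _] := C1T; exact: differentiable_continuous.
  apply: eps_continuous => e /(continuous_eps (@ctrA t))[r r0 hr]; exists r => // p.
  by rewrite prod_normE gt_max/= => /andP[/hr].
by apply/funext => -[s y]; rewrite divE.
Qed.

(** The trace of [A s] cancels in the difference, and the divergence [T] of [f] is C^1 because [f]
    is C^2. *)
Lemma perturbed_div_lipschitz t x : exists K r : R, [/\ 0 <= K, 0 < r & forall s (y z : V),
  `|s - t| < r -> `|y - x| < r -> `|z - x| < r ->
  `|\tr (A s + jacobian_mx (f s) y)| <= K /\
  `|\tr (A s + jacobian_mx (f s) y) - \tr (A s + jacobian_mx (f s) z)| <= K * `|y - z|].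
Proof.
have [dT cT] := C1T.
have [r1 r10 h1] := continuous_eps (@perturbed_div_continuous t x) (ltr01 : 0 < 1 :> R).
have [r2 r20 h2] := strict_partial dT (fun k => cT (0, basis_vec k) (t, x)) (ltr01 : 0 < 1 :> R).
pose K1 := `|\tr (A t + jacobian_mx (f t) x)| + 1.
pose K2 := \sum_k `|'D_(0, basis_vec k) T (t, x)| + 1.
have K10 : 0 <= K1 by rewrite addr_ge0.
have K20 : 0 <= K2 by rewrite addr_ge0// sumr_ge0.
have [r r0 hr] := common_radius r10 r20.
exists (K1 + K2), r; split=> //; first by rewrite addr_ge0.
move=> s y z /hr[s1 s2] /hr[y1 y2] /hr[z1 z2]; split.
  have /= := h1 (s, y); rewrite prod_normE gt_max/= s1 y1 => /(_ isT) h.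
  rewrite (@le_trans _ _ K1)//; last by rewrite lerDl.
  rewrite -(subrK (\tr (A t + jacobian_mx (f t) x)) (\tr (A s + _))) (le_trans (ler_normD _ _))//.
  by rewrite addrC lerD2l.
rewrite !divE opprD addrACA subrr add0r (@le_trans _ _ (K2 * `|y - z|))//; last by rewrite ler_wpM2r// lerDr.
have := h2 s z y s2 z2 y2; set S := \sum_k _ => h.
rewrite -(subrK S (T (s, y) - T (s, z))) (le_trans (ler_normD _ _))// /K2 mulrDl addrC lerD//.
rewrite (le_trans (ler_norm_sum _ _ _))// mulr_suml ler_sum// => k _.
by rewrite normrM mulrC ler_wpM2l// le_mx_norm.
Qed.

End perturbed.

Section linear.
Context {R : realType} {n : nat}.
Notation V := 'cV[R]_n.+1.
Variables (A : R -> 'M[R]_n.+1) (Psi : R -> 'M[R]_n.+1).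
Hypothesis PsiP : fundamental_matrix A Psi.
Notation U := (transition_mx Psi).

Lemma transition_mx1 t : U t t = 1%:M.
Proof. by have [_ Pu] := PsiP t; exact: mulmxV. Qed.

Lemma det_transition_neq0 t s : \det (U t s) != 0.
Proof.
have [_ Pt] := PsiP t; have [_ Ps] := PsiP s.
by rewrite -unitfE -unitmxE unitmx_mul Pt unitmx_inv.
Qed.

Let is_derive_mulmxr m (B : 'M[R]_(n.+1, m)) (t : R) i j :
  is_derive t 1 (fun s => (Psi s *m B) i j) ((A t *m (Psi t *m B)) i j).
Proof.
have [dPsi _] := PsiP t.
under [X in is_derive _ _ X _]eq_fun do rewrite mxE.
have dc k := is_derive_coord i k dPsi.
apply: is_derive_eq.
  apply: is_derive_bigsum => l.
rewrite mulmxA mxE; apply: eq_bigr => k _.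
by rewrite scaler0 add0r /GRing.scale/= mulrC.
Qed.

Lemma is_derive_transition_mx (t : R) i j : is_derive t 1 (fun s => U s t i j) (A t i j).
Proof.
apply: is_derive_eq; first exact: is_derive_mulmxr.
by rewrite -[Psi t *m _]/(U t t) transition_mx1 mulmx1.
Qed.

Variable L : R.
Hypotheses (L0 : 0 <= L) (AL : forall t (x y : V), `|A t *m x - A t *m y| <= L * `|x - y|).

Lemma linear_solutionE (y : R -> V) s t : solution_on setT (linear_system A) y ->
  y t = U t s *m y s.
Proof.
move=> dy; apply: (@solution_unique _ _ (linear_system A) L L0 AL y (fun t => U t s *m y s)
  (Num.min s t) (Num.max s t) s).
- by move=> u _; exact: dy.
- move=> u _; apply: coord_is_derive => i j.
  under [X in is_derive _ _ X _]eq_fun do rewrite /transition_mx -mulmxA.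
  by rewrite /linear_system /transition_mx -mulmxA; exact: is_derive_mulmxr.
- by rewrite ge_min le_max !lexx.
- by rewrite transition_mx1 mul1mx.
- by rewrite ge_min le_max !lexx !orbT.
Qed.

(* Letting s tend to -oo in |y t| <= |U t s| |y s| <= K e^(-alpha (t - s)) M. *)
Lemma bounded_linear_solution_eq0 (vnorm : V -> R) (mnorm : 'M[R]_n.+1 -> R) (K alpha M : R)
    (y : R -> V) :
  is_norm vnorm -> corresponding_mx_norm vnorm mnorm -> 1 <= K -> 0 < alpha ->
  (forall t s, s <= t -> mnorm (U t s) <= K * expR (- alpha * (t - s))) ->
  (forall t, vnorm (y t) <= M) -> solution_on setT (linear_system A) y -> forall t, y t = 0.
Proof.
move=> vP [mP _ mv] K1 a0 hK yM dy t; have [_ _ v0] := vP; apply: v0.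
apply/eqP; rewrite eq_le is_norm_ge0// andbT; rewrite leNgt; apply/negP => c0.
set c := vnorm (y t) in c0.
have M0 : 0 <= M by apply: le_trans (yM 0); exact: is_norm_ge0.
have K0 : 0 < K by lra.
(* Going back in time by [x / alpha] gives [c <= expR (- x) * K * M], that is [expR x * c <= x * c],
   contradicting [1 + x <= expR x]. *)
pose x := K * M / c; have x0 : 0 <= x by rewrite !mulr_ge0// ?invr_ge0 ltW.
have xa : x / alpha * alpha = x by rewrite divfK// gt_eqF.
have := hK t (t - x / alpha).
rewrite subKr mulNr [alpha * _]mulrC xa gerBl divr_ge0 ?(ltW a0)// => /(_ isT) h.
have e0 : 0 < expR x by exact: expR_gt0.
have : c <= expR (- x) * K * M.
  rewrite /c (@linear_solutionE y (t - x / alpha) t)// (le_trans (mv _ _))//.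
  rewrite [expR _ * K]mulrC (@le_trans _ _ (K * expR (- x) * vnorm (y (t - x / alpha))))//.
    by rewrite ler_wpM2r ?is_norm_ge0.
  by rewrite ler_wpM2l// mulr_ge0 ?expR_ge0// ltW.
rewrite expRN -mulrA ler_pdivlMl// => h1.
have : (1 + x) * c <= expR x * c by rewrite ler_wpM2r ?(ltW c0)// expR_ge1Dx.
by rewrite mulrDl mul1r divfK ?gt_eqF//; lra.
Qed.

End linear.

Lemma open_neq0 (R : realType) (V : normedModType R) : open [set x : V | x != 0].
Proof.
rewrite (_ : [set x | _] = (fun x : V => `|x|) @^-1` [set r : R | 0 < r]).
  by apply: open_comp => [x _|]; [exact: norm_continuous|exact: open_gt].
by apply/seteqP; split=> x /=; rewrite normr_gt0.
Qed.

(** The origin lies in boxes of side [d <= 1], whose volume is at most [d]; this relies on the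
    dimension being positive. *)
Lemma negligible_origin (R : realType) n : (@lebesgue_cV R n.+1).-negligible [set 0].
Proof.
have m0 : measurable [set 0 : 'cV[R]_n.+1].
  rewrite -[X in measurable X]setCK; apply: measurableC; apply: open_measurable_cV.
  by rewrite (_ : ~` _ = [set x : 'cV[R]_n.+1 | x != 0]); [exact: open_neq0|apply/seteqP; split=> x /eqP].
apply/(negligibleP _ m0).
apply/eqP; rewrite eq_le measure_ge0 andbT; apply/lee_addgt0Pr => e e0; rewrite add0e.
pose d := Num.min e 1; have d0 : 0 < d by rewrite lt_min e0 ltr01.
have d1 : d <= 1 by rewrite ge_min lexx orbT.
have de : d <= e by rewrite ge_min lexx.
pose B := [set x : 'cV[R]_n.+1 | forall i, (const_mx (- d) : 'cV[R]_n.+1) i 0 < x i 0 <= (0 : 'cV[R]_n.+1) i 0].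
apply: (@le_trans _ _ (lebesgue_cV B)).
  apply: le_measure; rewrite ?inE.
  - exact: m0.
  - exact: (measurable_oc_box (const_mx (- d)) 0).
  - by move=> x -> i; rewrite !mxE oppr_lt0 d0 lexx.
rewrite lebesgue_cV_box => [|i]; last by rewrite !mxE oppr_le0 ltW.
rewrite lee_fin (eq_bigr (fun=> d)) => [|i _]; last by rewrite !mxE opprK add0r.
by rewrite prodr_const card_ord exprS (le_trans _ de)// ler_piMr ?(ltW d0)// exprn_ile1// ltW.
Qed.

Lemma measurable_differentiable (R : realType) n (F : 'cV[R]_n -> 'cV[R]_n) :
  (forall x, differentiable F x) -> measurable_fun setT F.
Proof.
move=> dF; apply: measurable_fun_cVP => i; apply: continuous_measurable_cV openT _ => x _.
by apply: differentiable_continuous; exact: differentiable_coord_of.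
Qed.

(** * Integrability and null sets under a diffeomorphism *)

Section diffeomorphism.
Context {R : realType} {n : nat}.
Notation V := 'cV[R]_n.
Variables H H' : V -> V.
Hypotheses (HK : cancel H H') (HK' : cancel H' H).
Hypotheses (dH : forall x, differentiable H x) (dH' : forall x, differentiable H' x).
Hypothesis cdet : continuous (fun x => \det (jacobian_mx H x)).
Hypothesis det_gt0 : forall x, 0 < \det (jacobian_mx H x).
Notation lam := (@lebesgue_cV R n).
Notation w x := (\det (jacobian_mx H x)).

Let mH : measurable_fun setT H. Proof. exact: measurable_differentiable. Qed.

Let mw : measurable_fun setT (fun x => w x).
Proof. by apply: continuous_measurable_cV openT _ => x _; exact: cdet. Qed.

(** This is [lebesgue_cV_preimage] for the pair [H], [H'], with [B] seen as the preimage under [H']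
    of its own preimage under [H]. *)
Lemma lebesgue_cV_diffeo B : measurable B -> lam B = (\int[lam]_(x in H @^-1` B) (w x)%:E)%E.
Proof.
move=> mB; have -> : B = H' @^-1` (H @^-1` B).
  by apply/seteqP; split=> x /=; rewrite HK'.
rewrite (lebesgue_cV_preimage HK HK' (T := jacobian_mx H) (S := jacobian_mx H')).
- rewrite (_ : H @^-1` (H' @^-1` (H @^-1` B)) = H @^-1` B).
    by under eq_integral do rewrite gtr0_norm//.
  by apply/seteqP; split=> x /=; rewrite HK'.
- by move=> x e; exact: jacobian_eps.
- by move=> x e; exact: jacobian_eps.
- move=> x; rewrite -jacobian_comp// (_ : H' \o H = id) ?jacobian_id//.
  by apply/funext => y /=; rewrite HK.
- exact: cdet.
- exact: measurable_differentiable.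
- exact: measurable_preimage_setT.
Qed.

Lemma integrable_diffeo (p : V -> R) (E : set V) : measurable E ->
  lam.-integrable E (fun y => (p y)%:E) ->
  lam.-integrable (H @^-1` E) (fun x => (p (H x) * w x)%:E).
Proof.
move=> mE /integrableP[mp pfin].
have mHE : measurable (H @^-1` E) by exact: measurable_preimage_setT.
have mp' : measurable_fun E p by apply/measurable_EFinP.
apply/integrableP; split.
  apply/measurable_EFinP; apply: measurable_funM; last exact: measurable_funTS.
  apply: (measurable_comp mE _ mp'); last exact: measurable_funTS.
  by move=> _ [x hx <-].
apply: le_lt_trans pfin.
rewrite integral_mkcond [leRHS]integral_mkcond.
have u0 y : (0 <= ((fun y => `|(p y)%:E|) \_ E) y)%E by rewrite patchE; case: ifP.
rewrite [leRHS](ge0_integral_density_pushforward mH mw (fun x => ltW (det_gt0 x)) lebesgue_cV_diffeo)//.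
  rewrite le_eqVlt; apply/orP; left; apply/eqP/eq_integral => x _; rewrite !patchE.
  have -> : (x \in H @^-1` E) = (H x \in E) by apply/idP/idP; rewrite !inE.
  case: ifP => _; last by rewrite mul0e.
  by rewrite /= normrM (gtr0_norm (det_gt0 x)) EFinM.
by apply/(measurable_restrictT _ mE); apply: measurableT_comp.
Qed.

Lemma negligible_diffeo N : lam.-negligible N -> lam.-negligible (H @^-1` N).
Proof. exact: (negligible_preimage mH mw (fun x => ltW (det_gt0 x)) lebesgue_cV_diffeo). Qed.

End diffeomorphism.

Section pairs.
Context {R : realType}.

Lemma differentiable_fst (V : normedModType R) (p : R * V) : differentiable (fun p : R * V => p.1) p.
Proof. by apply: (linear_differentiable (f := fst)) => q; exact: cvg_fst. Qed.

Lemma derive_fst (V : normedModType R) (p u : R * V) : 'D_u (fun p : R * V => p.1) p = u.1.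
Proof.
rewrite deriveE; last exact: differentiable_fst.
by rewrite (diff_lin (f := fst))// => q; exact: cvg_fst.
Qed.

Lemma derive_mkpair (U V W : normedModType R) (F : U -> V) (G : U -> W) x u :
  differentiable F x -> differentiable G x ->
  'D_u (fun y => (F y, G y)) x = ('D_u F x, 'D_u G x).
Proof.
move=> dF dG; rewrite !deriveE//; last exact: differentiable_pair.
by rewrite diff_pair.
Qed.

End pairs.

(** * Transport of the density *)

Section transported_density.
Context {R : realType} {n : nat}.
Notation V := 'cV[R]_n.+1.
Variables (g : R -> V -> V) (Dg : R -> V -> 'M[R]_n.+1) (A : R -> 'M[R]_n.+1).
Hypothesis Dg_jac : forall t x, jacobian_mx (g t) x = Dg t x.
Variables H : R -> V -> V.
Notation J t x := (jacobian_mx (H t) x).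
Notation h t x := (\det (J t x)).
Hypothesis C1H : forall i, C1fun (fun p : R * V => H p.1 p.2 i 0).
Hypothesis C1h : C1fun (fun p : R * V => h p.1 p.2).
Hypothesis dtH : forall (t : R) x i, is_derive t 1 (fun s => H s x i 0)
  ((A t *m H t x) i 0 - 'D_(g t x) (fun y => H t y i 0) x).
Hypothesis dth : forall (t : R) x, is_derive t 1 (fun s => h s x)
  ((\tr (A t) - \tr (Dg t x)) * h t x - 'D_(g t x) (fun y => h t y) x).
Hypothesis H_neq0 : forall t x, x != 0 -> H t x != 0.
Variable rho : R -> V -> R.
Notation F := (fun p : R * V => rho p.1 p.2).
Hypothesis C1F : Ck_on 1 [set p : R * V | p.2 != 0] F.
Notation G := (fun p : R * V => rho p.1 (H p.1 p.2) * h p.1 p.2).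
Let Phi (p : R * V) : R * V := (p.1, H p.1 p.2).

Let dHp p : differentiable (fun p : R * V => H p.1 p.2) p.
Proof. by apply: differentiable_coords => i j; rewrite ord1; have [dHi _] := C1H i. Qed.

Let dPhi p : differentiable Phi p.
Proof. by apply: differentiable_pair; [exact: differentiable_fst|exact: dHp]. Qed.

Let dF p : p.2 != 0 -> differentiable F p. Proof. by have [dF _] := C1F; exact: dF. Qed.

Let dFPhi p : p.2 != 0 -> differentiable (F \o Phi) p.
Proof. by move=> p0; apply: differentiable_comp; [exact: dPhi|apply: (dF (p := Phi p)); exact: H_neq0]. Qed.

Let dh p : differentiable (fun p : R * V => h p.1 p.2) p. Proof. by have [dh _] := C1h. Qed.

Let derive_Phi p (u : R * V) : 'D_u Phi p = (u.1, 'D_u (fun p : R * V => H p.1 p.2) p).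
Proof.
by rewrite derive_mkpair ?derive_fst//; exact: differentiable_fst.
Qed.

Let derive_G p (u : R * V) : p.2 != 0 -> 'D_u G p =
  rho p.1 (H p.1 p.2) * 'D_u (fun p : R * V => h p.1 p.2) p +
  h p.1 p.2 * (u.1 * 'D_(1, 0) F (Phi p) +
     \sum_i 'D_u (fun p : R * V => H p.1 p.2 i 0) p * 'D_(0, basis_vec i) F (Phi p)).
Proof.
move=> p0; have dFp : differentiable F (Phi p) by apply: dF; exact: H_neq0.
rewrite -[LHS]/('D_u ((F \o Phi) * (fun p : R * V => h p.1 p.2)) p) deriveM; last 2 first.
- by apply: diff_derivable; exact: dFPhi.
- exact: diff_derivable.
rewrite (derive_comp (F := F) u (dPhi p) dFp) derive_Phi derive_pair//.
congr (_ + _ * (_ + _)); apply: eq_bigr => i _.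
by rewrite derive_coord//; exact: diff_derivable.
Qed.

Lemma transported_density_C1 : Ck_on 1 [set p : R * V | p.2 != 0] G.
Proof.
have [_ cF] := C1F; split=> [p p0|u p p0].
  by apply: (@differentiableM _ _ (F \o Phi) (fun p : R * V => h p.1 p.2)) => //; exact: dFPhi.
pose E q := rho q.1 (H q.1 q.2) * 'D_u (fun p : R * V => h p.1 p.2) q +
  h q.1 q.2 * (u.1 * 'D_(1, 0) F (Phi q) +
     \sum_i 'D_u (fun p : R * V => H p.1 p.2 i 0) q * 'D_(0, basis_vec i) F (Phi q)).
have cPhi (f : R * V -> R) : {for Phi p, continuous f} -> {for p, continuous (fun q => f (Phi q))}.
  move=> cf; apply: (@continuous_comp _ _ _ Phi f); last exact: cf.
  apply: differentiable_continuous; exact: dPhi.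
have Hp0 : [set p : R * V | p.2 != 0] (Phi p) by exact: H_neq0.
have cE : {for p, continuous E}.
  apply: (continuousD_for (F := fun q => rho q.1 (H q.1 q.2) * 'D_u (fun p : R * V => h p.1 p.2) q)).
    apply: (continuousM_for (F := fun q => rho q.1 (H q.1 q.2))).
      by apply: differentiable_continuous; exact: dFPhi.
    by have [_ ch] := C1h; exact: ch.
  apply: (continuousM_for (F := fun q => h q.1 q.2)); first exact: differentiable_continuous.
  apply: (continuousD_for (F := fun q => u.1 * 'D_(1, 0) F (Phi q))).
    apply: (continuousM_for (F := fun=> u.1)); first exact: cvg_cst.
    by apply: (cPhi ('D_(1, 0) F)); exact: cF.
  apply: continuous_sum_for => i; apply: (continuousM_for (F := 'D_u (fun p : R * V => H p.1 p.2 i 0))).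
    by have [_ cH] := C1H i; exact: cH.
  by apply: (cPhi ('D_(0, basis_vec i) F)); exact: cF.
(* The formula [E] is the derivative only off the origin; that set is open, so the two agree near
   [p] and the limit carries over. *)
have op : open [set q : R * V | q.2 != 0].
  by apply: (@open_comp _ _ snd [set x : V | x != 0]); [move=> q _; exact: cvg_snd|exact: open_neq0].
have nE : \near p, E p = 'D_u G p.
  by apply: filterS (open_nbhs_nbhs (conj op p0)) => q q0; rewrite derive_G.
have EG : E p = 'D_u G p by rewrite derive_G.
have cDG : 'D_u G @ p --> E p by apply: cvg_trans cE; exact: near_eq_cvg.
by rewrite EG in cDG.
Qed.

(** The [- 'D_g H] part of the time derivative of [H] cancels the transport of [rho] by [g], and the
    equation for [h] trades the divergence of [g] for the trace of [A]. *)
Lemma transported_density_transport t x : x != 0 ->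
  derive1 (fun s => rho s (H s x) * h s x) t +
    divergence_mul (fun x => rho t (H t x) * h t x) (g t) x =
  h t x * (derive1 (rho ^~ (H t x)) t + divergence_mul (rho t) (linear_system A t) (H t x)).
Proof.
move=> x0; have Hx0 := H_neq0 t x0.
have dFp : differentiable F (t, H t x) by exact: dF.
have drho : differentiable (rho t) (H t x) by exact: (differentiable_pairl dFp).
have dHt : differentiable (H t) x by exact: (differentiable_pairl (dHp (t, x))).
have dht : differentiable (fun y => h t y) x by exact: (differentiable_pairl (dh (t, x))).
have drhoH : differentiable (rho t \o H t) x by exact: differentiable_comp.
rewrite divergence_mulE; last exact: (differentiableM drhoH dht).
rewrite divergence_mulE// Dg_jac (_ : jacobian_mx (linear_system A t) (H t x) = A t); last exact: jacobian_mulmx.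
rewrite -[X in _ + (X + _)]/('D_(g t x) ((rho t \o H t) * (fun y => h t y)) x).
rewrite deriveM; [|exact: diff_derivable..].
rewrite (derive_comp (F := rho t) (g t x) dHt drho).
have dc : is_derive t 1 (fun s => (s, H s x) : R * V) (1, A t *m H t x - 'D_(g t x) (H t) x).
  have dHs : is_derive t 1 (fun s => H s x) (A t *m H t x - 'D_(g t x) (H t) x).
    apply: coord_is_derive => i j; rewrite ord1 !mxE -derive_coord; last exact: diff_derivable.
    by have := dtH t x i; rewrite mxE.
  have [dHd dHe] := dHs.
  have ds : differentiable (fun s => H s x) t by exact/derivable1_diffP.
  apply: DeriveDef.
    by apply/derivable1_diffP; apply: differentiable_pair.
  by rewrite derive_mkpair// dHe derive_id.
have d1 := is_derive1_compV dc dFp.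
rewrite derive1E (@derive_val _ _ _ _ _ _ _ (@is_deriveM _ _ (fun s => rho s (H s x)) (fun s => h s x) t 1 _ _ d1 (dth t x))).
rewrite derive1E (derive_pairr F).
rewrite /linear_system.
have -> : (1, A t *m H t x - 'D_(g t x) (H t) x) =
   1 *: (1, 0) + 1 *: (0, A t *m H t x - 'D_(g t x) (H t) x) :> R * V.
  by rewrite !scale1r; congr pair; rewrite /= ?addr0 ?add0r.
rewrite deriveDl// !scale1r -derive_pairl.
have -> : 'D_(A t *m H t x - 'D_(g t x) (H t) x) (fun y => F (t, y)) (H t x) =
   'D_(A t *m H t x) (rho t) (H t x) - 'D_('D_(g t x) (H t) x) (rho t) (H t x).
  by rewrite !deriveE// linearB.
rewrite /GRing.scale/=; ring.
Qed.

End transported_density.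

Theorem theorem3 (R : realType) (n : nat)
  (vnorm : 'cV[R]_n.+1 -> R) (mnorm : 'M[R]_n.+1 -> R)
  (vnormP : is_norm vnorm) (mnormP : corresponding_mx_norm vnorm mnorm)
  (A : R -> 'M[R]_n.+1)
  (A_bounded : exists M, forall t, mnorm (A t) <= M)
  (A_continuous : continuous A)
  (f : R -> 'cV[R]_n.+1 -> 'cV[R]_n.+1)
  (f_continuous : continuous (fun p : R * 'cV[R]_n.+1 => f p.1 p.2))
  (Psi : R -> 'M[R]_n.+1) (PsiP : fundamental_matrix A Psi)
  (phi : R -> R -> 'cV[R]_n.+1 -> 'cV[R]_n.+1)
  (phiP : general_solution (perturbed_system A f) phi)
  (mu gamma K alpha : R)
  (H1 : forall t x, vnorm (f t x) <= mu)
  (H2 : forall t x1 x2, vnorm (f t x1 - f t x2) <= gamma * vnorm (x1 - x2))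
  (K_ge1 : 1 <= K) (alpha_gt0 : 0 < alpha)
  (H3 : forall t s, s <= t ->
     mnorm (transition_mx Psi t s) <= K * expR (- alpha * (t - s)))
  (H4 : gamma <= alpha / (4 * K))
  (H5 : forall t, f t 0 = 0)
  (D1_C2 : Ck_on 2 setT (fun p : R * 'cV[R]_n.+1 => f p.1 p.2))
  (D1 : forall t xi,
     (\int[lebesgue_measure]_(r in `]-oo, t])
        (mx_norm_infty (transition_mx Psi t r *m
           jacobian_mx (f r) (phi r 0 xi) *m transition_mx Psi r t))%:E
      < 1%:E)%E)
  (D2 : forall t xi,
     (-oo < limf_einf
        (fun s : R => (- \int[lebesgue_measure]_(r in `[s, t]) \tr (A r))%:E)
        (ninfty_nbhs R))%E /\
     (-oo < limf_einf
        (fun s : R => (- \int[lebesgue_measure]_(r in `[s, t])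
           \tr (A r + jacobian_mx (f r) (phi r 0 xi)))%:E)
        (ninfty_nbhs R))%E)
  (Z : R -> R -> 'cV[R]_n.+1 -> 'M[R]_n.+1)
  (ZP : forall t x,
     fundamental_matrix (fun s => param_coef Psi f phi t s x)
       (fun s => Z t s x) /\ Z t t x = 1%:M)
  (D3 : forall t xi (i j : 'I_n.+1),
     cvg ((fun s => 'D_(basis_vec j) (Z t s) (phi t 0 xi) *m basis_vec i)
            @ ninfty_nbhs R))
  (H : R -> 'cV[R]_n.+1 -> 'cV[R]_n.+1)
  (H_palmer : palmer_map vnorm A f H)
  (H_diffeo : forall t, C2_orientation_preserving_diffeo (H t))
  (rho : R -> 'cV[R]_n.+1 -> R)
  (rhoP : density_function (linear_system A) rho) :
  density_function (perturbed_system A f)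
    (fun t x => rho t (H t x) * \det (jacobian_mx (H t) x)).
Proof.
have [_ _ mnormv] := mnormP.
have [Mb A_le] := A_bounded.
have [c1 c1_gt0 vnorm_le] := is_norm_le_mx_norm vnormP.
have [c2 c2_gt0 le_vnorm] := mx_norm_le_is_norm vnormP.
set g := perturbed_system A f in phiP *.
pose L1 := c2 * `|Mb| * c1; pose L2 := c2 * `|gamma| * c1.
have L1_ge0 : 0 <= L1 by rewrite !mulr_ge0// ltW.
have L2_ge0 : 0 <= L2 by rewrite !mulr_ge0// ltW.
have vnorm_scale (k : R) (x y : 'cV[R]_n.+1) : vnorm x <= k * vnorm y -> `|x| <= c2 * `|k| * c1 * `|y|.
  move=> xy; rewrite (le_trans (le_vnorm _))// -!mulrA ler_wpM2l ?(ltW c2_gt0)//.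
  rewrite (le_trans xy)// (@le_trans _ _ (`|k| * vnorm y))//.
    by rewrite ler_wpM2r ?is_norm_ge0// ler_norm.
  by rewrite ler_wpM2l.
have AL t (x y : 'cV[R]_n.+1) : `|A t *m x - A t *m y| <= L1 * `|x - y|.
  apply: vnorm_scale; rewrite -mulmxBr (le_trans (mnormv _ _))//.
  by rewrite ler_wpM2r ?is_norm_ge0.
have fL t x y : `|f t x - f t y| <= L2 * `|x - y| by apply: vnorm_scale.
pose L := L1 + L2; have L_ge0 : 0 <= L by rewrite addr_ge0.
have gL t x y : `|g t x - g t y| <= L * `|x - y|.
  by rewrite /g /perturbed_system opprD addrACA mulrDl (le_trans (ler_normD _ _))// lerD.
have g0 t : g t 0 = 0 by rewrite /g /perturbed_system mulmx0 H5 addr0.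
have [[bound H_bound] H_solution] := H_palmer.
pose U := transition_mx Psi.
have HE s t x : H s x = U s t *m H t (phi t s x).
  have [sol phi0] := phiP s x.
  rewrite -(linear_solutionE PsiP L1_ge0 AL (y := fun u => H u (phi u s x)) t s) ?phi0//.
  exact: H_solution.
have C2H t : Ck_on 2 setT (H t) by have [] := H_diffeo t.
have dH t x : differentiable (H t) x by exact: C2_differentiable.
have det_gt0 t x : 0 < \det (jacobian_mx (H t) x) by have [] := H_diffeo t.
have /choice[H' H'P] : forall t, exists H' : 'cV[R]_n.+1 -> 'cV[R]_n.+1,
    [/\ cancel (H t) H', cancel H' (H t) & forall x, differentiable H' x].
  move=> t; have [_ [H' [HK H'K C2H']] _] := H_diffeo t.
  by exists H'; split=> // x; exact: C2_differentiable.
have HK t : cancel (H t) (H' t) by have [] := H'P t.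
have H'K t : cancel (H' t) (H t) by have [] := H'P t.
have dH' t x : differentiable (H' t) x by have [] := H'P t.
have UK t s x : U t s *m (U s t *m x) = x.
  have [[_ Pt] [_ Ps]] := (PsiP t, PsiP s).
  by rewrite /U /transition_mx -!mulmxA (mulKmx Ps) (mulKVmx Pt).
have phiE t s x : phi t s x = H' t (U t s *m H s x) by rewrite (HE s t) UK HK.
have diff_phi t s x : differentiable (phi t s) x.
  rewrite (_ : phi t s = H' t \o (mulmx (U t s) \o H s)); last by apply/funext => y; rewrite phiE.
  apply: differentiable_comp => //; apply: differentiable_comp => //.
  exact: differentiable_mulmx.
pose Dg t x := A t + jacobian_mx (f t) x.
have cg t x : {for (t, x), continuous (fun p : R * 'cV[R]_n.+1 => g p.1 p.2)}.
  exact: perturbed_continuous.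
have sdg := perturbed_strict_derivative A_continuous D1_C2.
have cdivg := perturbed_div_continuous A_continuous D1_C2.
have divgL := perturbed_div_lipschitz A_continuous D1_C2.
have C1J t i j : C1fun (fun x => jacobian_mx (H t) x i j) by exact: C2_jacobian_C1fun.
have C1h t : C1fun (fun x => \det (jacobian_mx (H t) x)) by exact: C1fun_det.
have det_comp s t x : \det (jacobian_mx (H s) x) =
    \det (U s t) * \det (jacobian_mx (H t) (phi t s x)) * \det (jacobian_mx (phi t s) x).
  by rewrite (jacobian_conjugacy diff_phi HE dH s t) !det_mulmx mulrA.
(* Solving [det_comp] for the determinant of the flow writes it as a quotient of functions
   differentiable in [x], which avoids differentiating the Jacobian of the flow entrywise. *)
have diff_delta t s x : differentiable (fun y => \det (jacobian_mx (phi t s) y)) x.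
  have dh u y : differentiable (fun y => \det (jacobian_mx (H u) y)) y by have [] := C1h u.
  have nz y : \det (U s t) * \det (jacobian_mx (H t) (phi t s y)) != 0.
    by rewrite mulf_neq0 ?(det_transition_neq0 PsiP)// gt_eqF.
  rewrite (_ : (fun y => _) = (fun y => \det (jacobian_mx (H s) y)) *
    (fun y => (\det (U s t) * \det (jacobian_mx (H t) (phi t s y)))^-1)); last first.
    by apply/funext => y; apply: (mulfI (nz y)); rewrite -det_comp fctE mulrCA mulfV// mulr1.
  apply: differentiableM => //; apply: differentiableV => //.
  apply: differentiableM => //.
  exact: (differentiable_comp (g := fun y => \det (jacobian_mx (H t) y))).
have dU := is_derive_transition_mx PsiP.
have U1 := transition_mx1 PsiP.
have C1_H := conjugacy_C1 L_ge0 gL phiP g0 cg diff_phi A_continuous dU U1 HE dH C1J.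
have C1_h := conjugacy_det_C1 L_ge0 gL phiP g0 cg sdg diff_phi divgL cdivg diff_delta
  A_continuous dU U1 HE dH C1J.
have dtH := is_derive_conjugacy L_ge0 gL phiP g0 cg dU U1 HE dH.
have dth := is_derive_conjugacy_det L_ge0 gL phiP g0 cg sdg diff_phi dU U1 HE dH C1J.
have H0 t : H t 0 = 0.
  apply: (bounded_linear_solution_eq0 PsiP L1_ge0 AL vnormP mnormP K_ge1 alpha_gt0 H3
    (M := bound) (y := fun t => H t 0)) => [u|].
    by have := H_bound u 0; rewrite subr0.
  apply: (H_solution (cst 0)) => u _; rewrite -[perturbed_system A f]/g [g _ _]g0.
  exact: is_derive_cst.
have H_neq0 t x : x != 0 -> H t x != 0.
  by apply: contra_neq => Hx0; rewrite -(HK t x) Hx0 -(H0 t) HK.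
have [_ C1_rho rho_ge0 rho_int rho_ae] := rhoP.
have jac_g t x : jacobian_mx (g t) x = Dg t x by exact: jacobian_perturbed.
split.
- split=> [//|t0 z0|a b t0 z w t0ab dz dw zw t tab].
    by exists (fun t => phi t t0 z0); exact: phiP.
  (* The two solutions are given on an open interval only; uniqueness is applied on the closed
     segment joining [t0] and [t]. *)
  have sub (u : R) : Num.min t0 t <= u <= Num.max t0 t -> u \in `]a, b[.
    move: t0ab tab; rewrite !in_itv/= => /andP[? ?] /andP[? ?] /andP[u1 u2].
    by rewrite (lt_le_trans _ u1) ?lt_min ?(le_lt_trans u2) ?gt_max//; apply/andP.
  apply: (@solution_unique _ _ g L L_ge0 gL z w (Num.min t0 t) (Num.max t0 t) t0) => //.
  + by move=> u /sub; exact: dz.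
  + by move=> u /sub; exact: dw.
  + by rewrite ge_min le_max !lexx.
  + by rewrite ge_min le_max !lexx !orbT.
- exact: (transported_density_C1 C1_H C1_h H_neq0 C1_rho).
- by move=> t z z0; rewrite mulr_ge0 ?(ltW (det_gt0 _ _))// rho_ge0// H_neq0.
- move=> t r r0.
  (* Continuity of the inverse at 0 shows that [H t] sends the complement of the ball of radius [r]
     outside some ball of radius [r'], where [rho t] is integrable; [r / 2] provides a strict
     inequality. *)
  have [r' r'0 hr'] : exists2 r' : R, 0 < r' & forall y, `|y - 0| < r' -> `|H' t y - H' t 0| <= r / 2.
    by apply: continuous_eps; [exact: differentiable_continuous|rewrite divr_gt0].
  have H'0 : H' t 0 = 0 by rewrite -(H0 t) HK.
  have mb (s : R) : measurable (~` ball (0 : 'cV[R]_n.+1) s) by apply: measurableC; exact: measurable_ball_cV.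
  apply: (integrableS (E := H t @^-1` ~` ball 0 r')).
  + by apply: measurable_preimage_setT; [exact: measurable_differentiable|exact: mb].
  + exact: mb.
  + move=> x xr /=; apply: contra_not xr; rewrite -!ball_normE/= !sub0r !normrN.
    by have := hr' (H t x); rewrite !subr0 H'0 subr0 HK => h /h; lra.
  + apply: (integrable_diffeo (HK t) (H'K t)) => //; last exact: rho_int.
    by move=> x; apply: differentiable_continuous; have [] := C1h t.
- move=> t; have cdet : continuous (fun x => \det (jacobian_mx (H t) x)).
    by move=> x; apply: differentiable_continuous; have [] := C1h t.
  have := negligible_diffeo (HK t) (H'K t) (dH t) (dH' t) cdet (det_gt0 t) (rho_ae t).
  (* The transport identity holds only off the origin, so the origin joins the exceptional set. *)
  move=> /(negligibleU (negligible_origin R n)); apply: negligibleS => x /= hx.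
  have [->|x0] := eqVneq x 0; [by left|right] => h.
  apply: hx; rewrite (transported_density_transport jac_g C1_H C1_h dtH dth H_neq0 C1_rho)//.
  by rewrite mulr_gt0.
Qed.
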